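(* (1) Let $C$ be any smooth two-dimensional immersed submanifold of $Q\setminus 0_Q$ such that $(d\omega)|_C=0$, i.e. such that the restriction $\omega|_C$ is closed, and assume that $C$ is transversal to the fibers of the projection $\pi:Q\to S$. Then, after a choice of base points $q_0\in C$, $x_0\in\mathbb{R}^3$, the formula $\phi(q_1)=x_0+\int_{q_0}^{q_1}\omega$ (integral along smooth curves in $C$ from $q_0$ to $q_1$; on a simply connected open subset $C_0$ the value is continued along curves in $C_0$) defines an embedding $\phi$ from each simply connected open subset $C_0$ of $C$ onto a smooth two-dimensional submanifold $M_0$ of $\mathbb{R}^3$. There is a unique orientation of $M_0$ such that $n(\phi(q))=\pi(q)$ for every $q\in C_0$; with this orientation the inverse of $\phi$ is equal to $n':M_0\to Q$, and $M_0$ is a minimal surface (with nowhere vanishing Gauss curvature, because $n'(M_0)=C_0\subset Q\setminus 0_Q$). (2) Conversely, let $M$ be an oriented minimal surface in $\mathbb{R}^3$ with nowhere vanishing Gauss curvature. Then every $x_0\in M$ has a connected open neighborhood $M_0$ in $M$ such that $n'$ is a diffeomorphism from $M_0$ onto a smooth two-dimensional submanifold $C_0$ of $Q\setminus 0_Q$ that is transversal to the fibers of $\pi$, $\omega|_{C_0}$ is closed, and $(n'|_{M_0})^{-1}(q_1)=x_0+\int_{q_0}^{q_1}\omega$ for all $q_1\in C_0$, where $q_0=n'(x_0)$ and the integral is along any smooth curve in $C_0$ from $q_0$ to $q_1$. In this way the mapping $n'$ establishes a local equivalence between the minimal surfaces in $\mathbb{R}^3$ with nonvanishing curvature, modulo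 translations, and the two-dimensional smooth submanifolds $C$ of $Q\setminus 0_Q$ such that $\omega|_C$ is closed and $C$ is transversal to the fibers of the projection $\pi:Q\to S$.
   Context: $S=\{s\in\mathbb{R}^3:\|s\|=1\}$, and $T_sS=s^\perp\subset\mathbb{R}^3$. For $s\in S$, $Q_s$ is the real two-dimensional vector space of linear maps $q:T_sS\to T_sS$ that are symmetric (for the Euclidean inner product) and have trace zero; every nonzero $q\in Q_s$ is invertible. The $Q_s$ form a smooth rank two real vector bundle $\pi:Q\to S$ with zero section $0_Q$. On $Q\setminus 0_Q$ the $\mathbb{R}^3$-valued one-form $\omega$ (''$q^{-1}\,ds$'') is defined by $\omega_q(v)=q^{-1}(T_q\pi(v))\in T_sS\subset\mathbb{R}^3$ for $q\in Q_s\setminus\{0\}$, $v\in T_qQ$. For an oriented smooth surface $M$ in $\mathbb{R}^3$, $n:M\to S$ is the Gauss map (oriented unit normal), and $n'(x)$ denotes the tangent map $T_xn:T_xM\to T_{n(x)}S$ viewed as a symmetric endomorphism of $T_{n(x)}S$, using that $T_xM=n(x)^\perp=T_{n(x)}S$ as linear subspaces of $\mathbb{R}^3$. $M$ is a minimal surface iff $\operatorname{trace} n'(x)=0$ for all $x\in M$; then $n'$ is a smooth map $M\to Q$ with $\pi\circ n'=n$, and the Gauss curvature is $K(x)=\det n'(x)\le 0$.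
   Formalization: In (1), φ on C_0 is claimed only to be a diffeomorphism onto an immersed surface and locally an embedding, since φ need not be injective (Enneper's surface); the claims for the subset M_0=φ(C_1) of R^3 are made for open C_1 in C_0 on which φ is an embedding. *)

(* Defs.v *)
From HB Require Import structures.
From mathcomp Require Import all_boot all_order all_algebra.
From mathcomp Require Import all_classical all_reals all_analysis.

Set Implicit Arguments.
Unset Strict Implicit.
Unset Printing Implicit Defensive.
Import Order.TTheory GRing.Theory Num.Theory.
Import numFieldNormedType.Exports.
Local Open Scope classical_set_scope.
Local Open Scope ring_scope.

Section Smooth.
Context {R : realType} {E V : normedModType R}.
Implicit Types (U : set E) (f : E -> V).

Fixpoint Ck (k : nat) U f : Prop :=
  if k is k'.+1 then
    (forall x, U x -> differentiable f x) /\ forall v, Ck k' U ('D_v f)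
  else forall x, U x -> {for x, continuous f}.

(* Only used for open U. *)
Definition smooth_on U f := forall k, Ck k U f.

End Smooth.

(* A two-dimensional immersed submanifold of a normed space V is a topological
   space with a map f into V such that f is, in suitable local parametrizations
   p by open subsets of R^2, a smooth immersion.  The smooth structure is the
   one for which these p are the (inverse) charts: two such parametrizations
   differ by a diffeomorphism because f is an immersion.  f need not be
   injective.  Everything is relative to an open subset D of the space.  An
   embedded submanifold A of V is the case of [subspace A], D = A, f = id. *)
Section Surfaces.
Context {R : realType} {T : topologicalType} {V : normedModType R}.
Implicit Types (D : set T) (f : T -> V).

Definition chart D f (U : set 'rV[R]_2) (p : 'rV[R]_2 -> T) : Prop :=
  [/\ open U,
      (forall u, U u -> {for u, continuous p}) /\ set_inj U p,
      forall W, open W -> W `<=` U -> open (p @` W),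
      p @` U `<=` D &
      smooth_on U (f \o p) /\
      forall u w, U u -> 'D_w (f \o p) u = 0 -> w = 0].

Definition surface D f : Prop :=
  hausdorff_space T /\
  forall x, D x -> exists U p, chart D f U p /\ (p @` U) x.

Definition tangent D f (x : T) (v : V) : Prop :=
  exists U p u w, [/\ chart D f U p, U u, p u = x & 'D_w (f \o p) u = v].

Definition smooth_curve D f (g : R -> T) (a b : T) : Prop :=
  [/\ g 0 = a, g 1 = b &
    exists J : set R, [/\ open J, `[0, 1]%classic `<=` J,
      forall t, J t -> {for t, continuous g} /\ D (g t) &
      smooth_on J (f \o g)]].

End Surfaces.

Section Maps.
Context {R : realType} {T T' : topologicalType} {V V' : normedModType R}.

Definition smooth_map (D : set T) (f : T -> V) (f' : T' -> V') (h : T -> T')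
    : Prop :=
  (forall x, D x -> {for x, continuous h}) /\
  forall U p, chart D f U p -> smooth_on U (f' \o h \o p).

End Maps.

Definition diffeo (R : realType) (T T' : topologicalType)
    (V V' : normedModType R) (D : set T) (f : T -> V)
    (D' : set T') (f' : T' -> V') (h : T -> T') : Prop :=
  [/\ set_bij D D' h, smooth_map D f f' h &
    exists g : T' -> T, [/\ (forall x, D x -> g (h x) = x),
      (forall y, D' y -> h (g y) = y) & smooth_map D' f' f g]].

Definition topological_embedding (T V : topologicalType) (D : set T)
    (f : T -> V) : Prop :=
  [/\ (forall x, D x -> {for x, continuous f}), set_inj D f &
    forall W, open W -> W `<=` D ->
      exists2 O : set V, open O & f @` W = f @` D `&` O].

Definition simply_connected (R : realType) (T : topologicalType)
    (D : set T) : Prop :=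
  (forall a b, D a -> D b -> exists g : R -> T,
     [/\ {within `[0, 1], continuous g},
         (forall t : R, t \in `[0, 1] -> D (g t)), g 0 = a & g 1 = b]) /\
  (forall g : R -> T, {within `[0, 1], continuous g} ->
     (forall t : R, t \in `[0, 1] -> D (g t)) -> g 0 = g 1 ->
     exists H : R * R -> T,
       [/\ {within `[0, 1] `*` `[0, 1], continuous H},
           (forall s t : R, s \in `[0, 1] -> t \in `[0, 1] -> D (H (s, t))),
           (forall t : R, t \in `[0, 1] -> H (0, t) = g t /\ H (1, t) = g 0) &
           (forall s : R, s \in `[0, 1] -> H (s, 0) = g 0 /\ H (s, 1) = g 0)]).

(* T_x A for an embedded submanifold A of V. *)
Definition tangent_set (R : realType) (V : normedModType R) (A : set V)
    (x v : V) : Prop :=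
  exists (g : R -> V) (J : set R),
    [/\ open J, J 0, smooth_on J g, (forall t, J t -> A (g t)) &
        g 0 = x /\ derive1 g 0 = v].

(* An endomorphism q of s^\perp is encoded as the 3x3 matrix, acting on row
   vectors by right multiplication, that extends it by 0 on the line R s. *)
Notation ambient R := ('rV[R]_3 * 'M[R]_3)%type.

Section Q.
Context {R : realType}.
Implicit Types (s v : 'rV[R]_3) (q : 'M[R]_3).

Definition dot (u v : 'rV[R]_3) : R := (u *m v^T) 0 0.

Definition Qbundle : set (ambient R) :=
  [set y | [/\ dot y.1 y.1 = 1, y.2^T = y.2, \tr y.2 = 0 & y.1 *m y.2 = 0]].

Definition Qnz : set (ambient R) := [set y | Qbundle y /\ y.2 != 0].

Definition fiber s : set (ambient R) := [set y | Qbundle y /\ y.1 = s].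

(* q on s^\perp and the identity on R s: its determinant and its inverse are,
   on s^\perp, those of the endomorphism q of s^\perp. *)
Definition plus_id s q : 'M[R]_3 := q + s^T *m s.

(* v = (ds, dq) is tangent to Q at y = (s, q), and v.1 is its projection to
   T_s S. *)
Definition omega (y v : ambient R) : 'rV[R]_3 := v.1 *m invmx (plus_id y.1 y.2).

Definition path_integral (c : R -> ambient R) : 'rV[R]_3 :=
  \row_i \int[lebesgue_measure]_(t in `[0, 1]) omega (c t) (derive1 c t) 0 i.

End Q.

Section OneForms.
Context {R : realType}.

Definition pullback (V W : normedModType R) (al : V -> V -> W)
    (F : 'rV[R]_2 -> V) : 'rV[R]_2 -> 'rV[R]_2 -> W :=
  fun u w => al (F u) ('D_w F u).

(* Constant vector fields v, w commute, so d al (v, w) has no bracket term. *)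
Definition ext_deriv (E W : normedModType R) (al : E -> E -> W) (u v w : E)
    : W :=
  'D_v (al ^~ w) u - 'D_w (al ^~ v) u.

Definition omega_closed (T : topologicalType) (D : set T)
    (i : T -> ambient R) : Prop :=
  forall U p, chart D i U p -> forall u v w, U u ->
    ext_deriv (pullback omega (i \o p)) u v w = 0.

Definition transverse (T : topologicalType) (D : set T)
    (i : T -> ambient R) : Prop :=
  forall q, D q -> forall v, tangent_set Qbundle (i q) v ->
    exists c k, [/\ tangent D i q c, tangent_set (fiber (i q).1) (i q) k &
                    v = c + k].

End OneForms.

(* An orientation assigns to each point the set of its positive frames. *)
Section Gauss.
Context {R : realType} {T : topologicalType}.
Implicit Types (D : set T) (f : T -> 'rV[R]_3).
Implicit Types (o : T -> set ('rV[R]_3 * 'rV[R]_3)).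

Definition positive_frames f (p : 'rV[R]_2 -> T) (u : 'rV[R]_2)
    : set ('rV[R]_3 * 'rV[R]_3) :=
  let e (i : 'I_2) := 'D_(delta_mx 0 i) (f \o p) u in
  [set b | exists A : 'M[R]_2, [/\ 0 < \det A,
     b.1 = \sum_i A 0 i *: e i & b.2 = \sum_i A 1 i *: e i]].

Definition orientation D f o : Prop :=
  forall x, D x -> exists U p, [/\ chart D f U p, (p @` U) x &
    forall u, U u -> o (p u) = positive_frames f p u].

Definition det3 (a b c : 'rV[R]_3) : R :=
  \det (col_mx a (col_mx b c) : 'M[R]_3).

Definition gauss_map o (x : T) : 'rV[R]_3 :=
  xget 0 [set n | dot n n = 1 /\ forall b, o x b ->
    [/\ dot n b.1 = 0, dot n b.2 = 0 & 0 < det3 b.1 b.2 n]].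

(* n'(x), as the pair of its base point n(x) and the tangent map of n at x. *)
Definition gauss_diff D f o (x : T) : ambient R :=
  (gauss_map o x,
   xget 0 [set A | gauss_map o x *m A = 0 /\
     forall U p u w, chart D f U p -> U u -> p u = x ->
       'D_w (f \o p) u *m A = 'D_w (gauss_map o \o p) u]).

Definition minimal_surface D f o : Prop :=
  [/\ surface D f, orientation D f o &
      forall x, D x -> \tr (gauss_diff D f o x).2 = 0].

Definition gauss_curvature D f o (x : T) : R :=
  let N := gauss_diff D f o x in \det (plus_id N.1 N.2).

End Gauss.

(* Phi is a diffeomorphism from the surface (D, i) in Q \ 0 onto the surface
   (D', j) in R^3, which has a unique orientation with Gauss map pi \o Phi^-1;
   for it, n' is inverse to Phi, and (D', j) is minimal with K <> 0. *)
Definition parametrizes_minimal (R : realType) (T T' : topologicalType)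
    (D : set T) (i : T -> ambient R) (D' : set T') (j : T' -> 'rV[R]_3)
    (Phi : T -> T') : Prop :=
  [/\ surface D' j, diffeo D i D' j Phi &
   exists o, [/\
     orientation D' j o /\ (forall q, D q -> gauss_map o (Phi q) = (i q).1),
     forall o', orientation D' j o' ->
       (forall q, D q -> gauss_map o' (Phi q) = (i q).1) ->
       forall x, D' x -> o' x = o x,
     forall q, D q -> gauss_diff D' j o (Phi q) = i q,
     minimal_surface D' j o &
     forall x, D' x -> gauss_curvature D' j o x != 0]].

(* Main.v *)
From HB Require Import structures.
Require Import Defs.
From mathcomp Require Import all_boot all_order all_algebra.
From mathcomp Require Import all_classical all_reals all_analysis.
From mathcomp Require Import ring lra.
Set Implicit Arguments.
Unset Strict Implicit.
Unset Printing Implicit Defensive.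
Import Order.TTheory GRing.Theory Num.Theory.
Import numFieldNormedType.Exports.
Local Open Scope classical_set_scope.
Local Open Scope ring_scope.

(** The notion that carries the proof is that of a primitive of omega along a
    surface (C, i) in Q \ 0 ([omega_primitive]): a map phi with
    d phi = q^-1 ds.  Since q is invertible on the plane orthogonal to s and
    ds takes its values there, the equation says that s is normal to phi and
    that ds = d phi . q ([primitive_derive]).  So, as soon as phi is an
    immersion, its Gauss map is s and its shape operator is q, which is
    symmetric, of trace zero and nonsingular: phi is a minimal immersion of
    nonzero curvature and n' is inverse to it ([primitive_parametrizes]).
    That phi is an immersion amounts to s being one, and this is what
    transversality to the fibers means ([transverse_projection_immersion]).

    Primitives exist locally because omega is closed along C
    ([closed_primitive]), and are continued along paths; on a simply
    connected open set the result is independent of the path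
    ([global_continuation]), and it is the integral of omega along any smooth
    curve ([path_integral_primitive]).  So closed transverse
    surfaces integrate to minimal surfaces.

    Conversely, for a minimal surface f with nonzero curvature, dn = df . n'
    can be solved for df, so that f is a primitive of omega along n'
    ([immersion_primitive]).  Then omega pulls back to df, which is closed by
    the symmetry of second derivatives, n and n' are immersions, and
    transversality holds because every base direction is already reached
    along the surface ([gauss_diff_transverse]).  On a small ball of a chart
    n' is an embedding, and the properties pass to its image.
    Two surfaces with the same n' are primitives of the same form, so they
    differ by a translation ([equal_gauss_diff_translation]).

    Charts refer to immersions of open subsets of the plane, and the fact
    behind every change of charts is [factor_smooth]: a continuous map t is
    smooth if F o t is smooth for some smooth immersion F.  It allows
    smoothness and derivatives along a surface to be tested in a single chart
    around each point ([smooth_along], [derive_along]). *)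

(** * Calculus of smooth functions *)

Section Calculus.
Context {R : realType}.
Implicit Types (E V W : normedModType R).

Lemma open_near (T : topologicalType) (U : set T) x : open U -> U x ->
  \forall y \near x, U y.
Proof. by move=> oU Ux; exact: open_nbhs_nbhs. Qed.

Lemma derive_ext E V (U : set E) (f g : E -> V) v x : open U ->
  (forall y, U y -> f y = g y) -> U x -> 'D_v f x = 'D_v g x.
Proof.
move=> oU fg Ux; apply: near_eq_derive.
by apply: filterS (open_near oU Ux) => y /fg.
Qed.

Lemma derive_add_cst E V (f : E -> V) (c : V) v x :
  'D_v (fun y => f y + c) x = 'D_v f x.
Proof.
rewrite /derive (_ : (fun h => _) = fun h => h^-1 *: ((f \o shift x) (h *: v) - f x))//.
by apply: funext => h /=; rewrite opprD addrACA subrr addr0.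
Qed.

Lemma differentiable_ext E V (U : set E) (f g : E -> V) x : open U ->
  (forall y, U y -> f y = g y) -> U x -> differentiable f x -> differentiable g x.
Proof.
move=> oU fg Ux df.
have dc := diff_continuous df.
suff E1 : g \o shift x = cst (g x) + 'd f x +o_ 0 id.
  have d0 := diff_unique dc E1.
  by apply/diff_locallyP; rewrite d0.
have := diff_locally df; rewrite (fg x Ux) => /eqaddoP H; apply/eqaddoP => e e0.
have Uyx : \forall y \near (0 : E), U (y + x).
  have c : (id y + cst x y : E) @[y --> (0 : E)] --> 0 + x.
    by apply: cvgD; [exact: cvg_id|exact: cvg_cst].
  by apply: c; rewrite add0r; exact: open_near.
apply: filterS2 Uyx (H _ e0) => y /= Uy.
by rewrite !fctE /= (fg (y + x)).
Qed.

Lemma Ck_ext k E V (U : set E) (f g : E -> V) : open U ->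
  (forall y, U y -> f y = g y) -> Ck k U f -> Ck k U g.
Proof.
move=> oU; elim: k f g => [|k IH] f g fg /=.
  move=> cf x Ux; have := cf x Ux; rewrite /prop_for /continuous_at.
  rewrite -(fg x Ux); apply: cvg_trans.
  by apply: near_eq_cvg; apply: filterS (open_near oU Ux) => y Uy; rewrite fg.
move=> [df Df]; split=> [x Ux|v].
  exact: differentiable_ext fg Ux (df x Ux).
by apply: IH (Df v) => y Uy; exact: derive_ext oU fg Uy.
Qed.

Lemma Ck_sub k E V (U U' : set E) (f : E -> V) : U' `<=` U ->
  Ck k U f -> Ck k U' f.
Proof.
move=> sU; elim: k f => [|k IH] f /=; first by move=> cf x /sU /cf.
by move=> [df Df]; split=> [x /sU /df //|v]; exact: IH.
Qed.

Lemma Ck_local k E V (U : set E) (f : E -> V) :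
  (forall x, U x -> exists2 W, W x & Ck k W f) -> Ck k U f.
Proof.
elim: k f => [|k IH] f /=; first by move=> H x /H[W Wx]; apply.
move=> H; split=> [x /H[W Wx []]|v]; first by move=> + _; apply.
by apply: IH => x /H[W Wx [_ Df]]; exists W.
Qed.

Lemma Ck_continuous k E V (U : set E) (f : E -> V) x : Ck k U f -> U x ->
  {for x, continuous f}.
Proof.
case: k => [|k] /=; first by move=> H /H.
by move=> [df _] Ux; apply: differentiable_continuous; exact: df.
Qed.

Lemma CkW k E V (U : set E) (f : E -> V) : Ck k.+1 U f -> Ck k U f.
Proof.
elim: k f => [|k IH] f; first by move=> /Ck_continuous.
by move=> [df Df]; split => // v; apply: IH; exact: Df.
Qed.

Lemma Ck_linear k E V W (L : {linear V -> W}) (U : set E) (f : E -> V) :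
  open U -> continuous L -> Ck k U f -> Ck k U (L \o f).
Proof.
move=> oU cL; elim: k f => [|k IH] f /=.
  by move=> cf x Ux; apply: continuous_comp; [exact: cf|exact: cL].
move=> [df Df]; split=> [x Ux|v].
  by apply: differentiable_comp; [exact: df|exact: linear_differentiable].
apply: (Ck_ext oU) (IH _ (Df v)) => y Uy /=.
rewrite [RHS]deriveE; last first.
  by apply: differentiable_comp; [exact: df|exact: linear_differentiable].
rewrite diff_comp; [|exact: df|exact: linear_differentiable].
by rewrite /= diff_lin// deriveE//; exact: df.
Qed.

Lemma Ck_cst k E V (U : set E) (a : V) : Ck k U (fun _ : E => a).
Proof.
elim: k a => [|k IH] a /=; first by move=> x _; exact: cst_continuous.
split=> [x _|v]; first exact: differentiable_cst.
rewrite (_ : 'D_v _ = fun=> 0); first exact: IH.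
by apply: funext => x; exact: derive_cst.
Qed.

Lemma Ck_id k E (U : set E) : Ck k U (@id E).
Proof.
case: k => [|k]; first by move=> x _; exact: cvg_id.
split=> [x _|v]; first by have [] := is_diff_id x.
rewrite (_ : 'D_v _ = fun=> v); first exact: Ck_cst.
by apply: funext => x; exact: derive_id.
Qed.

Lemma CkD k E V (U : set E) (f g : E -> V) : open U ->
  Ck k U f -> Ck k U g -> Ck k U (fun x => f x + g x).
Proof.
move=> oU; elim: k f g => [|k IH] f g /=.
  by move=> cf cg x Ux; apply: continuousD; [exact: cf|exact: cg].
move=> [df Df] [dg Dg]; split=> [x Ux|v].
  by apply: differentiableD; [exact: df|exact: dg].
apply: (Ck_ext oU) (IH _ _ (Df v) (Dg v)) => y Uy /=.
by rewrite deriveD//; apply: diff_derivable; [exact: df|exact: dg].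
Qed.

Lemma Ck_sum k E V (U : set E) (I : Type) (r : seq I) (P : pred I)
    (f : I -> E -> V) : open U ->
  (forall i, P i -> Ck k U (f i)) -> Ck k U (fun x => \sum_(i <- r | P i) f i x).
Proof.
move=> oU H; elim: r => [|i r IH].
  apply: (Ck_ext oU) (Ck_cst k U 0) => y _; by rewrite big_nil.
case Pi : (P i); last first.
  by apply: (Ck_ext oU) IH => y _; rewrite big_cons Pi.
apply: (Ck_ext oU) (CkD oU (H _ Pi) IH) => y _; by rewrite big_cons Pi.
Qed.

Lemma scale_bilinear V : bilinear_for
    (GRing.Scale.Law.clone _ _ *:%R _) (GRing.Scale.Law.clone _ _ *:%R _)
    (@GRing.scale R V).
Proof.
split=> [u'|u] a x y /=.
- by rewrite scalerDl scalerA.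
- by rewrite scalerDr scalerA mulrC -scalerA.
Qed.

Lemma is_diff_scale E V (s ds : E -> R) (f df : E -> V) x :
  is_diff x s ds -> is_diff x f df ->
  is_diff x (fun y => s y *: f y) (fun v => s x *: df v + ds v *: f x).
Proof.
move=> hs hf.
pose sM := bilinear_isBilinear.Build R R V V _ _ (@GRing.scale R V) (scale_bilinear V).
pose B : {bilinear R -> V -> V} := HB.pack (@GRing.scale R V) sM.
have cB : continuous (fun p : R * V => B p.1 p.2).
  by move=> p; exact: scale_continuous.
have H1 : is_diff (s x, f x) (fun q : R * V => q.1 *: q.2) (fun q => s x *: q.2 + q.1 *: f x).
  apply: DiffDef; first exact: (differentiable_bilin (f := B)).
  exact: (diff_bilin (f := B)).
have H2 := is_diff_pair hs hf.
exact: (is_diff_comp H2 H1).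
Qed.

Lemma derive_scale E V (s : E -> R) (f : E -> V) x v :
  differentiable s x -> differentiable f x ->
  differentiable (fun y => s y *: f y) x /\
  'D_v (fun y => s y *: f y) x = s x *: 'D_v f x + 'D_v s x *: f x.
Proof.
move=> ds df; have [d D] := is_diff_scale (differentiableP ds) (differentiableP df).
by split => //; rewrite !deriveE// D.
Qed.

Lemma CkZ k E V (U : set E) (s : E -> R) (f : E -> V) : open U ->
  Ck k U s -> Ck k U f -> Ck k U (fun x => s x *: f x).
Proof.
move=> oU; elim: k s f => [|k IH] s f.
  by move=> cf cg x Ux; apply: continuousZ; [exact: cf|exact: cg].
move=> Cs Cf; have [ds Ds] := Cs; have [df Df] := Cf.
have H x w (Ux : U x) := derive_scale w (ds x Ux) (df x Ux).
split=> [x Ux|v]; first by have [] := H x 0 Ux.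
apply: (Ck_ext oU) (CkD oU (IH _ _ (CkW Cs) (Df v)) (IH _ _ (Ds v) (CkW Cf))) => y Uy /=.
by have [_ ->] := H y v Uy.
Qed.

Lemma CkM k E (U : set E) (s f : E -> R) : open U ->
  Ck k U s -> Ck k U f -> Ck k U (fun x => s x * f x).
Proof. exact: CkZ. Qed.

Lemma Ck_prod k E (U : set E) (I : Type) (r : seq I) (P : pred I)
    (f : I -> E -> R) : open U ->
  (forall i, P i -> Ck k U (f i)) -> Ck k U (fun x => \prod_(i <- r | P i) f i x).
Proof.
move=> oU H; elim: r => [|i r IH].
  apply: (Ck_ext oU) (@Ck_cst k E R U 1) => y _; by rewrite big_nil.
case Pi : (P i); last first.
  by apply: (Ck_ext oU) IH => y _; rewrite big_cons Pi.
apply: (Ck_ext oU) (CkM oU (H _ Pi) IH) => y _; by rewrite big_cons Pi.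
Qed.

Lemma CkV k E (U : set E) (s : E -> R) : open U -> (forall x, U x -> s x != 0) ->
  Ck k U s -> Ck k U (fun x => (s x)^-1).
Proof.
move=> oU s0; elim: k => [|k IH].
  by move=> cs x Ux; apply: continuousV; [exact: s0|exact: cs].
move=> Cs; have [ds Ds] := Cs; split=> [x Ux|v].
  by apply: differentiableV; [exact: ds|exact: s0].
have Ci := IH (CkW Cs).
apply: (Ck_ext oU) (CkM oU (CkM oU (@Ck_cst k E R U (-1)) (CkM oU Ci Ci)) (Ds v)) => y Uy.
have := @deriveV _ _ s y v (s0 _ Uy) (diff_derivable (ds _ Uy)) => /= ->.
by rewrite /GRing.scale /= expr2 invfM mulN1r.
Qed.

Lemma Ck_sqrt k E (U : set E) (s : E -> R) : open U -> (forall x, U x -> 0 < s x) ->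
  Ck k U s -> Ck k U (fun x => Num.sqrt (s x)).
Proof.
move=> oU s0; elim: k => [|k IH].
  by move=> cs x Ux; apply: continuous_comp; [exact: cs|exact: sqrt_continuous].
move=> Cs; have [ds Ds] := Cs.
have dq (x : R) : 0 < x -> differentiable (@Num.sqrt R) x.
  by move=> x0; apply/derivable1_diffP; have [] := is_derive1_sqrt x0.
split=> [x Ux|v].
  by apply: differentiable_comp; [exact: ds|exact/dq/s0].
have Ci := IH (CkW Cs).
have H x : U x -> 2 * Num.sqrt (s x) != 0.
  by move=> Ux; rewrite mulf_neq0// ?pnatr_eq0// sqrtr_eq0 -ltNge s0.
apply: (Ck_ext oU) (CkM oU (CkV oU H (CkM oU (@Ck_cst k E R U 2) Ci)) (Ds v)) => y Uy.
have [d1 d2] := is_derive1_sqrt (s0 _ Uy).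
rewrite [RHS]deriveE; last by apply: differentiable_comp; [exact: ds|exact/dq/s0].
rewrite diff_comp; [|exact: ds|exact/dq/s0] => /=.
rewrite (deriv1E d1) /= derive1E d2 deriveE; last exact: ds.
by rewrite mulrC.
Qed.

Lemma Ck_coord k E m n (U : set E) (f : E -> 'M[R]_(m, n)) i j : open U ->
  Ck k U f -> Ck k U (fun x => f x i j).
Proof.
move=> oU; pose c := fun N : 'M[R]_(m, n) => N i j.
have lc : linear (c : _ -> R^o) by move=> a x y; rewrite /c !mxE.
pose cM := GRing.isLinear.Build _ _ _ _ _ lc.
pose cL : {linear 'M[R]_(m, n) -> R^o} := HB.pack (c : _ -> R^o) cM.
exact: (Ck_linear (L := cL) oU (@coord_continuous _ _ _ _ _)).
Qed.

Lemma Ck_matrix k E m n (U : set E) (f : E -> 'M[R]_(m, n)) : open U ->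
  (forall i j, Ck k U (fun x => f x i j)) -> Ck k U f.
Proof.
move=> oU H.
apply: (Ck_ext oU (f := fun x => \sum_i \sum_j f x i j *: delta_mx i j)).
  by move=> y _; rewrite -matrix_sum_delta.
by apply: Ck_sum => // i _; apply: Ck_sum => // j _; apply: CkZ => //; exact: Ck_cst.
Qed.

Lemma Ck_pair k E V W (U : set E) (f : E -> V) (g : E -> W) : open U ->
  Ck k U f -> Ck k U g -> Ck k U (fun x => (f x, g x)).
Proof.
move=> oU Cf Cg.
have l1 : linear (fun v : V => (v, 0 : W)).
  by move=> a x y; congr pair; rewrite /= ?[a *: (0, _)]/(0, _) ?scaler0 ?addr0.
have l2 : linear (fun w : W => (0 : V, w)).
  by move=> a x y; congr pair; rewrite /= ?[a *: (0, _)]/(0, _) ?scaler0 ?addr0.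
pose m1 := GRing.isLinear.Build _ _ _ _ _ l1.
pose m2 := GRing.isLinear.Build _ _ _ _ _ l2.
pose L1 : {linear V -> (V * W)%type} := HB.pack (fun v : V => (v, 0 : W)) m1.
pose L2 : {linear W -> (V * W)%type} := HB.pack (fun w : W => (0 : V, w)) m2.
have c1 : continuous L1.
  by move=> x; apply: (@cvg_pair _ _ _ (nbhs x)); [exact: cvg_id|exact: cvg_cst].
have c2 : continuous L2.
  by move=> x; apply: (@cvg_pair _ _ _ (nbhs x)); [exact: cvg_cst|exact: cvg_id].
apply: (Ck_ext oU) (CkD oU (Ck_linear oU c1 Cf) (Ck_linear oU c2 Cg)) => y _ /=.
by congr pair; rewrite ?addr0 ?add0r.
Qed.

Lemma Ck_fst k E V W (U : set E) (f : E -> V * W) : open U ->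
  Ck k U f -> Ck k U (fun x => (f x).1).
Proof. by move=> oU; apply: (Ck_linear (L := fst)) => // x; exact: cvg_fst. Qed.

Lemma Ck_snd k E V W (U : set E) (f : E -> V * W) : open U ->
  Ck k U f -> Ck k U (fun x => (f x).2).
Proof. by move=> oU; apply: (Ck_linear (L := snd)) => // x; exact: cvg_snd. Qed.

Lemma Ck_mulmx k E m n p (U : set E) (f : E -> 'M[R]_(m, n)) (g : E -> 'M[R]_(n, p)) :
  open U -> Ck k U f -> Ck k U g -> Ck k U (fun x => f x *m g x).
Proof.
move=> oU Cf Cg; apply: Ck_matrix => // i j.
apply: (Ck_ext oU (f := fun x => \sum_l f x i l * g x l j)).
  by move=> y _; rewrite mxE.
by apply: Ck_sum => // l _; apply: CkM => //; exact: Ck_coord.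
Qed.

Lemma Ck_trmx k E m n (U : set E) (f : E -> 'M[R]_(m, n)) :
  open U -> Ck k U f -> Ck k U (fun x => (f x)^T).
Proof.
move=> oU Cf; apply: Ck_matrix => // i j.
apply: (Ck_ext oU (f := fun x => f x j i)); first by move=> y _; rewrite mxE.
exact: Ck_coord.
Qed.

Lemma Ck_det k E n (U : set E) (f : E -> 'M[R]_n) : open U ->
  Ck k U f -> Ck k U (fun x => \det (f x)).
Proof.
move=> oU Cf; apply: Ck_sum => // s _; apply: CkM => //; first exact: Ck_cst.
by apply: Ck_prod => // i _; exact: Ck_coord.
Qed.

(** Cramer's rule: the entries of the inverse are polynomials in the entries
    divided by the determinant. *)
Lemma Ck_invmx k E n (U : set E) (f : E -> 'M[R]_n) : open U ->
  (forall x, U x -> f x \in unitmx) -> Ck k U f -> Ck k U (fun x => invmx (f x)).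
Proof.
move=> oU fu Cf.
apply: (Ck_ext oU (f := fun x => (\det (f x))^-1 *: \adj (f x))).
  by move=> y Uy; rewrite /invmx fu.
apply: CkZ => //.
  apply: CkV => //; last exact: Ck_det.
  by move=> x /fu; rewrite unitmxE unitfE.
apply: Ck_matrix => // i j.
apply: (Ck_ext oU (f := fun x => cofactor (f x) j i)) => [y _|]; first by rewrite mxE.
apply: CkM => //; first exact: Ck_cst.
apply: Ck_det => //; apply: Ck_matrix => // a b.
apply: (Ck_ext oU) (Ck_coord (lift j a) (lift i b) oU Cf) => y _.
by rewrite !mxE.
Qed.

(** By the chain rule a derivative of f o t is a sum of coordinates of
    derivatives of t times partial derivatives of f composed with t, which
    are compositions of lower order. *)
Lemma Ck_comp k E n V (U : set E) (U' : set 'rV[R]_n) (t : E -> 'rV[R]_n)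
    (f : 'rV[R]_n -> V) : open U -> (forall x, U x -> U' (t x)) ->
  Ck k U' f -> Ck k U t -> Ck k U (f \o t).
Proof.
move=> oU tU; elim: k f t tU => [|k IH] f t tU.
  move=> cf ct x Ux; apply: continuous_comp; first exact: ct.
  exact/cf/tU.
move=> [df Df] Ct; have [dt Dt] := Ct.
split=> [x Ux|v].
  by apply: differentiable_comp; [exact: dt|exact/df/tU].
apply: (Ck_ext oU (f := fun x => \sum_i ('D_v t x) 0 i *: ('D_(delta_mx 0 i) f \o t) x)).
  move=> y Uy /=; rewrite [RHS]deriveE; last first.
    by apply: differentiable_comp; [exact: dt|exact/df/tU].
  rewrite diff_comp; [|exact: dt|exact/df/tU] => /=.
  have df_ := df _ (tU _ Uy).
  rewrite -(deriveE _ (dt _ Uy)).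
  rewrite [in RHS](row_sum_delta ('D_v t y)) linear_sum /=; apply: eq_bigr => i _.
  by rewrite linearZ /= -(deriveE _ df_).
apply: Ck_sum => // i _; apply: CkZ => //.
  exact: Ck_coord oU (Dt v).
exact: IH tU (Df _) (CkW Ct).
Qed.

End Calculus.

(** * Mean values and mixed second derivatives *)

Section Analysis.
Context {R : realType}.
Implicit Types (E V W : normedModType R).

Lemma open_normP E (U : set E) (x : E) : open U -> U x ->
  exists2 r : R, 0 < r & forall y, `|y - x| < r -> U y.
Proof.
move=> oU Ux; have /nbhs_ballP[r /= r0 H] := open_nbhs_nbhs (conj oU Ux).
by exists r => // y yx; apply: H; rewrite -ball_normE /= distrC.
Qed.

Lemma open_norm_ball E (c : E) (r : R) : open [set x : E | `|x - c| < r].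
Proof.
rewrite (_ : [set x | _] = ball c r); first exact: ball_open.
by apply/seteqP; split => u; rewrite -ball_normE /= distrC.
Qed.

Lemma near_normP E (x : E) (P : E -> Prop) : (\forall y \near x, P y) ->
  exists2 r : R, 0 < r & forall y, `|y - x| < r -> P y.
Proof.
move=> /nbhs_ballP[r /= r0 H]; exists r => // y yx; apply: H.
by rewrite -ball_normE /= distrC.
Qed.

Lemma near_norm E (x : E) (P : E -> Prop) (r : R) : 0 < r ->
  (forall y, `|y - x| < r -> P y) -> \forall y \near x, P y.
Proof.
move=> r0 H; apply/nbhs_ballP; exists r => // y; rewrite -ball_normE /= => yx.
by apply: H; rewrite distrC.
Qed.

Lemma near_close E V (f : E -> V) (x : E) (e : R) : {for x, continuous f} ->
  0 < e -> \forall y \near x, `|f y - f x| <= e.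
Proof.
move=> cf e0; move/cvgrPdist_le: cf => /(_ e e0).
by apply: filterS => y; rewrite distrC.
Qed.

Lemma diff_epsilon E V (f : E -> V) (x : E) (e : R) : differentiable f x ->
  0 < e -> exists2 r : R, 0 < r &
    forall y, `|y - x| < r -> `|f y - f x - 'd f x (y - x)| <= e * `|y - x|.
Proof.
move=> /diff_locally /eqaddoP H e0; have /near_normP[r r0 Hr] := H _ e0.
exists r => // y yx; have := Hr (y - x); rewrite subr0 => /(_ yx) /=.
by rewrite !fctE /= subrK opprD addrA.
Qed.

Lemma epsilon_diff E V (f : E -> V) (L : {linear E -> V}) (x : E) :
  continuous L ->
  (forall e : R, 0 < e -> exists2 r : R, 0 < r &
    forall y, `|y - x| < r -> `|f y - f x - L (y - x)| <= e * `|y - x|) ->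
  differentiable f x /\ forall v, 'D_v f x = L v.
Proof.
move=> cL H.
have E1 : f \o shift x = cst (f x) + L +o_ 0 id.
  apply/eqaddoP => e e0; have [r r0 Hr] := H e e0.
  apply: (near_norm r0) => y; rewrite subr0 => yr /=.
  have := Hr (y + x); rewrite addrK => /(_ yr).
  by rewrite !fctE /= opprD addrA.
have dE := diff_unique cL E1.
have df : differentiable f x by apply/diff_locallyP; rewrite dE.
by split=> // v; rewrite deriveE// dE.
Qed.

Lemma rV_linear_continuous n V (L : {linear 'rV[R]_n -> V}) : continuous L.
Proof.
have -> : (L : 'rV[R]_n -> V) = fun v => \sum_i v 0 i *: L (delta_mx 0 i).
  apply: funext => v; rewrite {1}(row_sum_delta v) linear_sum /=.
  by apply: eq_bigr => i _; rewrite linearZ.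
move=> v.
suff H : Ck 0 setT (fun v : 'rV[R]_n => \sum_i v 0 i *: L (delta_mx 0 i)).
  exact: H.
apply: Ck_sum => [|i _]; first exact: openT.
apply: CkZ; [exact: openT| |exact: Ck_cst].
exact: Ck_coord openT (Ck_id _ _).
Qed.

Lemma is_derive_line E V (f : E -> V) (x h : E) (t : R) :
  differentiable f (x + t *: h) ->
  is_derive t 1 (fun s : R => f (x + s *: h)) ('D_h f (x + t *: h)).
Proof.
move=> df.
have H1 : is_diff t (fun s : R => x + s *: h) (fun s => s *: h).
  have H2 := is_diffD (is_diff_cst x t) (is_diff_scalel t h).
  move: H2; rewrite (_ : cst x + _ = fun s : R => x + s *: h)//.
  by rewrite (_ : _ + _ = fun s : R => s *: h)//; apply: funext => s; rewrite !fctE add0r.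
have [d3 H3] := is_diff_comp H1 (differentiableP df).
apply: DeriveDef; first exact: diff_derivable.
by rewrite deriveE// H3 /= scale1r deriveE.
Qed.

Lemma derive_affine V (x h : V) (t : R) : 'D_1 (fun s : R => x + s *: h) t = h.
Proof.
have di : differentiable id (x + t *: h) by have [] := is_diff_id (x + t *: h).
by have [_ ->] := is_derive_line di; exact: derive_id.
Qed.

Lemma MVT_line E (f : E -> R) (x h : E) :
  (forall t : R, 0 <= t <= 1 -> differentiable f (x + t *: h)) ->
  exists2 t : R, 0 <= t <= 1 & f (x + h) - f x = 'D_h f (x + t *: h).
Proof.
move=> df.
have := @MVT_segment R (fun t => f (x + t *: h)) (fun t => 'D_h f (x + t *: h)) 0 1 ler01.
case.
- move=> t; rewrite in_itv /= => /andP[/ltW t0 /ltW t1].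
  by apply: is_derive_line; apply: df; rewrite t0 t1.
- apply: derivable_within_continuous => t; rewrite in_itv /= => t01.
  by have [] := is_derive_line (df t t01).
- move=> t; rewrite in_itv /= => t01; rewrite scale1r scale0r addr0 subr0 mulr1 => ->.
  by exists t.
Qed.

(** The mean value theorem in the direction v turns the second difference
    into t times an increment of D_v f, between two points at distance O(t)
    from x that differ by t w; the differential of D_v f at x gives this
    increment up to o(t). *)
Lemma second_difference E (f : E -> R) (U : set E) (x v w : E) (e : R) :
  open U -> Ck 2 U f -> U x -> 0 < e ->
  exists2 r : R, 0 < r & forall t, 0 < t < r ->
    `|f (x + t *: v + t *: w) - f (x + t *: v) - f (x + t *: w) + f x
      - t ^+ 2 * 'D_w ('D_v f) x| <= e * t ^+ 2.
Proof.
move=> oU [df Df] Ux e0.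
have dG : differentiable ('D_v f) x by have [+ _] := Df v; apply.
set N := `|v| + `|w| + 1.
have N0 : 0 < N by rewrite ltr_wpDl// addr_ge0.
have [r1 r10 H1] := open_normP oU Ux.
have e20 : 0 < e / (2 * N) by rewrite divr_gt0// mulr_gt0.
have [r2 r20 H2] := diff_epsilon dG e20.
exists (Num.min r1 r2 / N); first by rewrite divr_gt0// lt_min r10 r20.
move=> t /andP[t0 tr].
have small (a b : R) : 0 <= a <= t -> 0 <= b <= t ->
    `|a *: v + b *: w| <= t * N /\ t * N < Num.min r1 r2.
  move=> /andP[a0 at_] /andP[b0 bt]; split; last by rewrite -ltr_pdivlMr.
  apply: le_trans (ler_normD _ _) _; rewrite !normrZ (ger0_norm a0) (ger0_norm b0).
  rewrite /N !mulrDr mulr1.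
  have h1 : a * `|v| <= t * `|v| by rewrite ler_wpM2r.
  have h2 : b * `|w| <= t * `|w| by rewrite ler_wpM2r.
  by rewrite -[leLHS]addr0 lerD ?lerD// ltW.
have inU (a b : R) : 0 <= a <= t -> 0 <= b <= t -> U (x + a *: v + b *: w).
  move=> ha hb; have [s1 s2] := small a b ha hb.
  apply: H1; rewrite -(addrA x) addrAC subrr add0r.
  by apply: le_lt_trans s1 (lt_le_trans s2 _); rewrite ge_min lexx.
have t0t : 0 <= t <= t by rewrite lexx ltW.
have z0t : 0 <= (0 : R) <= t by rewrite lexx ltW.
pose g (s : R) := f ((x + t *: w) + s *: v) - f (x + s *: v).
have hg s : 0 <= s <= t -> is_derive s 1 g
    ('D_v f ((x + t *: w) + s *: v) - 'D_v f (x + s *: v)).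
  move=> s0t; apply: is_deriveB; apply: is_derive_line; apply: df.
    by rewrite addrAC; exact: inU.
  by rewrite -[_ + _ *: _]addr0 -(scale0r w); exact: inU.
have [xi xi0t] : exists2 xi, 0 <= xi <= t & g t - g 0 =
    ('D_v f ((x + t *: w) + xi *: v) - 'D_v f (x + xi *: v)) * (t - 0).
  have cg : {within `[0, t], continuous g}.
    by apply: derivable_within_continuous => s; rewrite in_itv /= => /hg[].
  have [|xi] := MVT_segment (ltW t0) _ cg (df := fun s => 'D_v f ((x + t *: w) + s *: v) - 'D_v f (x + s *: v)).
    by move=> s; rewrite in_itv /= => /andP[/ltW s0 /ltW st]; apply: hg; rewrite s0 st.
  by rewrite in_itv /= => ? ?; exists xi.
rewrite /g scale0r !addr0 subr0 => Eg.
rewrite (_ : _ + f x = f (x + t *: w + t *: v) - f (x + t *: v) - (f (x + t *: w) - f x)); last first.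
  by rewrite [x + t *: w + _]addrAC opprB addrA addrAC [in RHS]addrAC addrAC; ring.
rewrite Eg.
have K (b : R) : 0 <= b <= t -> `|'D_v f (x + xi *: v + b *: w) - 'D_v f x -
    'd ('D_v f) x (xi *: v + b *: w)| <= e / 2 * t.
  move=> hb; have [s1 s2] := small xi b xi0t hb.
  have := H2 (x + xi *: v + b *: w); rewrite -(addrA x) (addrAC x) subrr add0r => /(_ _)/le_trans.
  apply.
    by apply: le_lt_trans s1 (lt_le_trans s2 _); rewrite ge_min lexx orbT.
  rewrite invfM mulrA -mulrA ler_wpM2l ?divr_ge0 ?(ltW e0)//.
  by rewrite mulrC ler_pdivrMr.
have K1 := K t t0t; have K2 := K 0 z0t.
rewrite linearD !linearZ /= -(deriveE v dG) in K1.
rewrite scale0r !addr0 linearZ /= in K2.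
rewrite -(deriveE w dG) in K1.
rewrite [x + xi *: v + _]addrAC in K1.
have -> : ('D_v f (x + t *: w + xi *: v) - 'D_v f (x + xi *: v)) * t -
  t ^+ 2 * 'D_w ('D_v f) x =
  t * (('D_v f (x + t *: w + xi *: v) - 'D_v f x - (xi *: 'D_v ('D_v f) x + t *: 'D_w ('D_v f) x)) -
   ('D_v f (x + xi *: v) - 'D_v f x - xi *: 'D_v ('D_v f) x)).
  have aux (a1 a2 a3 a4 a5 s xi' : R) : (a1 - a2) * s - s ^+ 2 * a5 =
      s * ((a1 - a3 - (xi' * a4 + s * a5)) - (a2 - a3 - xi' * a4)) by ring.
  exact: aux.
rewrite normrM (gtr0_norm t0) [e * _]mulrC expr2 -mulrA ler_pM2l//.
apply: le_trans (ler_normB _ _) _.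
rewrite -(deriveE v dG) in K2.
apply: le_trans (lerD K1 K2) _.
by rewrite -mulrDl -splitr mulrC.
Qed.

Lemma two_thirds_lt (y : R) : 0 < y -> y / 3 + y / 3 < y.
Proof. by move=> *; lra. Qed.

(** The second difference is symmetric in v and w, and its quotient by t^2
    tends to both mixed derivatives. *)
Lemma schwarz E (f : E -> R) (U : set E) (x v w : E) :
  open U -> Ck 2 U f -> U x -> 'D_v ('D_w f) x = 'D_w ('D_v f) x.
Proof.
move=> oU Cf Ux; apply/eqP/negPn/negP => ne.
set d := 'D_v ('D_w f) x - 'D_w ('D_v f) x.
have d0 : 0 < `|d| by rewrite normr_gt0 subr_eq0.
have d30 : 0 < `|d| / 3 by rewrite divr_gt0.
have [r1 r10 H1] := second_difference v w oU Cf Ux d30.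
have [r2 r20 H2] := second_difference w v oU Cf Ux d30.
pose t := Num.min r1 r2 / 2.
have t0 : 0 < t by rewrite divr_gt0// lt_min r10 r20.
have tr : t < Num.min r1 r2 by rewrite ltr_pdivrMr// ltr_pMr ?lt_min ?r10 ?r20// ltr1n.
have := H1 t; have := H2 t; rewrite t0 /=.
move: tr; rewrite lt_min => /andP[tr1 tr2] /(_ tr2) K2 /(_ tr1) K1.
have := lerD K1 K2; rewrite -mulrDl => /(le_trans (ler_normB _ _)).
rewrite [x + t *: w + t *: v]addrAC.
set A := f _; set B := f _; set C := f _; set D := f _; set X := 'D_w _ _; set Y := 'D_v _ _.
have -> : A - B - C + D - t ^+ 2 * X - (A - C - B + D - t ^+ 2 * Y) = t ^+ 2 * d.
  by rewrite /d -/X -/Y; ring.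
rewrite normrM ger0_norm ?sqr_ge0// mulrC ler_pM2r ?exprn_gt0//.
by apply/negP; rewrite -ltNge; exact: two_thirds_lt.
Qed.

End Analysis.

(** * Immersions between spaces of row vectors *)

Section Immersions.
Context {R : realType}.
Implicit Types (E V W : normedModType R).

Lemma mx_norm_coord m n (A : 'M[R]_(m, n)) i j : `|A i j| <= `|A|.
Proof.
rewrite [leRHS]/Num.norm /= mx_normrE.
exact: (le_bigmax _ (fun ij : 'I_m * 'I_n => `|A ij.1 ij.2|) (i, j)).
Qed.

Lemma mx_norm_le m n (A : 'M[R]_(m, n)) (e : R) : 0 <= e ->
  (forall i j, `|A i j| <= e) -> `|A| <= e.
Proof.
move=> e0 H; rewrite [leLHS]/Num.norm /= mx_normrE.
by apply: bigmax_le => // -[i j] _.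
Qed.

Definition jac n m (F : 'rV[R]_n -> 'rV[R]_m) (u : 'rV[R]_n) : 'M[R]_(n, m) :=
  \matrix_(i, j) ('D_(delta_mx 0 i) F u) 0 j.

Lemma row_jac n m (F : 'rV[R]_n -> 'rV[R]_m) u i :
  row i (jac F u) = 'D_(delta_mx 0 i) F u.
Proof. by apply/rowP => j; rewrite !mxE. Qed.

Lemma derive_sum n V (F : 'rV[R]_n -> V) u w : differentiable F u ->
  'D_w F u = \sum_i w 0 i *: 'D_(delta_mx 0 i) F u.
Proof.
move=> dF; rewrite deriveE// {1}(row_sum_delta w) linear_sum /=.
by apply: eq_bigr => i _; rewrite linearZ deriveE.
Qed.

Lemma derive_jac n m (F : 'rV[R]_n -> 'rV[R]_m) u w : differentiable F u ->
  'D_w F u = w *m jac F u.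
Proof.
move=> dF; rewrite derive_sum// mulmx_sum_row.
by apply: eq_bigr => i _; rewrite row_jac.
Qed.

Lemma differentiable_coordf m n E (F : E -> 'M[R]_(m, n)) u i j :
  differentiable F u -> differentiable (fun x => F x i j) u.
Proof.
move=> dF; exact: (differentiable_comp dF (differentiable_coord _ i j)).
Qed.

Lemma derive_coord m n E (F : E -> 'M[R]_(m, n)) u w i j :
  differentiable F u -> 'D_w (fun x => F x i j) u = ('D_w F u) i j.
Proof.
by move=> dF; rewrite (derive_mx (diff_derivable dF)) mxE.
Qed.

Lemma segment_ball E (x y c : E) (r t : R) : 0 <= t <= 1 ->
  `|x - c| < r -> `|y - c| < r -> `|x + t *: (y - x) - c| < r.
Proof.
move=> /andP[t0 t1] xr yr.
have -> : x + t *: (y - x) - c = (1 - t) *: (x - c) + t *: (y - c).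
  rewrite scalerBl scale1r -[RHS]addrA [X in _ = _ + X]addrC -scalerBr opprB.
  by rewrite (addrA (y - c)) subrK addrAC.
apply: le_lt_trans (ler_normD _ _) _.
rewrite !normrZ (ger0_norm t0) ger0_norm ?subr_ge0//.
have [t00|tn0] := eqVneq t 0; first by rewrite t00 subr0 mul1r mul0r addr0.
apply: (@lt_le_trans _ _ ((1 - t) * r + t * r)); last by rewrite -mulrDl subrK mul1r.
apply: ler_ltD; first by rewrite ler_wpM2l ?subr_ge0// ltW.
by rewrite ltr_pM2l// lt_neqAle eq_sym tn0.
Qed.

(** The denominator is n + 1 rather than n in order to be nonzero for n = 0. *)
Lemma norm_sum_le n (x y : 'I_n -> R) (X e : R) : 0 <= X -> 0 <= e ->
  (forall i, `|x i| <= X) -> (forall i, `|y i| <= e / n.+1%:R) ->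
  `|\sum_i x i * y i| <= e * X.
Proof.
move=> X0 e0 xX ye; apply: le_trans (ler_norm_sum _ _ _) _.
apply: (@le_trans _ _ (\sum_(i < n) (X * (e / n.+1%:R)))).
  by apply: ler_sum => i _; rewrite normrM ler_pM.
rewrite sumr_const card_ord -[_ *+ n]mulr_natr -mulrA [leRHS]mulrC ler_wpM2l//.
by rewrite -mulrA ler_piMr// mulrC ler_pdivrMr ?ltr0n// mul1r ler_nat.
Qed.

(** The mean value theorem on a segment, in each coordinate of F; the ball
    is so small that every partial derivative stays within e / (n + 1) of
    its value at u0. *)
Lemma C1_uniform n m (F : 'rV[R]_n -> 'rV[R]_m) U u0 (e : R) : open U ->
  Ck 1 U F -> U u0 -> 0 < e -> exists2 r : R, 0 < r &
    (forall u, `|u - u0| < r -> U u) /\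
    forall u w, `|u - u0| < r -> `|w - u0| < r ->
      `|F u - F w - (u - w) *m jac F u0| <= e * `|u - w|.
Proof.
move=> oU [dF DF] Uu0 e0.
have [r1 r10 H1] := open_normP oU Uu0.
have en0 : 0 < e / n.+1%:R by rewrite divr_gt0// ltr0n.
have /near_normP[r2 r20 H2] : \forall u \near u0, forall k : 'I_n,
    `|'D_(delta_mx 0 k) F u - 'D_(delta_mx 0 k) F u0| <= e / n.+1%:R.
  have H k := near_close (DF (delta_mx 0 k) _ Uu0) en0.
  exact: filter_forall H.
exists (Num.min r1 r2); first by rewrite lt_min r10 r20.
split; first by move=> u; rewrite lt_min => /andP[/H1].
move=> u w ur wr; apply: mx_norm_le; first by rewrite mulr_ge0// ltW.
move=> i0 j; rewrite (ord1 i0) {i0}.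
have dline t : 0 <= t <= 1 -> `|w + t *: (u - w) - u0| < Num.min r1 r2.
  by move=> t01; exact: segment_ball.
have dU t : 0 <= t <= 1 -> U (w + t *: (u - w)).
  by move=> /dline; rewrite lt_min => /andP[/H1].
have [t t01] := @MVT_line _ _ (fun x => F x 0 j) w (u - w)
  (fun t t01 => differentiable_coordf 0 j (dF _ (dU t t01))).
rewrite [w + (u - w)]addrC subrK => E1.
have mB (A B : 'rV[R]_m) : (A - B) 0 j = A 0 j - B 0 j by rewrite !mxE.
rewrite !mB E1 derive_coord; last exact/dF/dU.
rewrite derive_jac; last exact/dF/dU.
rewrite [X in `|X - _| <= _]mxE [X in `|_ - X| <= _]mxE -sumrB.
under eq_bigr => i _ do rewrite -mulrBr.
apply: norm_sum_le => //; [exact: ltW|by move=> i; exact: mx_norm_coord|move=> i].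
have := dline t t01; rewrite lt_min => /andP[_ /H2 /(_ i)]; apply: le_trans.
have := mx_norm_coord ('D_(delta_mx 0 i) F (w + t *: (u - w)) - 'D_(delta_mx 0 i) F u0) 0 j.
by rewrite mB ![jac F _ i j]mxE.
Qed.

(** The differential acts on row vectors as w |-> w J, so its injectivity
    means that J has full row rank, that is, a right inverse. *)
Lemma jac_free n m (F : 'rV[R]_n -> 'rV[R]_m) u : differentiable F u ->
  (forall w, 'D_w F u = 0 -> w = 0) -> exists B, jac F u *m B = 1%:M.
Proof.
move=> dF inj; apply/row_freeP; rewrite -kermx_eq0.
apply/eqP/row_matrixP => i; rewrite row0; apply: inj.
by rewrite derive_jac// -row_mul mulmx_ker row0.
Qed.

Lemma mulmx_bound n m (B : 'M[R]_(n, m)) :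
  exists2 k : R, 0 < k & forall x : 'rV[R]_n, `|x *m B| <= k * `|x|.
Proof.
have c : continuous (mulmxr B : 'rV[R]_n -> 'rV[R]_m).
  exact: (@rV_linear_continuous _ _ _ (mulmxr B : {linear 'rV[R]_n -> 'rV[R]_m})).
exact: linear_lipschitz c.
Qed.

(** With J B = 1 one has u - w = (F u - F w) B - (F u - F w - (u - w) J) B,
    and near u0 the last term is at most half of |u - w|. *)
Lemma immersion_bilipschitz n m (F : 'rV[R]_n -> 'rV[R]_m) U u0 : open U ->
  Ck 1 U F -> U u0 -> (forall w, 'D_w F u0 = 0 -> w = 0) ->
  exists r c : R, [/\ 0 < r, 0 < c, (forall u, `|u - u0| < r -> U u) &
    forall u w, `|u - u0| < r -> `|w - u0| < r -> `|u - w| <= c * `|F u - F w|].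
Proof.
move=> oU CF Uu0 inj; have [dF _] := CF.
have [B JB] := jac_free (dF _ Uu0) inj.
have [k k0 kB] := mulmx_bound B.
have e0 : 0 < (2 * k)^-1 by rewrite invr_gt0 mulr_gt0.
have [r r0 [rU Hr]] := C1_uniform oU CF Uu0 e0.
exists r, (2 * k); split => //; first by rewrite mulr_gt0.
move=> u w ur wr; have H := Hr u w ur wr.
have E1 : u - w = (F u - F w) *m B - (F u - F w - (u - w) *m jac F u0) *m B.
  by rewrite -mulmxBl opprB [X in X *m B]addrC subrK -mulmxA JB mulmx1.
have : `|u - w| <= k * `|F u - F w| + 2^-1 * `|u - w|.
  rewrite {1}E1; apply: le_trans (ler_normB _ _) _; apply: lerD; first exact: kB.
  apply: le_trans (kB _) _; rewrite -ler_pdivlMl//; apply: le_trans H _.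
  by rewrite invfM mulrA [_ * 2^-1]mulrC.
set x := `|u - w|; set y := `|F u - F w|; lra.
Qed.

(** With J the Jacobian of F at t x and J B = 1, the increment t y - t x is
    (F (t y) - F (t x)) B - (F (t y) - F (t x) - (t y - t x) J) B. The first
    term has a linear part; the second is o(|t y - t x|), which is o(|y -
    x|) because F is bilipschitz near t x. *)
Lemma factor_differentiable n m E (F : 'rV[R]_n -> 'rV[R]_m) (U' : set 'rV[R]_n)
    (U : set E) (t : E -> 'rV[R]_n) (x : E) : open U' -> open U ->
  Ck 1 U' F -> U' (t x) -> (forall w, 'D_w F (t x) = 0 -> w = 0) ->
  U x -> {for x, continuous t} -> differentiable (F \o t) x ->
  differentiable t x.
Proof.
move=> oU' oU CF U't inj Ux ct dG; have [dF _] := CF.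
have [B JB] := jac_free (dF _ U't) inj.
have [k k0 kB] := mulmx_bound B.
have [r [c [r0 c0 rU Hc]]] := immersion_bilipschitz oU' CF U't inj.
have [M M0 HM] := linear_lipschitz (diff_continuous dG).
have cL : continuous ((mulmxr B : {linear 'rV[R]_m -> 'rV[R]_n}) \o ('d (F \o t) x : {linear E -> 'rV[R]_m})).
  move=> y; apply: continuous_comp; first exact: diff_continuous.
  exact: rV_linear_continuous.
have [] := @epsilon_diff R E 'rV[R]_n t _ x cL _; last by [].
move=> e e0.
have near_t (s : R) : 0 < s -> exists2 q : R, 0 < q & forall y, `|y - x| < q -> `|t y - t x| < s.
  move=> s0; move/cvgrPdist_lt: (ct) => /(_ s s0) /near_normP[q q0 Hq].
  by exists q => // y /Hq; rewrite distrC.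
have [q0 q00 Hq0] := near_t r r0.
have [q1 q10 Hq1] := diff_epsilon dG (ltr01 : 0 < (1 : R)).
have e2k : 0 < e / (2 * k) by rewrite divr_gt0// mulr_gt0.
have [q2 q20 Hq2] := diff_epsilon dG e2k.
have e3 : 0 < e / (2 * k * c * (M + 1)) by rewrite divr_gt0// !mulr_gt0// addr_gt0.
have [r3 r30 [_ H3]] := C1_uniform oU' CF U't e3.
have [q3 q30 Hq3] := near_t r3 r30.
exists (Num.min (Num.min q0 q1) (Num.min q2 q3)); first by rewrite !lt_min q00 q10 q20 q30.
move=> y; rewrite !lt_min => /andP[/andP[y0 y1] /andP[y2 y3]].
have K0 : `|t y - t x| <= c * ((M + 1) * `|y - x|).
  have := Hc (t y) (t x) (Hq0 _ y0); rewrite subrr normr0 => /(_ r0)/le_trans; apply.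
  rewrite ler_pM2l//.
  have -> : F (t y) - F (t x) = 'd (F \o t) x (y - x) + ((F \o t) y - (F \o t) x - 'd (F \o t) x (y - x)).
    by rewrite [RHS]addrC subrK.
  apply: le_trans (ler_normD _ _) _; rewrite mulrDl; apply: lerD; first exact: HM.
  exact: Hq1.
have -> : t y - t x - ((mulmxr B : {linear 'rV[R]_m -> 'rV[R]_n}) \o ('d (F \o t) x : {linear E -> 'rV[R]_m})) (y - x)
   = ((F \o t) y - (F \o t) x - 'd (F \o t) x (y - x)) *m B
     - (F (t y) - F (t x) - (t y - t x) *m jac F (t x)) *m B.
  rewrite -[RHS]mulmxBl opprB [X in _ = X *m B]addrC [X in _ = X *m B]addrA subrK.
  by rewrite [RHS]mulmxBl -mulmxA JB mulmx1.
apply: le_trans (ler_normB _ _) _.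
rewrite (splitr e) mulrDl; apply: lerD.
  apply: le_trans (kB _) _; rewrite -ler_pdivlMl//.
  apply: le_trans (Hq2 _ y2) _; rewrite invfM !mulrA.
  by rewrite [k^-1 * e]mulrC ler_wpM2r// mulrAC.
apply: le_trans (kB _) _; rewrite -ler_pdivlMl//.
have := H3 (t y) (t x) (Hq3 _ y3); rewrite subrr normr0 => /(_ r30) /le_trans; apply.
apply: le_trans (ler_wpM2l (ltW e3) K0) _.
rewrite le_eqVlt; apply/orP; left; apply/eqP.
by field; rewrite !gt_eqF ?addr_gt0.
Qed.

Lemma Ck_jac k n m (F : 'rV[R]_n -> 'rV[R]_m) U : open U -> Ck k.+1 U F ->
  Ck k U (jac F).
Proof.
move=> oU [dF DF]; apply: Ck_matrix => // i j.
apply: (Ck_ext oU) (Ck_coord 0 j oU (DF (delta_mx 0 i))) => y _.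
by rewrite mxE.
Qed.

(** Differentiating F o t gives D_v t J(t) = D_v (F o t). If J(t) B = 1 at a
    point, then J(t) B is invertible around it and D_v t = D_v (F o t) B
    (J(t) B)^-1, so that each degree of regularity of t yields the next one.
    Applied to two parametrizations of an immersed surface, this is the
    smoothness of the change of charts. *)
Lemma factor_smooth n m E (F : 'rV[R]_n -> 'rV[R]_m) (U' : set 'rV[R]_n)
    (U : set E) (t : E -> 'rV[R]_n) : open U' -> open U ->
  smooth_on U' F -> (forall u w, U' u -> 'D_w F u = 0 -> w = 0) ->
  (forall x, U x -> U' (t x)) -> (forall x, U x -> {for x, continuous t}) ->
  smooth_on U (F \o t) -> smooth_on U t.
Proof.
move=> oU' oU CF inj tU ct CG.
have dt x : U x -> differentiable t x.
  move=> Ux; apply: (factor_differentiable oU' oU (CF 1%N) (tU _ Ux)) => //.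
  - by move=> w; apply: inj; exact: tU.
  - exact: ct.
  - by have [+ _] := CG 1%N; apply.
have [dF _] := CF 1%N.
elim=> [|k IH]; first exact: ct.
split=> // v; apply: Ck_local => x0 Ux0.
have [B JB] := jac_free (dF _ (tU _ Ux0)) (fun w => inj _ w (tU _ Ux0)).
have CJt l : Ck l U t -> Ck l U (fun x => jac F (t x) *m B).
  move=> Ct; apply: Ck_mulmx => //; last exact: Ck_cst.
  exact: (Ck_comp oU tU (Ck_jac oU' (CF l.+1)) Ct).
pose W := U `&` [set x | \det (jac F (t x) *m B) != 0].
have oW : open W.
  rewrite openE => x [Ux nx].
  have cd : {for x, continuous (fun x => \det (jac F (t x) *m B))}.
    exact: (Ck_continuous (Ck_det oU (CJt 0%N (fun x Ux => ct x Ux))) Ux).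
  apply: filterI; first exact: open_near.
  exact: (cvgr_neq0 _ cd nx).
exists W; first by split => //=; rewrite JB det1 oner_neq0.
have sW : W `<=` U by move=> x [].
apply: (Ck_ext oW (f := fun x => 'D_v (F \o t) x *m B *m invmx (jac F (t x) *m B))).
  move=> x [Ux nx].
  rewrite deriveE; last by have [+ _] := CG 1%N; apply.
  rewrite diff_comp /=; [|exact: dt|exact/dF/tU].
  rewrite -(deriveE _ (dt x Ux)) -(deriveE _ (dF _ (tU _ Ux))).
  rewrite (derive_jac _ (dF _ (tU _ Ux))) -(mulmxA _ _ B) mulmxK//.
  by rewrite unitmxE unitfE.
apply: Ck_mulmx => //.
  apply: Ck_mulmx => //; last exact: Ck_cst.
  by have [_ H] := CG k.+1; exact: Ck_sub sW (H v).
apply: Ck_invmx => //; last exact: Ck_sub sW (CJt _ IH).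
by move=> x [_]; rewrite unitmxE unitfE.
Qed.

End Immersions.

(** * Primitives of closed one-forms on a ball *)

Section Primitives.
Context {R : realType}.
Implicit Types (E V W : normedModType R).
Notation mu := (@lebesgue_measure R).

Lemma zero_derive_const m n E (F : E -> 'M[R]_(m, n)) (c u v : E) (r : R) :
  (forall x, `|x - c| < r -> differentiable F x /\ forall w, 'D_w F x = 0) ->
  `|u - c| < r -> `|v - c| < r -> F u = F v.
Proof.
move=> H ur vr; apply/matrixP => i j.
have seg (t : R) : 0 <= t <= 1 -> `|v + t *: (u - v) - c| < r.
  by move=> t01; exact: segment_ball.
have [t t01] := @MVT_line _ _ (fun x => F x i j) v (u - v)
  (fun t t01 => differentiable_coordf i j (H _ (seg t t01)).1).
rewrite [v + (u - v)]addrC subrK derive_coord; last by have [] := H _ (seg t t01).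
have [_ ->] := H _ (seg t t01); rewrite mxE => /eqP.
by rewrite subr_eq0 => /eqP.
Qed.

Lemma FTC_unit_interval (f f' : R -> R) :
  (forall t : R, 0 <= t <= 1 -> is_derive t 1 f (f' t)) ->
  {within `[0, 1], continuous f'} ->
  \int[mu]_(t in `[0, 1]) f' t = f 1 - f 0.
Proof.
move=> df cf'; rewrite /Rintegral (@continuous_FTC2 _ _ f)//.
- have cf (t : R) : 0 <= t <= 1 -> {for t, continuous f}.
    by move=> /df [dft _]; apply: differentiable_continuous; exact/derivable1_diffP.
  split => [t||].
  + by rewrite in_itv /= => /andP[/ltW t0 /ltW t1]; have [] := df t; rewrite ?t0.
  + by apply: cvg_at_right_filter; apply: cf; rewrite lexx ler01.
  + by apply: cvg_at_left_filter; apply: cf; rewrite lexx ler01.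
- move=> t; rewrite in_itv /= => /andP[/ltW t0 /ltW t1].
  by have [|_ <-] := df t; rewrite ?t0// derive1E.
Qed.

(** The increment of P along the segment from u to y is, by the mean value
    theorem, the form a at an intermediate point applied to y - u;
    continuity of a at u does the rest. *)
Lemma differentiable_of_partials n (P : 'rV[R]_n -> R) (a : 'I_n -> 'rV[R]_n -> R)
    (U : set 'rV[R]_n) u : open U -> U u ->
  (forall i, {for u, continuous (a i)}) ->
  (forall v (w : 'rV[R]_n), U v ->
     is_derive (0 : R) 1 (fun h : R => P (v + h *: w)) (\sum_i w 0 i * a i v)) ->
  differentiable P u /\ forall w, 'D_w P u = \sum_i w 0 i * a i u.
Proof.
move=> oU Uu ca dP.
have lL : linear (fun w : 'rV[R]_n => \sum_i w 0 i * a i u : R^o).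
  move=> k x y; rewrite scaler_sumr -big_split /=; apply: eq_bigr => i _.
  by rewrite !mxE mulrDl -scalerAl.
pose m := GRing.isLinear.Build _ _ _ _ _ lL.
pose L : {linear 'rV[R]_n -> R^o} := HB.pack (fun w : 'rV[R]_n => \sum_i w 0 i * a i u : R^o) m.
apply: (epsilon_diff (L := L)); first exact: rV_linear_continuous.
move=> e e0.
have en0 : 0 < e / n.+1%:R by rewrite divr_gt0// ltr0n.
have [r1 r10 H1] := open_normP oU Uu.
have /near_normP[r2 r20 H2] : \forall v \near u, forall i, `|a i v - a i u| <= e / n.+1%:R.
  exact: filter_forall (fun i => near_close (ca i) en0).
exists (Num.min r1 r2); first by rewrite lt_min r10 r20.
move=> y yr; set w := y - u.
have seg (s : R) : 0 <= s <= 1 -> `|u + s *: w - u| < Num.min r1 r2.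
  by move=> s01; apply: segment_ball => //; rewrite subrr normr0 lt_min r10 r20.
have dg (s : R) : 0 <= s <= 1 -> is_derive (s : R) 1 (fun s => P (u + s *: w))
    (\sum_i w 0 i * a i (u + s *: w)).
  move=> s01.
  have Us : U (u + s *: w) by have := seg s s01; rewrite lt_min => /andP[/H1].
  have H0 := dP _ w Us.
  have H3 : is_derive (s : R) 1 (shift (- s) : R -> R) 1 by exact: is_derive_shift.
  have H4 : is_derive (shift (- s) s) 1 (fun h : R => P (u + s *: w + h *: w)) (\sum_i w 0 i * a i (u + s *: w)).
    by rewrite /= subrr.
  have := is_derive1_comp H4 H3; rewrite mulr1; congr is_derive.
  by apply: funext => h /=; rewrite -addrA -scalerDl [s + _]addrC subrK.
have [s s01 Es] : exists2 s : R, 0 <= s <= 1 & P y - P u = \sum_i w 0 i * a i (u + s *: w).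
  have cg : {within `[0, 1], continuous (fun s => P (u + s *: w))}.
    by apply: derivable_within_continuous => s; rewrite in_itv /= => /dg[].
  have [|s] := MVT_segment ler01 _ cg (df := fun s => \sum_i w 0 i * a i (u + s *: w)).
    by move=> s; rewrite in_itv /= => /andP[/ltW s0 /ltW s1]; apply: dg; rewrite s0 s1.
  rewrite in_itv /= subr0 mulr1 scale1r scale0r addr0 => s01.
  by rewrite /w [u + _]addrC subrK => ->; exists s.
rewrite Es /= -sumrB; under eq_bigr => i _ do rewrite -mulrBr.
apply: norm_sum_le => //; [exact: ltW|by move=> i; exact: mx_norm_coord|move=> i].
by apply: H2; have := seg s s01; rewrite lt_min => /andP[].
Qed.

(** The lemma of Poincare: P u is the integral of the form over the segment
    from c to u. The bounds K dominate the derivative of the integrand,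
    which can thus be taken under the integral sign; for a closed form this
    derivative in the direction w is the derivative in t of t times the sum
    of the w_i a_i (c + t (u - c)). *)
Lemma closed_primitive_aux n (a : 'I_n -> 'rV[R]_n -> R) (U : set 'rV[R]_n)
    (c : 'rV[R]_n) (r : R) (K : 'I_n -> R) :
  (forall u : 'rV[R]_n, `|u - c| < r -> U u) -> open U -> (forall i, Ck 1 U (a i)) ->
  (forall (u : 'rV[R]_n) (i j : 'I_n), U u ->
    'D_(delta_mx 0 i) (a j) u = 'D_(delta_mx 0 j) (a i) u) ->
  (forall (u : 'rV[R]_n) i, `|u - c| < r -> `|a i u| <= K i) ->
  (forall (u : 'rV[R]_n) (i j : 'I_n), `|u - c| < r -> `|'D_(delta_mx 0 j) (a i) u| <= K i) ->
  let P (u : 'rV[R]_n) := \int[mu]_(t in `[0, 1]) (\sum_i (u - c) 0 i * a i (c + t *: (u - c))) in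
  forall (u w : 'rV[R]_n), `|u - c| < r ->
    is_derive (0 : R) 1 (fun h : R => P (u + h *: w)) (\sum_i w 0 i * a i u).
Proof.
move=> rU oU Ca cl K1 K2 P u w ur.
pose y (h : R) : 'rV[R]_n := u + h *: w - c.
pose f (h t : R) := \sum_i (y h) 0 i * a i (c + t *: y h).
pose d1 (h t : R) := \sum_i ((y h) 0 i * (t * 'D_w (a i) (c + t *: y h))
   + w 0 i * a i (c + t *: y h)).
have r0 : 0 < r by apply: le_lt_trans ur.
have N0 : 0 < `|w| + 1 by rewrite ltr_wpDl.
pose d := (r - `|u - c|) / (`|w| + 1).
have d0 : 0 < d by rewrite divr_gt0// subr_gt0.
have yr (h : R) : h \in `]- d, d[ -> `|y h| < r.
  rewrite in_itv /= -ltr_norml => hd.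
  rewrite /y addrAC; apply: le_lt_trans (ler_normD _ _) _.
  rewrite -ltrBrDl normrZ.
  apply: (@le_lt_trans _ _ (`|h| * (`|w| + 1))); first by rewrite ler_wpM2l// lerDl.
  by rewrite -ltr_pdivlMr.
have pr (h t : R) : h \in `]- d, d[ -> 0 <= t <= 1 -> `|c + t *: y h - c| < r.
  move=> /yr yhr /andP[t0 t1]; rewrite addrAC subrr add0r normrZ (ger0_norm t0).
  by apply: le_lt_trans yhr; rewrite ler_piMl.
have da i x : U x -> differentiable (a i) x by have [+ _] := Ca i; apply.
have ca i x : U x -> {for x, continuous (a i)}.
  by move=> Ux; exact: differentiable_continuous (da i x Ux).
have cda i v x : U x -> {for x, continuous ('D_v (a i))}.
  by have [_ +] := Ca i => /(_ v) /(_ x).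
have cline (h t : R) : {for t, continuous (fun t : R => c + t *: y h)}.
  by apply: cvgD; [exact: cvg_cst|exact: scalel_continuous].
have pU (h t : R) : h \in `]- d, d[ -> 0 <= t <= 1 -> U (c + t *: y h).
  by move=> hd t01; apply: rU; exact: pr.
have I0 : 0 \in `]- d, d[ by rewrite in_itv /= oppr_lt0 d0.
have csum (g : 'I_n -> R -> R) t : (forall i, {for t, continuous (g i)}) ->
    {for t, continuous (fun t : R => \sum_i g i t)}.
  move=> cg; rewrite (_ : (fun t => _) = \sum_i g i); last by apply: funext => s; rewrite fct_sumE.
  elim/big_ind : _ => [|g1 g2 c1 c2|i _]; [exact: cst_continuous|exact: continuousD|exact: cg].
have cf (h t : R) : h \in `]- d, d[ -> 0 <= t <= 1 -> {for t, continuous (f h)}.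
  move=> hd t01; apply: csum => i; apply: cvgM; first exact: cvg_cst.
  apply: (@continuous_comp _ _ _ (fun t : R => c + t *: y h) (a i)); [exact: cline|exact/ca/pU].
have ccomp (h t : R) i : h \in `]- d, d[ -> 0 <= t <= 1 ->
   {for t, continuous (fun t : R => 'D_w (a i) (c + t *: y h))}.
  move=> hd t01.
  apply: (@continuous_comp _ _ _ (fun t : R => c + t *: y h) ('D_w (a i))); [exact: cline|exact/cda/pU].
have cd1 (h t : R) : h \in `]- d, d[ -> 0 <= t <= 1 -> {for t, continuous (d1 h)}.
  move=> hd t01; apply: csum => i; apply: cvgD; apply: cvgM; try exact: cvg_cst.
    by apply: cvgM; [exact: cvg_id|exact: ccomp].
  apply: (@continuous_comp _ _ _ (fun t : R => c + t *: y h) (a i)); [exact: cline|exact/ca/pU].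
have df (h t : R) : h \in `]- d, d[ -> 0 <= t <= 1 -> is_derive (h : R) 1 (f ^~ t) (d1 h t).
  move=> hd t01.
  have E i : is_derive (h : R) 1 (fun h => (y h) 0 i * a i (c + t *: y h))
      ((y h) 0 i * (t * 'D_w (a i) (c + t *: y h)) + w 0 i * a i (c + t *: y h)).
    have e1 h' : c + t *: y h' = (c + t *: (u - c)) + h' *: (t *: w).
      by rewrite /y (addrAC u) scalerDr addrA !scalerA [h' * t]mulrC.
    have := pU h t hd t01; rewrite e1 => Up.
    have D1 := is_derive_line (da i _ Up).
    rewrite [X in is_derive _ _ X _](_ : _ = (fun h => (u - c) 0 i + h * w 0 i) *
       (fun h' => a i (c + t *: (u - c) + h' *: (t *: w)))); last first.
      by apply: funext => h' /=; rewrite fctE e1 /y addrAC !mxE.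
    have D2 : is_derive (h : R) 1 (fun h => (u - c) 0 i + h * w 0 i) (w 0 i).
      by apply: is_derive_eq; rewrite add0r mul1r scaler0 add0r /GRing.scale /= mulr1.
    apply: is_derive_eq (is_deriveM D2 D1) _ => /=.
    have -> : y h 0 i = (u - c) 0 i + h * w 0 i by rewrite /y (addrAC u) !mxE.
    rewrite deriveE; last exact: da.
    rewrite linearZ /= -deriveE; last exact: da.
    by congr (_ + _); exact: mulrC.
  have := is_derive_sum E; congr is_derive.
  by apply: funext => h'; rewrite fct_sumE.
have Bound (h t : R) : h \in `]- d, d[ -> 0 <= t <= 1 ->
    `|d1 h t| <= \sum_i (r * (`|w| * (n%:R * K i)) + `|w| * K i).
  move=> hd t01; apply: le_trans (ler_norm_sum _ _ _) _; apply: ler_sum => i _.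
  have prt := pr h t hd t01.
  apply: le_trans (ler_normD _ _) _; apply: lerD; last first.
    by rewrite normrM ler_pM// ?mx_norm_coord// K1.
  rewrite normrM ler_pM//.
    by apply: ltW; apply: le_lt_trans (yr h hd); exact: mx_norm_coord.
  rewrite normrM -[leRHS]mul1r ler_pM//.
    by case/andP: t01 => t0 t1; rewrite ger0_norm.
  rewrite derive_sum; last exact/da/rU.
  apply: le_trans (ler_norm_sum _ _ _) _.
  apply: (@le_trans _ _ (\sum_(j < n) (`|w| * K i))).
    by apply: ler_sum => j _; rewrite normrM ler_pM// ?mx_norm_coord// K2.
  by rewrite sumr_const card_ord mulrCA mulr_natl.
have mem01 (t : R) : `[0, 1]%classic t -> 0 <= t <= 1 by rewrite /= in_itv.
have intf (h : R) : h \in `]- d, d[ -> mu.-integrable `[0, 1] (EFin \o f h).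
  move=> hd; apply: continuous_compact_integrable; first exact: segment_compact.
  by apply: continuous_in_subspaceT => t; rewrite inE => /mem01; exact: cf.
pose G (_ : R) : R := \sum_i (r * (`|w| * (n%:R * K i)) + `|w| * K i).
have p1E h t : h \in `]- d, d[ -> 0 <= t <= 1 -> partial1of2 f h t = d1 h t.
  by move=> hd t01; rewrite partial1of2E; have [_ ->] := df h t hd t01.
have mI : measurable (`[0, 1]%classic : set R) by exact: measurable_itv.
have intG : mu.-integrable `[0, 1] (EFin \o G).
  apply: continuous_compact_integrable; first exact: segment_compact.
  by apply: continuous_subspaceT; exact: cst_continuous.
have G_ge0 t : 0 <= G t.
  have t01 : 0 <= (0 : R) <= 1 by rewrite lexx ler01.
  exact: le_trans (normr_ge0 _) (Bound 0 0 I0 t01).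
have derf h t : `]- d, d[%classic h -> `[0, 1]%classic t -> derivable (f ^~ t) h 1.
  by move=> hd /mem01 t01; have [] := df h t hd t01.
have Gub h t : `]- d, d[%classic h -> `[0, 1]%classic t -> `|partial1of2 f h t| <= G t.
  by move=> hd /mem01 t01; rewrite p1E//; exact: Bound.
have D1 := @derivable_under_integral R _ _ mu f `[0, 1] mI 0 (- d) d I0 intf derf G G_ge0 intG Gub.
have D2 := @differentiation_under_integral R _ _ mu f `[0, 1] mI 0 (- d) d I0 intf derf G G_ge0 intG Gub.
apply: DeriveDef; first exact: D1.
rewrite -derive1E [LHS]D2.
have -> : \int[mu]_(t in `[0, 1]) partial1of2 f 0 t = \int[mu]_(t in `[0, 1]) d1 0 t.
  by apply: eq_Rintegral => t; rewrite inE => /mem01 t01; exact: p1E.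
pose q (t : R) := t * (\sum_i w 0 i * a i (c + t *: (u - c))).
have y0 : y 0 = u - c by rewrite /y scale0r addr0.
have dq (t : R) : 0 <= t <= 1 -> is_derive t 1 q (d1 0 t).
  move=> t01.
  have Up : U (c + t *: (u - c)) by rewrite -y0; exact: pU.
  have E i : is_derive t 1 (fun t : R => w 0 i * a i (c + t *: (u - c)))
     (w 0 i * 'D_(u - c) (a i) (c + t *: (u - c))).
    have D3 := is_derive_line (da i _ Up).
    exact: (is_deriveZ (w 0 i) D3).
  have D4 := is_derive_sum E.
  have D5 := is_deriveM (is_derive_id t (1 : R)) D4.
  have -> : q = id * (\sum_i (fun t : R => w 0 i * a i (c + t *: (u - c)))).
    by apply: funext => s; rewrite /q fctE fct_sumE.
  apply: is_derive_eq D5 _ => /=.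
  rewrite /d1 y0 big_split /= fct_sumE; congr (_ + _); last first.
    by rewrite /GRing.scale /= mulr1.
  rewrite /GRing.scale /= mulr_sumr.
  transitivity (\sum_i \sum_j t * (w 0 i * (u - c) 0 j * 'D_(delta_mx 0 j) (a i) (c + t *: (u - c)))).
    apply: eq_bigr => i _; rewrite -mulr_sumr; congr (_ * _).
    rewrite derive_sum; last exact: da.
    by rewrite mulr_sumr; apply: eq_bigr => j _; rewrite -mulrA.
  rewrite exchange_big /=; apply: eq_bigr => j _.
  rewrite -mulr_sumr mulrCA; congr (_ * _).
  rewrite derive_sum; last exact: da.
  rewrite mulr_sumr; apply: eq_bigr => i _.
  by rewrite (cl _ j i Up) /GRing.scale /=; ring.
rewrite (FTC_unit_interval dq) /q ?mul0r ?subr0 ?mul1r ?scale1r.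
  by rewrite [c + _]addrC subrK.
by apply: continuous_in_subspaceT => t; rewrite inE => /mem01; exact: cd1.
Qed.

End Primitives.

Section RowPrimitives.
Context {R : realType}.

Lemma differentiable_mx (E : normedModType R) m n (F : E -> 'M[R]_(m, n)) x :
  (forall i j, differentiable (fun y => F y i j) x) -> differentiable F x.
Proof.
move=> H.
have -> : F = \sum_i \sum_j (fun y => F y i j *: delta_mx i j).
  apply: funext => y; rewrite fct_sumE {1}(matrix_sum_delta (F y)).
  by apply: eq_bigr => i _; rewrite fct_sumE.
elim/big_ind : _ => [|f g df dg|i _]; [exact: differentiable_cst|exact: differentiableD|].
elim/big_ind : _ => [|f g df dg|j _]; [exact: differentiable_cst|exact: differentiableD|].
exact: differentiableZl.
Qed.

(** Each coordinate has the primitive of closed_primitive_aux, on a ball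
    small enough for the forms and their derivatives to be bounded. *)
Lemma closed_primitive n m (A : 'I_n -> 'rV[R]_n -> 'rV[R]_m) (U : set 'rV[R]_n) c :
  open U -> U c -> (forall i, Ck 1 U (A i)) ->
  (forall u (i j : 'I_n), U u ->
    'D_(delta_mx 0 i) (A j) u = 'D_(delta_mx 0 j) (A i) u) ->
  exists (r : R) (P : 'rV[R]_n -> 'rV[R]_m),
    [/\ 0 < r, forall u, `|u - c| < r -> U u &
     forall u, `|u - c| < r -> differentiable P u /\
       forall w, 'D_w P u = \sum_i w 0 i *: A i u].
Proof.
move=> oU Uc CA cl.
have [r1 r10 H1] := open_normP oU Uc.
have dA i u : U u -> differentiable (A i) u by have [+ _] := CA i; apply.
pose K i := `|A i c| + \sum_j `|'D_(delta_mx 0 j) (A i) c| + 1.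
have bnd (g : 'rV[R]_n -> 'rV[R]_m) k : {for c, continuous g} -> `|g c| + 1 <= k ->
    \forall u \near c, `|g u| <= k.
  move=> cg gk; apply: filterS (near_close cg ltr01) => u cu.
  by apply: le_trans gk; rewrite -lerBlDl; exact: le_trans (lerB_dist _ _) _.
have /near_normP[r2 r20 H2] : \forall u \near c, forall i, `|A i u| <= K i.
  have H i : \forall u \near c, `|A i u| <= K i.
    apply: bnd; first exact: (Ck_continuous (CA i) Uc).
    by rewrite /K lerD2r lerDl sumr_ge0.
  exact: filter_forall H.
have /near_normP[r3 r30 H3] : \forall u \near c, forall i j, `|'D_(delta_mx 0 j) (A i) u| <= K i.
  have H i j : \forall u \near c, `|'D_(delta_mx 0 j) (A i) u| <= K i.
    apply: bnd.
      by have [_ /(_ (delta_mx 0 j)) C] := CA i; exact: C.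
    rewrite /K lerD2r; apply: ler_wpDl => //.
    by rewrite (bigD1 j)//= lerDl sumr_ge0.
  have H' i : \forall u \near c, forall j, `|'D_(delta_mx 0 j) (A i) u| <= K i.
    exact: filter_forall (H i).
  exact: filter_forall H'.
pose r := Num.min r1 (Num.min r2 r3).
have r0 : 0 < r by rewrite !lt_min r10 r20 r30.
have rr u : `|u - c| < r -> [/\ `|u - c| < r1, `|u - c| < r2 & `|u - c| < r3].
  by rewrite !lt_min => /and3P[].
have rU (u : 'rV[R]_n) : `|u - c| < r -> U u by move=> /rr[/H1].
pose p l (u : 'rV[R]_n) := \int[@lebesgue_measure R]_(t in `[0, 1])
   (\sum_i (u - c) 0 i * A i (c + t *: (u - c)) 0 l).
have dp l (u w : 'rV[R]_n) : `|u - c| < r ->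
    is_derive (0 : R) 1 (fun h : R => p l (u + h *: w)) (\sum_i w 0 i * A i u 0 l).
  move=> ur.
  apply: (@closed_primitive_aux _ _ (fun i u => A i u 0 l) U c r K) => //.
  - by move=> i; exact: Ck_coord.
  - move=> x i j Ux; rewrite !derive_coord; [|exact: dA..].
    by rewrite cl.
  - by move=> x i /rr[_ /H2 + _] => /(_ i); apply: le_trans; exact: mx_norm_coord.
  - move=> x i j xr; rewrite derive_coord; last exact/dA/rU.
    have [_ _ /H3/(_ i j)] := rr x xr; apply: le_trans; exact: mx_norm_coord.
pose B := [set u : 'rV[R]_n | `|u - c| < r].
have oB : open B by exact: open_norm_ball.
exists r, (fun u => \row_l p l u); split => // u ur.
have H l := differentiable_of_partials (P := p l) (a := fun i u => A i u 0 l) oB ur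
  (fun i => Ck_continuous (Ck_coord 0 l oU (CA i)) (rU _ ur)) (dp l).
have dP : differentiable (fun u => \row_l p l u) u.
  apply: differentiable_mx => i j.
  rewrite (_ : (fun y => _) = p j); last by apply: funext => y; rewrite mxE.
  by have [] := H j.
split => // w; apply/rowP => j; rewrite -derive_coord//.
rewrite (_ : (fun y => _) = p j); last by apply: funext => y; rewrite mxE.
have [_ ->] := H j; rewrite summxE.
by apply: eq_bigr => i _; rewrite mxE.
Qed.

End RowPrimitives.

(** * Connected sets and subdivision of the unit interval *)

Section Connectedness.
Context {R : realType}.

Lemma connected_locally_constant (X : topologicalType) (Y : Type) (K : set X)
    (g : X -> Y) : connected K ->
  (forall x, K x -> \forall y \near x, K y -> g y = g x) ->
  forall x y, K x -> K y -> g x = g y.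
Proof.
move=> cK lg x y Kx Ky.
pose O (S : set Y) : set X := [set z : X | nbhs z (fun y => K y -> S (g y))].
have nb (S : set Y) z : K z -> O S z <-> S (g z).
  move=> Kz; split; first by move=> /nbhs_singleton; apply.
  by move=> Sz; apply: filterS (lg z Kz) => w /[apply] ->.
have oO (S : set Y) : open (O S) by rewrite openE => z /nbhs_interior.
have : K `&` g @^-1` [set g x] = K.
  apply: cK; first by exists x.
    exists (O [set g x]); first exact: oO.
    by apply/seteqP; split => z [Kz] => [/(nb [set g x] z Kz)|/(nb [set g x] z Kz)].
  exists (~` O (~` [set g x])); first exact/open_closedC/oO.
  apply/seteqP; split => z [Kz Sz]; split => //=.
    by move=> /(nb (~` [set g x]) z Kz).
  by apply: contrapT => nS; apply: Sz; apply/(nb (~` [set g x]) z Kz).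
by move=> /seteqP[_ /(_ y Ky)[_ /= ->]].
Qed.

Lemma connected_segment (a b : R) : connected `[a, b]%classic.
Proof. exact/connected_intervalP/interval_is_interval. Qed.

Lemma segment_split (a m b : R) : a <= m -> m <= b ->
  `[a, b]%classic = (`[a, m] `|` `[m, b])%classic.
Proof.
move=> am mb; apply/seteqP; split => t /=; rewrite !in_itv /=.
  by move=> /andP[-> ->]; rewrite andbT; case: (leP t m) => [|/ltW]; [left|right].
by move=> [|] /andP[at_ tb]; rewrite ?at_ ?tb ?(le_trans tb) ?(le_trans am).
Qed.

Lemma segment_meet (a m b : R) : a <= m -> m <= b ->
  (`[a, m] `&` `[m, b])%classic = `[m, m]%classic.
Proof.
move=> am mb; apply/seteqP; split => t /=; rewrite !in_itv /=.
  by move=> [/andP[_ ->] /andP[-> _]].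
by move=> /andP[mt tm]; rewrite mt tm (le_trans am)// (le_trans tm).
Qed.

Lemma convex_connected (E : normedModType R) (A : set E) :
  (forall x y (t : R), A x -> A y -> 0 <= t <= 1 -> A (x + t *: (y - x))) ->
  connected A.
Proof.
move=> cA; have [->|/set0P[x Ax]] := eqVneq A set0; first exact: connected0.
have -> : A = \bigcup_(y in A) ((fun t : R => x + t *: (y - x)) @` `[0, 1]%classic).
  apply/seteqP; split => [y Ay|z [y Ay [t /= t01 <-]]].
    exists y => //; exists 1; first by rewrite /= in_itv /= ler01 lexx.
    by rewrite scale1r [x + _]addrC subrK.
  by apply: cA => //; move: t01; rewrite in_itv.
apply: bigcup_connected.
  exists x => y Ay; exists 0; first by rewrite /= in_itv /= ler01 lexx.
  by rewrite scale0r addr0.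
move=> y Ay; apply: connected_continuous_connected; first exact: connected_segment.
apply: continuous_subspaceT => t.
by apply: cvgD; [exact: cvg_cst|exact: scalel_continuous].
Qed.

(** The supremum of the x such that P 0 x is reached and cannot be smaller
    than 1. This stands for the choice of a Lebesgue number of a covering of
    [0, 1]. *)
Lemma interval_induction (P : R -> R -> Prop) :
  (forall a b c, 0 <= a -> a <= b -> b <= c -> c <= 1 -> P a b -> P b c -> P a c) ->
  (forall t : R, 0 <= t <= 1 -> exists2 e : R, 0 < e &
     forall a b, 0 <= a -> a <= b -> b <= 1 -> t - e < a -> b < t + e -> P a b) ->
  P 0 1.
Proof.
move=> Padd Ploc.
pose A := [set x : R | 0 <= x <= 1 /\ P 0 x].
have A0 : A 0.
  split; first by rewrite lexx ler01.
  have [|e e0 He] := Ploc 0; first by rewrite lexx ler01.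
  by apply: He => //; rewrite ?sub0r ?oppr_lt0 ?add0r.
have ubA : ubound A 1 by move=> x [/andP[]].
have hA : has_sup A by split; [exists 0|exists 1].
have x0 : 0 <= sup A by apply: ub_le_sup => //; exists 1.
have x1 : sup A <= 1 by apply: ge_sup => //; exists 0.
have [|e e0 He] := Ploc (sup A); first by rewrite x0 x1.
have [a [/andP[a0 a1] Pa] ae] := sup_adherent e0 hA.
have ax : a <= sup A by apply: ub_le_sup; [exists 1|split => //; rewrite a0 a1].
pose b := Num.min 1 (sup A + e / 2).
have xb : sup A <= b by rewrite le_min x1 lerDl divr_ge0 ?ltW.
have b1 : b <= 1 by rewrite ge_min lexx.
have Pb : P 0 b.
  apply: (Padd 0 a b) => //; first exact: le_trans xb.
  apply: He => //; first exact: le_trans xb.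
  rewrite /b gt_min ltrD2l ltr_pdivrMr//; apply/orP; right.
  by rewrite ltr_pMr// ltr1n.
have bA : b <= sup A.
  apply: ub_le_sup; first by exists 1.
  by split => //; rewrite b1 andbT (le_trans x0).
have : b = 1.
  apply/eqP; rewrite eq_le b1 /=; rewrite leNgt; apply/negP => bl.
  have : b = sup A + e / 2.
    by move: bl; rewrite /b; case: (leP 1 (sup A + e / 2)) => //; rewrite ltxx.
  by move=> bE; move: bA; rewrite bE gerDl leNgt divr_gt0.
by move=> <-.
Qed.

End Connectedness.

(** * Continuation of local primitives along paths *)

Section Continuation.
Context {R : realType} {T : topologicalType} {V : zmodType}.
Variable D : set T.
(** [loc W P] is to be read: P is a primitive on the open set W of some
    fixed closed form. The hypotheses below say that primitives exist
    locally, on path-connected open sets, and that two of them differ by a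
    locally constant function. *)
Variable loc : set T -> (T -> V) -> Prop.
Hypothesis loc_open : forall W P, loc W P -> open W /\ W `<=` D.
Hypothesis loc_const : forall W W' P P' x, loc W P -> loc W' P' -> W x -> W' x ->
  \forall y \near x, P y - P' y = P x - P' x.

(** H maps K continuously to T, and h is, near each point of K, a local
    primitive composed with H, up to a constant: h is a primitive of the
    pullback of the form by the merely continuous map H. *)
Definition continuation (X : topologicalType) (K : set X) (H : X -> T) (h : X -> V) :=
  forall z, K z ->
    (forall N, nbhs (H z) N -> \forall y \near z, K y -> N (H y)) /\
    exists W P k, [/\ loc W P, W (H z) & \forall y \near z, K y -> h y = P (H y) + k].

Section Generic.
Context {X : topologicalType}.
Implicit Types (K : set X) (H : X -> T) (h : X -> V).

Lemma continuation_unique K H h h' : connected K -> continuation K H h ->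
  continuation K H h' -> forall x y, K x -> K y -> h x - h' x = h y - h' y.
Proof.
move=> cK ch ch'; apply: (connected_locally_constant (g := fun x => h x - h' x)) => // x Kx.
have [cH [W [P [k [lP Wx hP]]]]] := ch x Kx.
have [_ [W' [P' [k' [lP' Wx' hP']]]]] := ch' x Kx.
have nb := cH _ (loc_const lP lP' Wx Wx').
have hx := nbhs_singleton hP Kx; have hx' := nbhs_singleton hP' Kx.
apply: filterS3 hP hP' nb => y Hy Hy' Hn Ky.
rewrite hx hx' (Hy Ky) (Hy' Ky) !opprD !addrA ![_ + k - _]addrAC.
by rewrite (Hn Ky).
Qed.

Lemma continuation_glue K K' H h : closed K -> closed K' ->
  continuation K H h -> continuation K' H h -> continuation (K `|` K') H h.
Proof.
move=> clK clK' ch ch' z.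
have away (A : set X) : closed A -> ~ A z -> \forall y \near z, ~ A y.
  by move=> /closed_openC oA nA; exact: (open_nbhs_nbhs (conj oA nA)).
have [Kz|nKz] := pselect (K z); have [Kz'|nKz'] := pselect (K' z) => KKz.
- have [cH [W [P [k [lP Wz hP]]]]] := ch z Kz.
  have [cH' [W' [P' [k' [lP' Wz' hP']]]]] := ch' z Kz'.
  split=> [N HN|].
    by apply: filterS2 (cH N HN) (cH' N HN) => y H1 H2 [/H1|/H2].
  exists W, P, k; split => //.
  have nb := cH' _ (loc_const lP' lP Wz' Wz).
  have hz := nbhs_singleton hP Kz; have hz' := nbhs_singleton hP' Kz'.
  apply: filterS3 hP hP' nb => y Hy Hy' Hn [/Hy//|Ky].
  rewrite (Hy' Ky); have /= E := Hn Ky.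
  have -> : P' (H y) = P' (H z) - P (H z) + P (H y) by rewrite -E subrK.
  have -> : k = P' (H z) + k' - P (H z) by rewrite -hz' hz [P _ + k]addrC addrK.
  by rewrite addrAC [RHS]addrC [P' (H z) + k' - _]addrAC.
- have [cH [W [P [k [lP Wz hP]]]]] := ch z Kz; have aw := away _ clK' nKz'.
  split=> [N HN|]; first by apply: filterS2 (cH N HN) aw => y H1 nK [/H1|/nK].
  by exists W, P, k; split => //; apply: filterS2 hP aw => y H1 nK [/H1|/nK].
- have [cH [W [P [k [lP Wz hP]]]]] := ch' z Kz'; have aw := away _ clK nKz.
  split=> [N HN|]; first by apply: filterS2 (cH N HN) aw => y H1 nK [/nK|/H1].
  by exists W, P, k; split => //; apply: filterS2 hP aw => y H1 nK [/nK|/H1].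
- by case: KKz.
Qed.

Lemma continuation_ext K H h h' : (forall x, K x -> h x = h' x) ->
  continuation K H h -> continuation K H h'.
Proof.
move=> hh' ch z Kz; have [cH [W [P [k [lP Wz hP]]]]] := ch z Kz.
by split => //; exists W, P, k; split => //; apply: filterS hP => y Hy Ky; rewrite -hh'// Hy.
Qed.

Lemma continuation_extH K H H' h : (forall x, K x -> H x = H' x) ->
  continuation K H h -> continuation K H' h.
Proof.
move=> HH' ch z Kz; have [cH [W [P [k [lP Wz hP]]]]] := ch z Kz.
rewrite -HH'//; split => [N HN|].
  by apply: filterS (cH N HN) => y Hy Ky; rewrite -HH'//; exact: Hy.
exists W, P, k; split => //; apply: filterS hP => y Hy Ky.
by rewrite -HH'// Hy.
Qed.

Lemma continuation_add K H h k : continuation K H h ->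
  continuation K H (fun x => h x + k).
Proof.
move=> ch z Kz; have [cH [W [P [k' [lP Wz hP]]]]] := ch z Kz.
split => //; exists W, P, (k' + k); split => //.
by apply: filterS hP => y Hy Ky; rewrite Hy// addrA.
Qed.

Lemma continuation_sub K K' H h : K' `<=` K -> continuation K H h ->
  continuation K' H h.
Proof.
move=> sK ch z Kz; have [cH [W [P [k' [lP Wz hP]]]]] := ch z (sK _ Kz).
split => [N HN|]; first by apply: filterS (cH N HN) => y Hy /sK.
by exists W, P, k'; split => //; apply: filterS hP => y Hy /sK.
Qed.

(** The two continuations differ by a constant on the connected set where
    both are defined; the second one is corrected by this constant. *)
Lemma continuation_join K K' H h h' x : closed K -> closed K' ->
  connected (K `&` K') -> K x -> K' x ->
  continuation K H h -> continuation K' H h' ->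
  exists h'', continuation (K `|` K') H h''.
Proof.
move=> clK clK' cKK Kx Kx' ch ch'.
pose h2 y := h' y + (h x - h' x).
have ch2 : continuation K' H h2 := continuation_add (h x - h' x) ch'.
pose h3 y := if pselect (K y) then h y else h2 y.
exists h3; apply: continuation_glue => //.
  by apply: continuation_ext (ch) => y Ky; rewrite /h3; case: pselect.
apply: continuation_ext (ch2) => y Ky'; rewrite /h3; case: pselect => // Ky.
have s1 : K `&` K' `<=` K by move=> ? [].
have s2 : K `&` K' `<=` K' by move=> ? [].
have := continuation_unique cKK (continuation_sub s1 ch) (continuation_sub s2 ch2)
  (conj Ky Ky') (conj Kx Kx').
by rewrite /h2 [h' x + _]addrC subrK subrr => /eqP; rewrite subr_eq0 => /eqP->.
Qed.

Lemma continuation_local K H W P k : loc W P -> (forall x, K x -> W (H x)) ->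
  (forall z, K z -> forall N, nbhs (H z) N -> \forall y \near z, K y -> N (H y)) ->
  continuation K H (fun x => P (H x) + k).
Proof.
move=> lP KW cH z Kz; split; first exact: cH.
by exists W, P, k; split => //; [exact: KW|exact: filterE].
Qed.

End Generic.

Lemma continuation_comp (X X' : topologicalType) (K : set X) (K' : set X')
    (f : X' -> X) H h : continuous f -> (forall x, K' x -> K (f x)) ->
  continuation K H h -> continuation K' (H \o f) (h \o f).
Proof.
move=> cf fK ch z Kz; have [cH [W [P [k [lP Wz hP]]]]] := ch _ (fK _ Kz).
split => [N HN|].
  have C : nbhs z (f @^-1` _) := cf z _ (cH N HN).
  by apply: filterS C => y Hy /fK; exact: Hy.
exists W, P, k; split => //.
have C : nbhs z (f @^-1` _) := cf z _ hP.
by apply: filterS C => y Hy /fK; exact: Hy.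
Qed.

Hypothesis loc_ex : forall x, D x -> exists W P, loc W P /\ W x.

Lemma within_nbhs (X Y : topologicalType) (K : set X) (H : X -> Y) :
  {within K, continuous H} ->
  forall z, K z -> forall N, nbhs (H z) N -> \forall y \near z, K y -> N (H y).
Proof. by move=> /subspace_continuousP cH z Kz N /(cH z Kz). Qed.

Local Notation sq := ((`[(0 : R), 1] `*` `[(0 : R), 1])%classic : set (R * R)).
Local Notation I01 := (`[(0 : R), 1]%classic : set R).

(** Small rectangles lie in the domain of one local primitive. Rectangles
    are joined along segments, first vertically to strips around a given s
    and then horizontally, each time by interval_induction. *)
Lemma square_continuation (H : R * R -> T) :
  {within sq, continuous H} ->
  (forall s t : R, s \in `[0, 1] -> t \in `[0, 1] -> D (H (s, t))) ->
  exists h : R * R -> V, continuation sq H h.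
Proof.
move=> cH DH.
pose rect (a b c d : R) : set (R * R) := (`[a, b] `*` `[c, d])%classic.
have clr a b c d : closed (rect a b c d).
  rewrite (_ : rect a b c d = fst @^-1` `[a, b]%classic `&` snd @^-1` `[c, d]%classic)//.
  apply: closedI; apply: closed_comp; try exact: interval_closed.
    by move=> [x y] _; exact: cvg_fst.
  by move=> [x y] _; exact: cvg_snd.
have convr a b c d : connected (rect a b c d).
  apply: convex_connected => -[x1 x2] [y1 y2] t /=.
  rewrite /rect /= !in_itv /= => -[/andP[a1 b1] /andP[a2 b2]] [/andP[a3 b3] /andP[a4 b4]].
  have aux (p q lo hi : R) : lo <= p -> p <= hi -> lo <= q -> q <= hi -> 0 <= t <= 1 ->
      lo <= p + t * (q - p) <= hi.
    move=> lp ph lq qh /andP[t0 t1].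
    have -> : p + t * (q - p) = (1 - t) * p + t * q by ring.
    have E (x : R) : x = (1 - t) * x + t * x by ring.
    by rewrite [X in X <= _ <= _](E lo) [X in _ <= _ <= X](E hi) !lerD// ler_wpM2l// subr_ge0.
  by move=> t01; split; exact: aux.
pose good a b c d := exists h, continuation (rect a b c d) H h.
have joinv a b c d m : a <= b -> c <= m -> m <= d -> good a b c m -> good a b m d ->
    good a b c d.
  move=> ab cm md [h ch] [h' ch'].
  have E : rect a b c d = rect a b c m `|` rect a b m d.
    rewrite /rect (segment_split cm md).
    by apply/seteqP; split => -[x y] /=; tauto.
  rewrite /good E.
  apply: (continuation_join (x := (a, m)) _ _ _ _ _ ch ch') => //.
  - by rewrite -setXI setIid segment_meet//; exact: convr.
  - by rewrite /rect /= !in_itv /= lexx ab cm lexx.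
  - by rewrite /rect /= !in_itv /= lexx ab md lexx.
have joinh a b c d m : c <= d -> a <= m -> m <= b -> good a m c d -> good m b c d ->
    good a b c d.
  move=> ab cm md [h ch] [h' ch'].
  have E : rect a b c d = rect a m c d `|` rect m b c d.
    rewrite /rect (segment_split cm md).
    by apply/seteqP; split => -[x y] /=; tauto.
  rewrite /good E.
  apply: (continuation_join (x := (m, c)) _ _ _ _ _ ch ch') => //.
  - by rewrite -setXI setIid segment_meet//; exact: convr.
  - by rewrite /rect /= !in_itv /= lexx ab cm lexx.
  - by rewrite /rect /= !in_itv /= lexx ab md lexx.
have small (s t : R) : 0 <= s <= 1 -> 0 <= t <= 1 -> exists2 e : R, 0 < e &
    forall a b c d, 0 <= a -> a <= b -> b <= 1 -> s - e < a -> b < s + e ->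
     0 <= c -> c <= d -> d <= 1 -> t - e < c -> d < t + e -> good a b c d.
  move=> s01 t01.
  have Ist : sq (s, t) by rewrite /= !in_itv.
  have [W [P [lP Wst]]] : exists W P, loc W P /\ W (H (s, t)) by apply/loc_ex/DH; rewrite in_itv.
  have [oW _] := loc_open lP.
  have := within_nbhs cH Ist (open_nbhs_nbhs (conj oW Wst)) => /nbhs_ballP[e /= e0 He].
  exists e => // a b c d a0 ab b1 sa bs c0 cd d1 tc dt.
  exists (fun x => P (H x) + 0); apply: (continuation_local (W := W)) => //.
    move=> [x y]; rewrite /rect /= !in_itv /= => -[/andP[ax xb] /andP[cy yd]].
    apply: He; last by rewrite /= !in_itv /= (le_trans a0)// (le_trans xb)// (le_trans c0)// (le_trans yd).
    by split => /=; rewrite /ball /= ltr_distlC; apply/andP; split;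
      [exact: lt_le_trans ax|exact: le_lt_trans bs|exact: lt_le_trans cy|exact: le_lt_trans dt].
  move=> z Kz N HN.
  have sK : rect a b c d `<=` sq.
    move=> [x y]; rewrite /rect /= !in_itv /= => -[/andP[ax xb] /andP[cy yd]].
    by rewrite (le_trans a0)// (le_trans xb)// (le_trans c0)// (le_trans yd).
  by apply: filterS (within_nbhs cH (sK _ Kz) HN) => y Hy /sK.
have strip (s : R) : 0 <= s <= 1 -> exists2 e : R, 0 < e &
    forall a b, 0 <= a -> a <= b -> b <= 1 -> s - e < a -> b < s + e -> good a b 0 1.
  move=> s01.
  apply: (@interval_induction R (fun c d => exists2 e : R, 0 < e &
    forall a b, 0 <= a -> a <= b -> b <= 1 -> s - e < a -> b < s + e -> good a b c d)).
    move=> c m d c0 cm md d1 [e1 e10 H1] [e2 e20 H2].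
    exists (Num.min e1 e2); first by rewrite lt_min e10 e20.
    move=> a b a0 ab b1 sa bs; apply: (joinv a b c d m) => //; [apply: H1|apply: H2] => //;
     rewrite ?(le_lt_trans _ sa) ?(lt_le_trans bs)// ?lerD2l ?lerN2 ge_min lexx ?orbT//.
  move=> t t01; have [e e0 He] := small s t s01 t01; exists e => // c d c0 cd d1 tc dt.
  by exists e => // a b *; exact: He.
apply: (@interval_induction R (fun a b => good a b 0 1)) => //.
by move=> a m b a0 am mb b1; apply: joinh.
Qed.

(** Continuation along some path from x to y takes the value v at x to the
    value v' at y. *)
Definition continues (x : T) (v : V) (y : T) (v' : V) :=
  exists (g : R -> T) (h : R -> V), [/\ continuation I01 g h,
    g 0 = x, g 1 = y, h 0 = v & h 1 = v'].

Lemma continuous_vertical (s : R) : continuous (fun t : R => (s, t)).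
Proof.
by move=> t; exact: (@cvg_pair _ _ _ (nbhs t) (nbhs s) (nbhs t) _ _ _
  (cst s) id (cvg_cst _) cvg_id).
Qed.

Lemma continuous_horizontal (t : R) : continuous (fun s : R => (s, t)).
Proof.
by move=> s; exact: (@cvg_pair _ _ _ (nbhs s) (nbhs s) (nbhs t) _ _ _
  id (cst t) cvg_id (cvg_cst _)).
Qed.

Lemma within_snd (g : R -> T) : {within I01, continuous g} ->
  {within sq, continuous (g \o snd)}.
Proof.
move=> cg; apply/subspace_continuousP => z [_ z2] N HN.
have C : \forall y \near (z : R * R), I01 y.2 -> N (g y.2).
  exact: (@cvg_snd R R (nbhs z.1) (nbhs z.2) _ _ (within_nbhs cg z2 HN)).
by apply: filterS C => y Hy [_ y01]; exact: Hy.
Qed.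

Lemma continues_exists (g : R -> T) v : {within `[0, 1], continuous g} ->
  (forall t : R, t \in `[0, 1] -> D (g t)) -> exists v', continues (g 0) v (g 1) v'.
Proof.
move=> cg Dg.
have [|h ch] := @square_continuation (g \o snd) _ (fun s t _ t01 => Dg t t01).
  exact: within_snd.
pose f (t : R) : R * R := (0, t).
have cf : continuous f by exact: continuous_vertical.
have fK (x : R) : `[0, 1]%classic x -> sq (f x).
  by move=> x01; split => //=; rewrite in_itv /= lexx ler01.
have ch' := continuation_add (v - h (f 0)) (continuation_comp cf fK ch).
exists (h (f 1) + (v - h (f 0))).
by exists g, (fun t => h (f t) + (v - h (f 0))); split => //; rewrite addrC subrK.
Qed.

Lemma continues_translate x v y v' k : continues x v y v' -> continues x (v + k) y (v' + k).
Proof.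
move=> [g [h [ch g0 g1 h0 h1]]]; exists g, (fun t => h t + k).
by split; rewrite ?h0 ?h1//; exact: continuation_add.
Qed.

Lemma continues_sym x v y v' : continues x v y v' -> continues y v' x v.
Proof.
move=> [g [h [ch g0 g1 h0 h1]]].
have cf : continuous (fun t : R => 1 - t).
  by move=> t; apply: cvgB; [exact: cvg_cst|exact: cvg_id].
exists (g \o (fun t => 1 - t)), (h \o (fun t => 1 - t)); split; rewrite /= ?subr0 ?subrr//.
apply: continuation_comp cf _ ch => t /=; rewrite !in_itv /= => /andP[t0 t1].
by rewrite subr_ge0 t1 lerBlDr lerDl.
Qed.

Lemma continues_trans x v y v' z v'' : continues x v y v' -> continues y v' z v'' ->
  continues x v z v''.
Proof.
move=> [g [h [ch g0 g1 h0 h1]]] [g' [h' [ch' g0' g1' h0' h1']]].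
pose f (t : R) := 2 * t; pose f' (t : R) := 2 * t - 1.
have cf : continuous f by move=> t; apply: cvgM; [exact: cvg_cst|exact: cvg_id].
have cf' : continuous f' by move=> t; apply: cvgB; [exact: cf|exact: cvg_cst].
have h2 : (0 : R) < 2 by rewrite ltr0n.
pose G t := if t <= 2^-1 then g (f t) else g' (f' t).
pose F t := if t <= 2^-1 then h (f t) else h' (f' t).
have f2 : f 2^-1 = 1 by rewrite /f mulfV ?gt_eqF.
have f2' : f' 2^-1 = 0 by rewrite /f' mulfV ?gt_eqF ?subrr.
have G2 t : 2^-1 <= t -> G t = g' (f' t).
  rewrite /G le_eqVlt => /orP[/eqP<-|]; first by rewrite lexx f2 f2' g1 g0'.
  by move=> lt; rewrite leNgt lt.
have F2 t : 2^-1 <= t -> F t = h' (f' t).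
  rewrite /F le_eqVlt => /orP[/eqP<-|]; first by rewrite lexx f2 f2' h1 h0'.
  by move=> lt; rewrite leNgt lt.
have half0 : (0 : R) <= 2^-1 by rewrite invr_ge0 ltW.
have half1 : (2^-1 : R) <= 1 by rewrite invf_le1// ler1n.
exists G, F; split.
- rewrite (segment_split half0 half1).
  apply: continuation_glue; try exact: interval_closed.
    have fK (t : R) : `[0, 2^-1]%classic t -> `[0, 1]%classic (f t).
      rewrite /= !in_itv /= => /andP[t0 t1]; rewrite mulr_ge0//= /f mulrC.
      by rewrite -ler_pdivlMr// mul1r.
    have := continuation_comp cf fK ch.
    move=> /(continuation_ext (h' := F)) H1; apply: (continuation_extH (H := g \o f)).
      by move=> t; rewrite /= in_itv /= => /andP[_ t1]; rewrite /G t1.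
    by apply: H1 => t; rewrite /= in_itv /= => /andP[_ t1]; rewrite /F t1.
  have fK (t : R) : `[2^-1, 1]%classic t -> `[0, 1]%classic (f' t).
    rewrite /= !in_itv /= => /andP[t0 t1]; rewrite /f' subr_ge0.
    rewrite mulrC -ler_pdivrMr// div1r t0 /= lerBlDr -ler_pdivlMr//.
    by rewrite (_ : (1 + 1) / 2 = 1) ?mulfV ?gt_eqF.
  have := continuation_comp cf' fK ch'.
  move=> /(continuation_ext (h' := F)) H1; apply: (continuation_extH (H := g' \o f')).
    by move=> t; rewrite /= in_itv /= => /andP[t1 _]; rewrite G2.
  by apply: H1 => t; rewrite /= in_itv /= => /andP[t1 _]; rewrite F2.
- by rewrite /G half0 /f mulr0.
- by rewrite G2// /f' mulr1 addrK.
- by rewrite /F half0 /f mulr0.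
- by rewrite F2// /f' mulr1 addrK.
Qed.

Hypothesis scD : simply_connected R D.

(** A homotopy from the loop to a constant loop carries a continuation over
    the whole square. The other three sides are constant paths, along which
    the values do not change. *)
Lemma continues_loop a v v' : continues a v a v' -> v = v'.
Proof.
move=> [g [h [ch g0 g1 h0 h1]]].
have cg : {within `[0, 1], continuous g}.
  by apply/subspace_continuousP => t t01 N HN; have [+ _] := ch t t01; apply.
have Dg t : t \in `[0, 1] -> D (g t).
  by move=> t01; have [_ [W [P [k [/loc_open[_ sW] Wt _]]]]] := ch t t01; exact: sW.
have [_ /(_ g cg Dg)] := scD; rewrite g0 g1 => /(_ erefl)[H [cH DH Ht Hs]].
have [h2 ch2] := square_continuation cH DH.
have I0 : (0 : R) \in `[0, 1] by rewrite in_itv /= lexx ler01.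
have I1 : (1 : R) \in `[0, 1] by rewrite in_itv /= lexx ler01.
have cv (s : R) : continuous (fun t : R => (s, t)).
  by exact: continuous_vertical.
have chz (t : R) : continuous (fun s : R => (s, t)).
  by exact: continuous_horizontal.
have c1 := @connected_segment R 0 1.
have cst_cont (f : R -> R * R) : continuous f ->
    (forall x : R, `[0, 1]%classic x -> sq (f x)) ->
    (forall x, x \in `[0, 1] -> H (f x) = a) -> h2 (f 0) = h2 (f 1).
  move=> cf fK Ha.
  have chf := continuation_comp cf fK ch2.
  have cc : continuation I01 (H \o f) (fun=> 0).
    move=> t t01; have [cHf _] := chf t t01; split => //.
    have [|W [P [lP Wt]]] := loc_ex (x := H (f t)).
      by have [+ +] := fK t t01; case: (f t) => x y; exact: DH.
    exists W, P, (- P a); split => //; apply: filterE => y y01.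
    by rewrite /= Ha// subrr.
  have := continuation_unique c1 chf cc I0 I1; rewrite /= !subr0.
  by [].
have E1 : h2 (0, 0) = h2 (1, 0).
  apply: (cst_cont (fun s => (s, 0))); [exact: chz|by []|].
  by move=> s /Hs[].
have E2 : h2 (1, 0) = h2 (1, 1).
  apply: (cst_cont (fun t => (1, t))); [exact: cv|by []|].
  by move=> s /Ht[].
have E3 : h2 (0, 1) = h2 (1, 1).
  apply: (cst_cont (fun s => (s, 1))); [exact: chz|by []|].
  by move=> s /Hs[].
have chg : continuation I01 g (h2 \o (fun t => (0, t))).
  apply: (continuation_extH (H := H \o (fun t => (0, t)))).
    by move=> t /Ht[].
  by apply: continuation_comp ch2.
have := continuation_unique c1 ch chg I0 I1; rewrite /= E1 E2 -E3 h0 h1.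
by move=> /addIr.
Qed.

Hypothesis loc_path : forall x, D x -> exists W P, [/\ loc W P, W x &
  forall y, W y -> exists g : R -> T, [/\ {within `[0, 1], continuous g},
    (forall t : R, t \in `[0, 1] -> W (g t)), g 0 = x & g 1 = y]].

(** The value at x is the one continued from a along any path; by
    continues_loop the path does not matter. *)
Lemma global_continuation a b : D a -> exists phi : T -> V, phi a = b /\
  forall x, D x -> exists W P, [/\ loc W P, W x &
    forall y, W y -> phi y = phi x + (P y - P x)].
Proof.
move=> Da.
have uniq x v v' : continues a b x v -> continues a b x v' -> v = v'.
  move=> r1 r2; have /continues_sym/(continues_translate (v - v')) r3 := r2.
  rewrite [v' + _]addrC subrK in r3.
  have := continues_loop (continues_trans r1 r3).
  move=> /eqP; rewrite -subr_eq0 opprD addrA subrr sub0r oppr_eq0 subr_eq0.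
  by move=> /eqP.
have ex x : D x -> exists v, continues a b x v.
  move=> Dx; have [g [cg Dg g0 g1]] := scD.1 a x Da Dx.
  by have := continues_exists b cg Dg; rewrite g0 g1.
pose phi x := xget 0 [set v | continues a b x v].
have phiP x : D x -> continues a b x (phi x).
  by move=> /ex[v rv]; rewrite /phi; apply: (xgetPex 0 (P := [set v | continues a b x v])); exists v.
have step W P x y v : loc W P -> (exists g : R -> T, [/\ {within `[0, 1], continuous g},
    (forall t : R, t \in `[0, 1] -> W (g t)), g 0 = x & g 1 = y]) ->
    continues x v y (v + (P y - P x)).
  move=> lP [g [cg Wg g0 g1]]; exists g, (fun t => P (g t) + (v - P x)).
  split => //; [|by rewrite g0 addrC subrK|by rewrite g1 addrCA].
  by apply: (continuation_local (W := W)) => //; exact: within_nbhs.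
exists phi; split.
  apply: uniq (phiP a Da) _.
  have [W [P [lP Wa]]] := loc_ex Da.
  have := @step W P a a b lP; rewrite subrr addr0; apply.
  exists (fun=> a); split => //.
  by apply: continuous_subspaceT; exact: cst_continuous.
move=> x Dx; have [W [P [lP Wx pW]]] := loc_path Dx.
exists W, P; split => // y Wy.
apply: uniq (phiP y _) _; first by have [_] := loc_open lP; apply.
exact: continues_trans (phiP x Dx) (step _ _ _ _ _ lP (pW y Wy)).
Qed.

End Continuation.

(** * Charts and maps into a surface *)

Section Charts.
Context {R : realType} {T : topologicalType}.
Implicit Types (D : set T) (U : set 'rV[R]_2) (p : 'rV[R]_2 -> T).

Definition lift U p (x : T) : 'rV[R]_2 := xget 0 [set u | U u /\ p u = x].

Lemma liftP U p x : (p @` U) x -> U (lift U p x) /\ p (lift U p x) = x.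
Proof.
move=> [u Uu pu]; rewrite /lift.
by apply: (xgetPex 0 (P := [set u | U u /\ p u = x])); exists u.
Qed.

Lemma liftK U p u : set_inj U p -> U u -> lift U p (p u) = u.
Proof.
move=> inj Uu; have [Ul pl] := @liftP U p (p u) (imageP p Uu).
by apply: inj => //; rewrite inE.
Qed.

Lemma chart_open (V : normedModType R) D (f : T -> V) U p :
  chart D f U p -> open (p @` U).
Proof. by move=> [oU _ op _ _]; exact: op. Qed.

Lemma lift_continuous (V : normedModType R) D (f : T -> V) U p x :
  chart D f U p -> (p @` U) x -> {for x, continuous (lift U p)}.
Proof.
move=> [oU [cp inj] op _ _] px N HN; have [Ul pl] := liftP px.
have : nbhs (lift U p x) (N `&` U) by apply: filterI => //; exact: open_nbhs_nbhs.
rewrite nbhsE => -[S [oS Sl] SN].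
have oW : open [set p u | u in S] by apply: op => // u /SN[].
have Wx : [set p u | u in S] x by exists (lift U p x).
apply: filterS (open_nbhs_nbhs (conj oW Wx)) => _ [u Su <-].
by have [Nu Uu] := SN _ Su; rewrite /preimage /= liftK.
Qed.

Lemma chart_sub (V : normedModType R) D (f : T -> V) U p (W : set 'rV[R]_2) :
  open W -> W `<=` U -> chart D f U p -> chart D f W p.
Proof.
move=> oW sW [oU [cp inj] op sD [Cf imm]]; split => //.
- split; first by move=> u /sW /cp.
  by move=> u v; rewrite !inE => /sW Uu /sW Uv; apply: inj; rewrite inE.
- by move=> O oO sO; apply: op => // u /sO /sW.
- by move=> _ [u /sW Uu <-]; apply: sD; exists u.
- by split => [k|u w /sW]; [exact: Ck_sub sW (Cf k)|exact: imm].
Qed.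

Section Along.
Context {m : nat} {E V : normedModType R}.
Variables (D : set T) (f : T -> 'rV[R]_m) (h : E -> T) (W : set E).
Hypothesis oW : open W.
Hypothesis ch : forall e, W e -> {for e, continuous h}.
Hypothesis Cfh : smooth_on W (f \o h).

Section OneChart.
Variables (U : set 'rV[R]_2) (p : 'rV[R]_2 -> T).
Hypothesis cp : chart D f U p.

Let W' := W `&` [set e | (p @` U) (h e)].

Lemma lift_domain_open : open W'.
Proof.
rewrite openE => e [We pe]; apply: filterI; first exact: open_near.
exact: (ch We (open_nbhs_nbhs (conj (chart_open cp) pe))).
Qed.

(** The map lift o h is continuous and its composition with the immersion f
    o p is f o h, so that factor_smooth applies. *)
Lemma smooth_lift : smooth_on W' (lift U p \o h).
Proof.
have [oU [cpp inj] op sD [Cf imm]] := cp.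
apply: (factor_smooth oU lift_domain_open Cf imm).
- by move=> e [_ /liftP[]].
- move=> e [We pe]; apply: continuous_comp; first exact: ch.
  exact: lift_continuous cp pe.
- move=> k; apply: (Ck_ext lift_domain_open (f := f \o h)).
    by move=> e [_ /liftP[_ /= ->]].
  by apply: Ck_sub (Cfh k) => e [].
Qed.

Lemma smooth_on_lift (g : T -> V) : smooth_on U (g \o p) -> smooth_on W' (g \o h).
Proof.
move=> Cg k; apply: (Ck_ext lift_domain_open (f := (g \o p) \o (lift U p \o h))).
  by move=> e [_ /liftP[_ /= ->]].
apply: (Ck_comp lift_domain_open _ (Cg k) (smooth_lift k)).
by move=> e [_ /liftP[]].
Qed.

Lemma derive_lift (g : T -> V) e v : (forall u, U u -> differentiable (g \o p) u) ->
  W e -> (p @` U) (h e) ->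
  'D_v (g \o h) e = 'D_('D_v (lift U p \o h) e) (g \o p) (lift U p (h e)).
Proof.
move=> dg We pe; have We' : W' e by [].
have [dl _] := smooth_lift 1; have [Ul pl] := liftP pe.
rewrite (derive_ext (g := (g \o p) \o (lift U p \o h)) v lift_domain_open _ We'); last first.
  by move=> x [_ /liftP[_ /= ->]].
rewrite deriveE; last by apply: differentiable_comp; [exact: dl|exact: dg].
rewrite diff_comp /=; [|exact: dl|exact: dg].
by rewrite -(deriveE _ (dl _ We')) -(deriveE _ (dg _ Ul)).
Qed.

End OneChart.

(** Near each point g o h is g o p composed with the smooth map lift o h. *)
Lemma smooth_along (g : T -> V) : (forall e, W e -> exists U p,
    [/\ chart D f U p, (p @` U) (h e) & smooth_on U (g \o p)]) ->
  smooth_on W (g \o h).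
Proof.
move=> H k; apply: Ck_local => e We; have [U [p [cp pe Cg]]] := H e We.
by exists (W `&` [set e | (p @` U) (h e)]) => //; exact: smooth_on_lift.
Qed.

End Along.

(** Both derivatives are those of g o p and of f o p at the lifted point, in
    the direction of the derivative of the lift. *)
Lemma derive_along m n (E : normedModType R) (D : set T) (f : T -> 'rV[R]_m)
    (h : E -> T) (W : set E) U p (g : T -> 'rV[R]_n) (M : 'M[R]_(m, n)) e v :
  open W -> (forall e, W e -> {for e, continuous h}) -> smooth_on W (f \o h) ->
  chart D f U p -> smooth_on U (g \o p) ->
  (forall u w, U u -> p u = h e -> 'D_w (g \o p) u = 'D_w (f \o p) u *m M) ->
  W e -> (p @` U) (h e) -> 'D_v (g \o h) e = 'D_v (f \o h) e *m M.
Proof.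
move=> oW ch Cfh cp Cg DM We pe; have [Ul pl] := liftP pe.
have [oU [cpp inj] op sD [Cf imm]] := cp.
have [dg _] := Cg 1%N; have [df _] := Cf 1%N.
rewrite (derive_lift oW ch Cfh cp v dg We pe) (derive_lift oW ch Cfh cp v df We pe).
exact: DM.
Qed.

End Charts.

(** * Euclidean geometry of the space of dimension three *)

Section EuclideanSpace.
Context {R : realType}.
Implicit Types (a b c n s u v w : 'rV[R]_3).

Notation o0 := (@Ordinal 3 0 isT).
Notation o1 := (@Ordinal 3 1 isT).
Notation o2 := (@Ordinal 3 2 isT).

Lemma sum3 (V : nmodType) (F : 'I_3 -> V) : \sum_i F i = F o0 + F o1 + F o2.
Proof.
rewrite !big_ord_recl big_ord0 addr0 addrA.
by congr (F _ + F _ + F _); apply: val_inj.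
Qed.

Lemma row3P u v : u 0 o0 = v 0 o0 -> u 0 o1 = v 0 o1 -> u 0 o2 = v 0 o2 -> u = v.
Proof.
move=> h0 h1 h2; apply/rowP => -[[|[|[|//]]] i].
- by rewrite (_ : Ordinal i = o0)//; exact: val_inj.
- by rewrite (_ : Ordinal i = o1)//; exact: val_inj.
- by rewrite (_ : Ordinal i = o2)//; exact: val_inj.
Qed.

Lemma dotE u v : dot u v = u 0 o0 * v 0 o0 + u 0 o1 * v 0 o1 + u 0 o2 * v 0 o2.
Proof. by rewrite /dot mxE sum3 !mxE. Qed.

Lemma dotC u v : dot u v = dot v u.
Proof. by rewrite !dotE; ring. Qed.

Lemma dotDl u v w : dot (u + v) w = dot u w + dot v w.
Proof. by rewrite /dot mulmxDl mxE. Qed.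

Lemma dotZl (k : R) u w : dot (k *: u) w = k * dot u w.
Proof. by rewrite /dot -scalemxAl mxE. Qed.

Lemma dotDr u v w : dot w (u + v) = dot w u + dot w v.
Proof. by rewrite dotC dotDl !(dotC w). Qed.

Lemma dotZr (k : R) u w : dot w (k *: u) = k * dot w u.
Proof. by rewrite dotC dotZl (dotC w). Qed.

Lemma dot0l u : dot 0 u = 0.
Proof. by rewrite /dot mul0mx mxE. Qed.

Lemma dot_mulmx (A : 'M[R]_3) u v : dot (u *m A) v = dot u (v *m A^T).
Proof. by rewrite /dot trmx_mul trmxK mulmxA. Qed.

Lemma mul_dot u v : u *m v^T = (dot u v)%:M.
Proof. by rewrite /dot [LHS]mx11_scalar. Qed.

Lemma dot_ge0 u : 0 <= dot u u.
Proof. by rewrite dotE -!expr2 !addr_ge0 ?sqr_ge0. Qed.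

Lemma dot_eq0 u : dot u u = 0 -> u = 0.
Proof.
rewrite dotE -!expr2 => /eqP; rewrite paddr_eq0 ?addr_ge0 ?sqr_ge0//.
rewrite paddr_eq0 ?sqr_ge0// !sqrf_eq0 => /andP[/andP[/eqP h0 /eqP h1] /eqP h2].
by apply: row3P; rewrite mxE.
Qed.

Lemma det_mx33 (M : 'M[R]_3) : \det M =
  M o0 o0 * (M o1 o1 * M o2 o2 - M o1 o2 * M o2 o1)
  - M o0 o1 * (M o1 o0 * M o2 o2 - M o1 o2 * M o2 o0)
  + M o0 o2 * (M o1 o0 * M o2 o1 - M o1 o1 * M o2 o0).
Proof.
rewrite (expand_det_row _ o0) sum3 /cofactor.
rewrite !(expand_det_row _ ord0) !big_ord_recl !big_ord0 /cofactor !det_mx11.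
rewrite !mxE /= !expr0 !expr1 !addr0 !mul1r.
have E1 : fintype.lift o0 (ord0 : 'I_2) = o1 by exact: val_inj.
have E2 : fintype.lift o0 (fintype.lift ord0 ord0 : 'I_2) = o2 by exact: val_inj.
have E3 : fintype.lift o1 (ord0 : 'I_2) = o0 by exact: val_inj.
have E4 : fintype.lift o1 (fintype.lift ord0 ord0 : 'I_2) = o2 by exact: val_inj.
have E5 : fintype.lift o2 (ord0 : 'I_2) = o0 by exact: val_inj.
have E6 : fintype.lift o2 (fintype.lift ord0 ord0 : 'I_2) = o1 by exact: val_inj.
have E7 : fintype.lift (fintype.lift ord0 ord0 : 'I_2) (ord0 : 'I_1) = ord0 by exact: val_inj.
have E0 : 0 = ord0 :> 'I_1 by [].
rewrite !E0 !E7 !E1 !E2 !E3 !E4 !E5 !E6.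
by ring.
Qed.

Lemma det3E a b c : det3 a b c =
  a 0 o0 * (b 0 o1 * c 0 o2 - b 0 o2 * c 0 o1)
  - a 0 o1 * (b 0 o0 * c 0 o2 - b 0 o2 * c 0 o0)
  + a 0 o2 * (b 0 o0 * c 0 o1 - b 0 o1 * c 0 o0).
Proof.
rewrite /det3 det_mx33.
have E0 j : (col_mx a (col_mx b c) : 'M[R]_3) o0 j = a 0 j.
  by rewrite (_ : o0 = lshift (1 + 1) (0 : 'I_1)); [exact: (col_mxEu a (col_mx b c))|exact: val_inj].
have E1 j : (col_mx a (col_mx b c) : 'M[R]_3) o1 j = b 0 j.
  rewrite (_ : o1 = rshift 1 (lshift 1 (0 : 'I_1))); last exact: val_inj.
  by rewrite [LHS](col_mxEd a (col_mx b c)); exact: (col_mxEu b c).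
have E2 j : (col_mx a (col_mx b c) : 'M[R]_3) o2 j = c 0 j.
  rewrite (_ : o2 = rshift 1 (rshift 1 (0 : 'I_1))); last exact: val_inj.
  by rewrite [LHS](col_mxEd a (col_mx b c)); exact: (col_mxEd b c).
by rewrite !E0 !E1 !E2.
Qed.

Definition cross a b : 'rV[R]_3 :=
  \row_i (a 0 (i + 1) * b 0 (i + 2) - a 0 (i + 2) * b 0 (i + 1)).

Lemma crossE a b : (cross a b 0 o0 = a 0 o1 * b 0 o2 - a 0 o2 * b 0 o1) *
  (cross a b 0 o1 = a 0 o2 * b 0 o0 - a 0 o0 * b 0 o2) *
  (cross a b 0 o2 = a 0 o0 * b 0 o1 - a 0 o1 * b 0 o0).
Proof.
by split; [split|]; rewrite mxE;
  congr (a 0 _ * b 0 _ - a 0 _ * b 0 _); exact: val_inj.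
Qed.

Lemma det3_cross a b c : det3 a b c = dot (cross a b) c.
Proof. by rewrite det3E dotE !crossE; ring. Qed.

Lemma dot_cross_l a b : dot (cross a b) a = 0.
Proof. by rewrite dotE !crossE; ring. Qed.

Lemma dot_cross_r a b : dot (cross a b) b = 0.
Proof. by rewrite dotE !crossE; ring. Qed.

Definition unit_normal a b : 'rV[R]_3 :=
  (Num.sqrt (dot (cross a b) (cross a b)))^-1 *: cross a b.

Definition independent a b := forall x y : R, x *: a + y *: b = 0 -> x = 0 /\ y = 0.

Lemma independent_cross a b : independent a b -> 0 < dot (cross a b) (cross a b).
Proof.
move=> ind; rewrite lt_neqAle dot_ge0 andbT eq_sym; apply/eqP => /dot_eq0 c0.
have E : dot a b *: a + (- dot a a) *: b = 0.
  have h0 : cross a b 0 o0 = 0 by rewrite c0 mxE.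
  have h1 : cross a b 0 o1 = 0 by rewrite c0 mxE.
  have h2 : cross a b 0 o2 = 0 by rewrite c0 mxE.
  have F i : (dot a b *: a + (- dot a a) *: b) 0 i = dot a b * a 0 i - dot a a * b 0 i.
    by rewrite !mxE mulNr.
  (* the coordinates of a x (a x b) *)
  apply: row3P; rewrite F !mxE !dotE.
  - transitivity (a 0 o1 * cross a b 0 o2 - a 0 o2 * cross a b 0 o1); last by rewrite h1 h2 !mulr0 subrr.
    by rewrite !crossE; ring.
  - transitivity (a 0 o2 * cross a b 0 o0 - a 0 o0 * cross a b 0 o2); last by rewrite h0 h2 !mulr0 subrr.
    by rewrite !crossE; ring.
  - transitivity (a 0 o0 * cross a b 0 o1 - a 0 o1 * cross a b 0 o0); last by rewrite h1 h0 !mulr0 subrr.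
    by rewrite !crossE; ring.
have [_ /eqP] := ind _ _ E; rewrite oppr_eq0 => /eqP/dot_eq0 a0.
have [] := ind 1 0; first by rewrite a0 scaler0 scale0r addr0.
by move=> /eqP; rewrite oner_eq0.
Qed.

Lemma unit_normalP a b : independent a b ->
  [/\ dot (unit_normal a b) (unit_normal a b) = 1, dot (unit_normal a b) a = 0,
      dot (unit_normal a b) b = 0 & 0 < det3 a b (unit_normal a b)].
Proof.
move=> /independent_cross c0; rewrite /unit_normal.
have s0 : 0 < Num.sqrt (dot (cross a b) (cross a b)) by rewrite sqrtr_gt0.
split.
- rewrite dotZl dotZr mulrA -invfM -expr2 sqr_sqrtr ?ltW// mulVf//.
  by rewrite gt_eqF.
- by rewrite dotZl dot_cross_l mulr0.
- by rewrite dotZl dot_cross_r mulr0.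
- by rewrite det3_cross dotZr mulr_gt0// invr_gt0.
Qed.

Lemma unit_normal_unique a b n : dot n n = 1 -> dot n a = 0 -> dot n b = 0 ->
  0 < det3 a b n -> n = unit_normal a b.
Proof.
move=> nn na nb d0; set c := cross a b.
have E : c = det3 a b n *: n.
  rewrite -[LHS]scale1r -nn det3_cross -/c.
  (* m = a (n.b) - b (n.a) is the double cross product of n, a and b *)
  pose m i := a 0 i * dot n b - b 0 i * dot n a.
  have m0 i : m i = 0 by rewrite /m na nb !mulr0 subrr.
  apply: row3P; rewrite [LHS]mxE [RHS]mxE.
  - transitivity (dot c n * n 0 o0 + (m o1 * n 0 o2 - m o2 * n 0 o1)).
      by rewrite /m /c !dotE !crossE; ring.
    by rewrite !m0 !mul0r subrr addr0.
  - transitivity (dot c n * n 0 o1 + (m o2 * n 0 o0 - m o0 * n 0 o2)).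
      by rewrite /m /c !dotE !crossE; ring.
    by rewrite !m0 !mul0r subrr addr0.
  - transitivity (dot c n * n 0 o2 + (m o0 * n 0 o1 - m o1 * n 0 o0)).
      by rewrite /m /c !dotE !crossE; ring.
    by rewrite !m0 !mul0r subrr addr0.
rewrite /unit_normal -/c [in dot c c]E dotZl dotZr nn mulr1 -expr2 sqrtr_sqr gtr0_norm//.
by rewrite [in RHS]E scalerA mulVf ?scale1r// gt_eqF.
Qed.

Lemma det3_comb a b n (x y z t : R) :
  det3 (x *: a + y *: b) (z *: a + t *: b) n = (x * t - y * z) * det3 a b n.
Proof. by rewrite !det3E !mxE; ring. Qed.

Lemma det3Nl a b c : det3 (- a) b c = - det3 a b c.
Proof. by rewrite !det3E !mxE; ring. Qed.

Lemma det3_add_l a b c (k : R) : det3 (a - k *: c) b c = det3 a b c.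
Proof. by rewrite !det3E !mxE; ring. Qed.

Lemma det3_add_m a b c (k : R) : det3 a (b - k *: c) c = det3 a b c.
Proof. by rewrite !det3E !mxE; ring. Qed.

(** Cramer's rule in the plane orthogonal to n. *)
Lemma normal_span a b n v : dot n n = 1 -> dot n a = 0 -> dot n b = 0 ->
  det3 a b n != 0 -> dot n v = 0 ->
  v = (det3 v b n / det3 a b n) *: a + (det3 a v n / det3 a b n) *: b.
Proof.
move=> nn na nb d0 nv.
have D0 : det3 a b v = 0.
  (* det3 a b v * (n.n) expands along n.a, n.b and n.v *)
  rewrite -[LHS]mul1r -nn.
  transitivity (dot n a * det3 n b v + dot n b * det3 a n v + dot n v * det3 a b n).
    by rewrite !det3E !dotE; ring.
  by rewrite na nb nv !mul0r !addr0.
have E i : det3 a b n * v 0 i = det3 v b n * a 0 i + det3 a v n * b 0 i.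
  rewrite -[RHS]addr0 -[X in _ + X](mul0r (n 0 i)) -[X in X * n 0 i]D0.
  have [->|[->|->]] : i = o0 \/ i = o1 \/ i = o2; try by rewrite !det3E; ring.
  case: i => -[|[|[|//]]] i; [left|right; left|right; right]; exact: val_inj.
apply/rowP => i; rewrite !mxE; apply: (mulfI d0); rewrite E.
by field.
Qed.

End EuclideanSpace.

(** * The bundle Q and the inverse of q *)

Section Bundle.
Context {R : realType}.
Implicit Types (E : normedModType R) (s : 'rV[R]_3) (q : 'M[R]_3).

(** Newton's identity between the determinant and the power sums of the
    eigenvalues. *)
Lemma newton3 (M : 'M[R]_3) : 6 * \det M =
  (\tr M) ^+ 3 - 3 * \tr M * \tr (M *m M) + 2 * \tr (M *m M *m M).
Proof.
rewrite det_mx33 /mxtrace !sum3 !mxE !sum3 !mxE !sum3.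
by ring.
Qed.

Lemma Qbundle_mul s q : Qbundle (s, q) -> s *m q = 0 /\ q *m s^T = 0.
Proof.
move=> [/= ss qT tq sq]; split => //.
by apply: trmx_inj; rewrite trmx_mul trmxK qT sq trmx0.
Qed.

(** As q s = 0, the traces of the powers of plus_id s q exceed those of q by
    1, and det q = 0. Newton's identities for q and for plus_id s q then
    give 2 det (plus_id s q) = - tr (q^2), where tr (q^2) is the sum of the
    squares of the entries of the symmetric matrix q. *)
Lemma plus_id_unit s q : Qnz (s, q) -> plus_id s q \in unitmx.
Proof.
move=> [Q /= qn0]; have [sq qs] := Qbundle_mul Q; have [/= ss qT tq _] := Q.
have tss : \tr (s^T *m s) = 1 by rewrite mxtrace_mulC mul_dot ss mxtrace1.
have PP : plus_id s q *m plus_id s q = q *m q + s^T *m s.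
  rewrite /plus_id mulmxDl !mulmxDr !mulmxA qs mul0mx addr0 -[s^T *m s *m q]mulmxA sq mulmx0 add0r.
  by rewrite -[s^T *m s *m s^T]mulmxA mul_dot ss mulmx1.
have PPP : plus_id s q *m plus_id s q *m plus_id s q = q *m q *m q + s^T *m s.
  rewrite PP /plus_id mulmxDl !mulmxDr !mulmxA -[q *m q *m s^T]mulmxA qs mulmx0 mul0mx addr0.
  rewrite -[s^T *m s *m q]mulmxA sq mulmx0 add0r.
  by rewrite -[s^T *m s *m s^T]mulmxA mul_dot ss mulmx1.
have dq : \det q = 0.
  apply/eqP/det0P; exists s => //; apply/eqP => s0.
  by move: ss; rewrite s0 dot0l => /eqP; rewrite eq_sym oner_eq0.
have Nq := newton3 q; rewrite dq tq mulr0 expr0n /= mulr0 mul0r subr0 add0r in Nq.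
have t3 : \tr (q *m q *m q) = 0 by apply/eqP; have := esym Nq => /eqP; rewrite mulf_eq0 pnatr_eq0.
have NP := newton3 (plus_id s q).
rewrite PPP PP !mxtraceD tss tq add0r t3 add0r expr1n !mulr1 in NP.
have tqq : \tr (q *m q) = \sum_i \sum_j q i j ^+ 2.
  rewrite -{2}qT /mxtrace; apply: eq_bigr => i _; rewrite mxE.
  by apply: eq_bigr => j _; rewrite mxE expr2.
rewrite unitmxE unitfE; apply/eqP => d0; rewrite d0 mulr0 in NP.
have t2 : \tr (q *m q) = 0.
  by move: NP; move: (\tr _) => x; clear; lra.
move: qn0 => /eqP; apply; apply/matrixP => i j; rewrite mxE.
move: t2; rewrite tqq => /eqP; rewrite psumr_eq0; last first.
  by move=> k _; apply: sumr_ge0 => l _; exact: sqr_ge0.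
move=> /allP /(_ i (mem_index_enum _)); rewrite /= psumr_eq0; last first.
  by move=> l _; exact: sqr_ge0.
by move=> /allP /(_ j (mem_index_enum _)) /=; rewrite sqrf_eq0 => /eqP.
Qed.

Lemma mul_plus_id s q (v : 'rV[R]_3) : dot v s = 0 -> v *m plus_id s q = v *m q.
Proof.
by move=> vs; rewrite /plus_id mulmxDr mulmxA mul_dot vs raddf0 mul0mx addr0.
Qed.

Lemma omega_inverse s q (v : 'rV[R]_3) : Qnz (s, q) -> dot v s = 0 ->
  dot (v *m invmx (plus_id s q)) s = 0 /\ v *m invmx (plus_id s q) *m q = v.
Proof.
move=> Qn vs; have Pu := plus_id_unit Qn; set x := v *m _.
have [/Qbundle_mul[sq qs] _] := Qn; have [[/= ss _ _ _] _] := Qn.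
have xP : x *m plus_id s q = v by rewrite /x mulmxKV.
have xs : dot x s = 0.
  have := xP; rewrite /plus_id mulmxDr => /(congr1 (fun z => (z *m s^T) 0 0)).
  rewrite -/(dot v s) vs mulmxDl -mulmxA qs mulmx0 add0r -!mulmxA mul_dot ss mulmx1.
  by rewrite mulmxA.
by split => //; rewrite -[RHS]xP mul_plus_id.
Qed.

Lemma derive_mulmx E m n p (a : E -> 'M[R]_(m, n)) (b : E -> 'M[R]_(n, p)) x (v : E) :
  differentiable a x -> differentiable b x ->
  differentiable (fun y => a y *m b y) x /\
  'D_v (fun y => a y *m b y) x = 'D_v a x *m b x + a x *m 'D_v b x.
Proof.
move=> da db.
have H i j l := derive_scale v (differentiable_coordf i l da) (differentiable_coordf l j db).
have dab : differentiable (fun y => a y *m b y) x.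
  apply: differentiable_mx => i j.
  rewrite (_ : (fun y => _) = \sum_l (fun y => a y i l * b y l j)); last first.
    by apply: funext => y; rewrite mxE fct_sumE.
  elim/big_ind : _ => [|f g df dg|l _]; [exact: differentiable_cst|exact: differentiableD|].
  by have [] := H i j l.
split => //; apply/matrixP => i j; rewrite -derive_coord//.
have E1 l : is_derive x v (fun y => a y i l * b y l j)
    (('D_v a x) i l * b x l j + a x i l * ('D_v b x) l j).
  have [d1 d2] := H i j l; apply: DeriveDef; first exact: diff_derivable.
  by rewrite d2 !derive_coord// addrC.
have [_] := is_derive_sum E1.
rewrite (_ : \sum_l _ = fun y => (a y *m b y) i j); last first.
  by apply: funext => y; rewrite mxE fct_sumE.
by move=> ->; rewrite big_split /= !mxE.
Qed.

Lemma derive_trmx E m n (a : E -> 'M[R]_(m, n)) x (v : E) : differentiable a x ->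
  differentiable (fun y => (a y)^T) x /\
  'D_v (fun y => (a y)^T) x = ('D_v a x)^T.
Proof.
move=> da; have d : differentiable (fun y => (a y)^T) x.
  apply: differentiable_mx => i j.
  rewrite (_ : (fun y => _) = fun y => a y j i); first exact: differentiable_coordf.
  by apply: funext => y; rewrite mxE.
split => //; apply/matrixP => i j; rewrite -derive_coord// mxE -derive_coord//.
by congr ('D_v _ x); apply: funext => y; rewrite mxE.
Qed.

Lemma derive_linear E (V W : normedModType R) (L : {linear V -> W}) (F : E -> V) x (v : E) :
  continuous L -> differentiable F x ->
  differentiable (L \o F) x /\ 'D_v (L \o F) x = L ('D_v F x).
Proof.
move=> cL dF; have dL := linear_differentiable (F x) cL.
have d := differentiable_comp dF dL.
by split => //; rewrite deriveE// (diff_comp dF dL) /= diff_lin// deriveE.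
Qed.

Lemma derive_fst E (V W : normedModType R) (F : E -> V * W) x (v : E) :
  differentiable F x -> differentiable (fun y => (F y).1) x /\
  'D_v (fun y => (F y).1) x = ('D_v F x).1.
Proof. by apply: (derive_linear (L := fst)) => z; exact: cvg_fst. Qed.

Lemma derive_snd E (V W : normedModType R) (F : E -> V * W) x (v : E) :
  differentiable F x -> differentiable (fun y => (F y).2) x /\
  'D_v (fun y => (F y).2) x = ('D_v F x).2.
Proof. by apply: (derive_linear (L := snd)) => z; exact: cvg_snd. Qed.

Lemma derive_dot E (a b : E -> 'rV[R]_3) x (v : E) :
  differentiable a x -> differentiable b x ->
  differentiable (fun y => dot (a y) (b y)) x /\
  'D_v (fun y => dot (a y) (b y)) x = dot ('D_v a x) (b x) + dot (a x) ('D_v b x).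
Proof.
move=> da db; have [dbt Db] := derive_trmx v db.
have [dm Dm] := derive_mulmx v da dbt.
split; first exact: differentiable_coordf.
by rewrite derive_coord// Dm Db mxE.
Qed.

Lemma derive_trace E n (a : E -> 'M[R]_n) x (v : E) : differentiable a x ->
  'D_v (fun y => \tr (a y)) x = \tr ('D_v a x).
Proof.
move=> da.
have E1 i : is_derive x v (fun y => a y i i) (('D_v a x) i i).
  apply: DeriveDef; last by rewrite derive_coord.
  by apply: diff_derivable; exact: differentiable_coordf.
have [_] := is_derive_sum E1.
by rewrite (_ : \sum_l _ = fun y => \tr (a y))//; apply: funext => y; rewrite fct_sumE.
Qed.

(** The derivatives of the four equations of Q. *)
Lemma tangent_Qbundle E (F : E -> ambient R) (U : set E) x (v : E) : open U -> U x ->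
  differentiable F x -> (forall y, U y -> Qbundle (F y)) ->
  [/\ dot ('D_v F x).1 (F x).1 = 0, (('D_v F x).2)^T = ('D_v F x).2,
      \tr ('D_v F x).2 = 0 & ('D_v F x).1 *m (F x).2 + (F x).1 *m ('D_v F x).2 = 0].
Proof.
move=> oU Ux dF QF; have [d1 D1] := derive_fst v dF; have [d2 D2] := derive_snd v dF.
have cst0 (V : normedModType R) (g : E -> V) a : (forall y, U y -> g y = a) -> 'D_v g x = 0.
  by move=> ga; rewrite (derive_ext (g := cst a) v oU ga Ux) derive_cst.
split.
- have [_ DD] := derive_dot v d1 d1.
  have : 'D_v (fun y => dot (F y).1 (F y).1) x = 0.
    by apply: (cst0 R _ 1) => y /QF[].
  rewrite DD D1 [dot (F x).1 _]dotC -mulr2n => /eqP.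
  by rewrite mulrn_eq0 /= => /eqP.
- rewrite -D2; have [_ <-] := derive_trmx v d2.
  apply: (derive_ext v oU _ Ux) => y /QF[_ + _ _]; by [].
- by rewrite -D2 -derive_trace//; apply: (cst0 R _ 0) => y /QF[].
- rewrite -D1 -D2; have [_ <-] := derive_mulmx v d1 d2.
  by apply: (cst0 _ _ 0) => y /QF[].
Qed.

(** The tangent space of Q projects onto that of the sphere. Let M_t be the
    reflection in the plane orthogonal to s + (t/2) v. Then - s M_t lies on
    the sphere and moves away from s with velocity v, and conjugation by M_t
    carries q along within Q. *)
Lemma Qbundle_projection_onto s q (v : 'rV[R]_3) : Qbundle (s, q) -> dot s v = 0 ->
  exists d, tangent_set (@Qbundle R) (s, q) (v, d).
Proof.
move=> Q sv; have [sq qs] := Qbundle_mul Q; have [/= ss qT tq _] := Q.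
pose w (t : R) := s + (t / 2) *: v.
pose N (t : R) := 1 + t * t * (dot v v / 4).
have Npos t : 0 < N t.
  by rewrite ltr_wpDr// mulr_ge0 ?divr_ge0 ?dot_ge0// -expr2 sqr_ge0.
have N0 t : N t != 0 by rewrite gt_eqF.
have ww t : dot (w t) (w t) = N t.
  rewrite /w dotDl !dotDr !dotZl !dotZr ss sv dotC sv /N.
  by field.
pose M (t : R) : 'M[R]_3 := 1%:M - (2 / N t) *: ((w t)^T *m w t).
have MT t : (M t)^T = M t.
  by rewrite /M linearB /= trmx1 linearZ /= trmx_mul trmxK.
have MM t : M t *m M t = 1%:M.
  have AA : ((w t)^T *m w t) *m ((w t)^T *m w t) = N t *: ((w t)^T *m w t).
    by rewrite mulmxA -[(w t)^T *m w t *m (w t)^T]mulmxA mul_dot ww mul_mx_scalar -scalemxAl.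
  rewrite /M mulmxBl mul1mx mulmxBr mulmx1 -scalemxAl -scalemxAr AA !scalerA.
  have -> : 2 / N t * (2 / N t) * N t = 2 / N t + 2 / N t by field.
  by rewrite scalerDl opprB addrK subrK.
pose g (t : R) : ambient R := (- s *m M t, M t *m q *m M t).
have Cw k : Ck k setT w.
  apply: CkD; [exact: openT|exact: Ck_cst|].
  apply: CkZ; [exact: openT| |exact: Ck_cst].
  by apply: CkM; [exact: openT|exact: Ck_id|exact: Ck_cst].
have CN k : Ck k setT N.
  apply: CkD; [exact: openT|exact: Ck_cst|].
  apply: CkM; [exact: openT| |exact: Ck_cst].
  by apply: CkM; [exact: openT|exact: Ck_id|exact: Ck_id].
have CM k : Ck k setT M.
  apply: (@Ck_ext R k _ _ setT (fun t => 1%:M + (- (2 * (N t)^-1)) *: ((w t)^T *m w t))).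
  - exact: openT.
  - by move=> t _; rewrite /M scaleNr.
  apply: CkD; [exact: openT|exact: Ck_cst|].
  apply: CkZ; [exact: openT| |].
    apply: (@Ck_ext R k _ _ setT (fun t => (-2) * (N t)^-1)); first exact: openT.
      by move=> t _; rewrite mulNr.
    apply: CkM; [exact: openT|exact: Ck_cst|].
    by apply: CkV; [exact: openT|move=> t _|].
  apply: Ck_mulmx; [exact: openT| |exact: Cw].
  by apply: Ck_trmx; [exact: openT|exact: Cw].
have Cg k : Ck k setT g.
  apply: Ck_pair; [exact: openT| |].
    by apply: Ck_mulmx; [exact: openT|exact: Ck_cst|exact: CM].
  apply: Ck_mulmx; [exact: openT| |exact: CM].
  by apply: Ck_mulmx; [exact: openT|exact: CM|exact: Ck_cst].
have sM t : - s *m M t = (2 / N t) *: w t - s.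
  have sw : dot s (w t) = 1 by rewrite /w dotDr dotZr ss sv mulr0 addr0.
  rewrite /M mulmxBr mulmx1 -scalemxAr !mulNmx mulmxA mul_dot sw mul1mx.
  by rewrite scalerN opprK addrC.
have M0 : M 0 = 1%:M - 2 *: (s^T *m s).
  by rewrite /M /w /N !mul0r scale0r !addr0 divr1.
have dg : differentiable g 0 by have [+ _] := Cg 1%N; apply.
exists ('D_1 g 0).2; exists g, setT; split => //.
- exact: openT.
- move=> t _; split => /=.
  + rewrite dot_mulmx MT -mulmxA MM mulmx1 /dot linearN /= mulNmx mulmxN opprK.
    exact: ss.
  + by rewrite !trmx_mul MT qT mulmxA.
  + by rewrite mxtrace_mulC mulmxA MM mul1mx.
  + by rewrite !mulmxA -[- s *m M t *m M t]mulmxA MM mulmx1 mulNmx sq oppr0 mul0mx.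
- split.
    rewrite /g M0; congr pair.
      rewrite mulmxBr mulmx1 -scalemxAr mulNmx mulmxA mul_dot ss mul1mx.
      by rewrite scalerN opprK scaler_nat mulr2n addrA addNr add0r.
    rewrite mulmxBl mul1mx -scalemxAl -mulmxA sq mulmx0 scaler0 subr0.
    by rewrite mulmxBr mulmx1 -scalemxAr mulmxA qs mul0mx scaler0 subr0.
  rewrite derive1E [LHS]surjective_pairing; congr pair.
  have [d1 <-] := derive_fst (1 : R) dg.
  have dN : is_derive (0 : R) 1 N 0.
    by apply: is_derive_eq; rewrite /GRing.scale /=; ring.
  have dN0 : differentiable N 0 by have [+ _] := CN 1%N; apply.
  have dy : differentiable (fun t => (g t).1 + s) 0.
    exact: differentiableD d1 (differentiable_cst s 0).
  have [_ DNy] := derive_scale (1 : R) dN0 dy.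
  (* N is stationary at 0 with value 1, so it suffices to know the velocity
     of the affine curve N t ((g t).1 + s) *)
  have Ny : (fun t => N t *: ((g t).1 + s)) = fun t => 2 *: s + t *: v.
    apply: funext => t; rewrite /g /= sM subrK scalerA mulrC divfK// /w scalerDr scalerA.
    by congr (_ + _ *: _); field.
  rewrite Ny derive_affine derive_add_cst (@derive_val _ _ _ _ _ _ _ dN) in DNy.
  by rewrite DNy scale0r addr0 /N !mul0r addr0 scale1r.
Qed.

End Bundle.

(** * Transversality to the fibers *)

Section Transversality.
Context {R : realType} {T : topologicalType}.
Implicit Types (D : set T) (U : set 'rV[R]_2) (p : 'rV[R]_2 -> T).

(** The ambient space of Q as a space of row vectors, where factor_smooth
    applies. *)
Definition coordinates (y : ambient R) : 'rV[R]_(3 + 3 * 3) := row_mx y.1 (mxvec y.2).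

Lemma coordinates_l y (j : 'I_3) : coordinates y 0 (lshift _ j) = y.1 0 j.
Proof. by rewrite row_mxEl. Qed.

Lemma coordinates_r y (k l : 'I_3) :
  coordinates y 0 (rshift _ (mxvec_index k l)) = y.2 k l.
Proof. by rewrite row_mxEr mxvecE. Qed.

Lemma Ck_coordinates (E : normedModType R) k (U : set E) (F : E -> ambient R) :
  open U -> Ck k U F -> Ck k U (coordinates \o F).
Proof.
move=> oU CF; apply: Ck_matrix => // i j; rewrite (ord1 i) {i}.
case: (split_ordP j) => l ->.
  apply: (Ck_ext oU (f := fun x => (F x).1 0 l)) => [y _|].
    by rewrite /= coordinates_l.
  by apply: Ck_coord => //; exact: Ck_fst.
case/mxvec_indexP: l => a b.
apply: (Ck_ext oU (f := fun x => (F x).2 a b)) => [y _|].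
  by rewrite /= coordinates_r.
by apply: Ck_coord => //; exact: Ck_snd.
Qed.

Lemma coordinates_immersion (E : normedModType R) (F : E -> ambient R) u w :
  differentiable F u -> differentiable (coordinates \o F) u ->
  'D_w (coordinates \o F) u = 0 -> 'D_w F u = 0.
Proof.
move=> dF dcF D0; have [d1 D1] := derive_fst w dF; have [d2 D2] := derive_snd w dF.
rewrite [LHS]surjective_pairing -D1 -D2; congr pair.
  apply/rowP => j; rewrite -derive_coord// mxE.
  have := derive_coord w 0 (lshift (3 * 3) j) dcF; rewrite D0 mxE => <-.
  by congr ('D_w _ u); apply: funext => y; rewrite /= coordinates_l.
apply/matrixP => k l; rewrite -derive_coord// mxE.
have := derive_coord w 0 (rshift 3 (mxvec_index k l)) dcF; rewrite D0 mxE => <-.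
by congr ('D_w _ u); apply: funext => y; rewrite /= coordinates_r.
Qed.

Lemma chart_coordinates D (i : T -> ambient R) U p : chart D i U p ->
  chart D (coordinates \o i) U p.
Proof.
move=> [oU cp op sD [Ci imm]]; split => //; split.
  by move=> k; exact: (Ck_coordinates oU (Ci k)).
move=> u w Uu D0; apply: (imm u) => //.
have d1 : differentiable (i \o p) u by have [+ _] := Ci 1%N; apply.
have d2 : differentiable (coordinates \o (i \o p)) u.
  by have [+ _] := Ck_coordinates oU (Ci 1%N); apply.
exact: (coordinates_immersion d1 d2 D0).
Qed.

Lemma fiber_tangent (s : 'rV[R]_3) (y k : ambient R) :
  tangent_set (fiber s) y k -> k.1 = 0.
Proof.
move=> [g [J [oJ J0 Cg gf [_ <-]]]].
have dg : differentiable g 0 by have [+ _] := Cg 1%N; apply.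
rewrite derive1E; have [_ <-] := derive_fst (1 : R) dg.
rewrite (derive_ext (g := cst s) (1 : R) oJ _ J0) ?derive_cst// => t Jt.
by have [] := gf t Jt.
Qed.

(** The row space of J contains the kernel of s^T, which has dimension 2. *)
Lemma rank_of_tangent_plane (s : 'rV[R]_3) (J : 'M[R]_(2, 3)) : dot s s = 1 ->
  (forall v, dot s v = 0 -> exists z, v = z *m J) -> row_free J.
Proof.
move=> ss H; rewrite /row_free eqn_leq rank_leq_row /=.
have rs : \rank s^T = 1%N.
  rewrite mxrank_tr; apply/eqP; rewrite eqn_leq rank_leq_row lt0n mxrank_eq0.
  by apply/eqP => s0; move: ss; rewrite s0 dot0l => /eqP; rewrite eq_sym oner_eq0.
have : (\rank (kermx s^T) <= \rank J)%N.
  apply/mxrankS/row_subP => j.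
  have [|z ->] := H (row j (kermx s^T)); last exact: submxMl.
  have : row j (kermx s^T) *m s^T = 0 by rewrite -row_mul mulmx_ker row0.
  by rewrite dotC /dot => ->; rewrite mxE.
by rewrite mxrank_ker rs.
Qed.

(** By Qbundle_projection_onto every v orthogonal to s is the base component
    of a vector tangent to Q. Transversality writes that vector as c + k
    with k vertical, so v is also the base component of c, which is tangent
    to the surface. Thus the differential of the projection is onto the
    plane orthogonal to s, hence injective on the two-dimensional tangent
    space. *)
Lemma transverse_projection_immersion D (i : T -> ambient R) U p :
  transverse D i -> (forall x, D x -> Qbundle (i x)) -> chart D i U p ->
  forall u w, U u -> 'D_w (fst \o i \o p) u = 0 -> w = 0.
Proof.
move=> tr QD cp u w Uu.
have [oU cpp op sD [Ci imm]] := cp.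
have dip x : U x -> differentiable (i \o p) x by have [+ _] := Ci 1%N; apply.
have [d1 _] := derive_fst w (dip u Uu).
rewrite derive_jac; last exact: d1.
set J := jac _ u.
suff Jf : row_free J by move=> /eqP; rewrite mulmx_free_eq0// => /eqP.
have Dx : D (p u) by apply: sD; exists u.
have Qx := QD _ Dx.
have [ss _ _ _] := Qx.
apply: (rank_of_tangent_plane ss) => v sv.
have [d td] : exists d, tangent_set (@Qbundle R) (i (p u)) (v, d).
  move: Qx sv; case: (i (p u)) => s q /=; exact: Qbundle_projection_onto.
have [c [k [tc tk E]]] := tr _ Dx _ td.
have v1 : v = c.1.
  by have := congr1 fst E; rewrite /= (fiber_tangent tk) addr0.
have [U' [p' [u' [w' [cp' Uu' pu' Dc]]]]] := tc.
have [oU' [cpp' inj'] op' sD' [Ci' imm']] := cp'.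
have di' : differentiable (i \o p') u' by have [+ _] := Ci' 1%N; apply.
have [_ D1] := derive_fst w' di'.
have pim : (p @` U) (p' u') by rewrite pu'; exists u.
have dfst x : U x -> differentiable ((fst \o i) \o p) x.
  by move=> /dip dx; have [] := derive_fst w dx.
(* the chart p' that represents c is expressed in the given chart p *)
have := derive_lift oU' (fun e => cpp' e) (fun k => Ck_coordinates oU' (Ci' k))
  (chart_coordinates cp) w' dfst Uu' pim.
rewrite pu' liftK => //; last by case: cpp.
set z := 'D_w' (lift U p \o p') u' => E1; exists z.
rewrite -derive_jac; last exact: d1.
by rewrite v1 -Dc -D1 -E1.
Qed.

Lemma chart_fst D (i : T -> ambient R) U p :
  transverse D i -> (forall x, D x -> Qbundle (i x)) -> chart D i U p ->
  chart D (fst \o i) U p.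
Proof.
move=> tr QD cp; have imm' := transverse_projection_immersion tr QD cp.
have [oU cpp op sD [Ci imm]] := cp; split => //; split => // k.
exact: Ck_fst (Ci k).
Qed.

End Transversality.

(** * Orientations and Gauss maps *)

Section GaussMap.
Context {R : realType} {T : topologicalType}.
Implicit Types (D : set T) (f : T -> 'rV[R]_3) (U : set 'rV[R]_2) (p : 'rV[R]_2 -> T).
Implicit Types (o : T -> set ('rV[R]_3 * 'rV[R]_3)) (n : 'rV[R]_3).

Definition frames n : set ('rV[R]_3 * 'rV[R]_3) :=
  [set b | [/\ dot n b.1 = 0, dot n b.2 = 0 & 0 < det3 b.1 b.2 n]].

Lemma sum2 (V : nmodType) (F : 'I_2 -> V) : \sum_i F i = F 0 + F 1.
Proof.
by rewrite !big_ord_recl big_ord0 addr0; congr (F _ + F _); apply: val_inj.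
Qed.

Definition partial f p (u : 'rV[R]_2) (i : 'I_2) : 'rV[R]_3 :=
  'D_(delta_mx 0 i) (f \o p) u.

Lemma chart_differentiable (V : normedModType R) D (f : T -> V) U p u :
  chart D f U p -> U u -> differentiable (f \o p) u.
Proof. by move=> [_ _ _ _ [Cf _]]; have [+ _] := Cf 1%N; apply. Qed.

Lemma chart_independent D f U p u : chart D f U p -> U u ->
  independent (partial f p u 0) (partial f p u 1).
Proof.
move=> cp Uu x y E; have [_ _ _ _ [_ imm]] := cp.
pose w : 'rV[R]_2 := \row_i (if i == 0 then x else y).
have w0 : w 0 0 = x by rewrite mxE.
have w1 : w 0 1 = y by rewrite mxE.
have : w = 0.
  apply: (imm u w Uu); rewrite derive_sum; last exact: chart_differentiable cp Uu.
  by rewrite sum2 w0 w1.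
by move=> wz; rewrite -w0 -w1 wz !mxE.
Qed.

Lemma det_mx2 (A : 'M[R]_2) : \det A = A 0 0 * A 1 1 - A 0 1 * A 1 0.
Proof.
rewrite (expand_det_row _ 0) sum2 /cofactor !det_mx11 !mxE /=.
have E1 : fintype.lift (0 : 'I_2) (0 : 'I_1) = 1 by exact: val_inj.
have E2 : fintype.lift (1 : 'I_2) (0 : 'I_1) = 0 by exact: val_inj.
by rewrite !E1 !E2; ring.
Qed.

(** In the plane orthogonal to n, the sign of det3 b1 b2 n is that of the
    determinant of the change of frames. *)
Lemma frames_combinations (n a b b1 b2 : 'rV[R]_3) : dot n n = 1 ->
  dot n a = 0 -> dot n b = 0 -> 0 < det3 a b n ->
  (exists A : 'M[R]_2, [/\ 0 < \det A, b1 = A 0 0 *: a + A 0 1 *: b &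
     b2 = A 1 0 *: a + A 1 1 *: b]) <-> frames n (b1, b2).
Proof.
move=> nn na nb d0; split.
  move=> [A [dA -> ->]]; rewrite /frames /= !dotDr !dotZr na nb !mulr0 addr0.
  by split => //; rewrite det3_comb mulr_gt0// -det_mx2.
move=> [/= nb1 nb2 db]; have dn0 := gt_eqF d0.
have E1 := normal_span nn na nb (negbT dn0) nb1.
have E2 := normal_span nn na nb (negbT dn0) nb2.
move: E1 E2; set x := _ / _; set y := _ / _; set z := _ / _; set t := _ / _ => E1 E2.
pose A : 'M[R]_2 := \matrix_(i, j) if i == 0 then (if j == 0 then x else y)
   else (if j == 0 then z else t).
have A00 : A 0 0 = x by rewrite mxE.
have A01 : A 0 1 = y by rewrite mxE.
have A10 : A 1 0 = z by rewrite mxE.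
have A11 : A 1 1 = t by rewrite mxE.
exists A; rewrite det_mx2 A00 A01 A10 A11; split => //.
by move: db; rewrite E1 E2 det3_comb pmulr_lgt0.
Qed.

Lemma positive_framesE f p u n : dot n n = 1 ->
  dot n (partial f p u 0) = 0 -> dot n (partial f p u 1) = 0 ->
  0 < det3 (partial f p u 0) (partial f p u 1) n ->
  positive_frames f p u = frames n.
Proof.
move=> nn n0 n1 d0; apply/seteqP; split => -[b1 b2].
  move=> [A [dA E1 E2]]; apply/(frames_combinations _ _ nn n0 n1 d0).
  by exists A; split => //; [rewrite -[LHS]/((b1, b2).1) E1 sum2|rewrite -[LHS]/((b1, b2).2) E2 sum2].
move=> /(frames_combinations _ _ nn n0 n1 d0)[A [dA E1 E2]].
by exists A; split => //; rewrite sum2.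
Qed.

(** The condition that defines the Gauss map determines it already on one
    positive frame, by unit_normal_unique. *)
Lemma gauss_map_frames o x n a b : dot n n = 1 -> independent a b ->
  frames n (a, b) -> o x = frames n -> gauss_map o x = n.
Proof.
move=> nn ind [/= na nb d0] ox; rewrite /gauss_map ox.
have nS : [set n0 | dot n0 n0 = 1 /\ forall b0, frames n b0 ->
    [/\ dot n0 b0.1 = 0, dot n0 b0.2 = 0 & 0 < det3 b0.1 b0.2 n0]] n.
  by split.
have [m1 m2] := xgetPex 0 (ex_intro _ n nS).
set m := xget _ _ in m1 m2 *.
have [/= ma mb md] : [/\ dot m a = 0, dot m b = 0 & 0 < det3 a b m].
  by apply: (m2 (a, b)).
by rewrite (unit_normal_unique m1 ma mb md) (unit_normal_unique nn na nb d0).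
Qed.

Lemma orientation_chart D f o x : orientation D f o -> D x ->
  exists U p, [/\ chart D f U p, (p @` U) x &
    forall u, U u -> let n := unit_normal (partial f p u 0) (partial f p u 1) in
      o (p u) = frames n /\ gauss_map o (p u) = n].
Proof.
move=> oo Dx; have [U [p [cp px oE]]] := oo x Dx.
exists U, p; split => // u Uu n.
have ind := chart_independent cp Uu.
have [nn n0 n1 d0] := unit_normalP ind.
have E : o (p u) = frames n by rewrite oE// (positive_framesE nn n0 n1 d0).
split; first exact: E.
exact: (@gauss_map_frames o (p u) n _ _ nn ind (And3 n0 n1 d0) E).
Qed.

Lemma Ck_partial D f U p (i : 'I_2) k : chart D f U p -> Ck k U (partial f p ^~ i).
Proof.
move=> [oU _ _ _ [Cf _]]; have [_ H] := Cf k.+1; exact: H.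
Qed.

Lemma Ck_dot (E : normedModType R) k (W : set E) (a b : E -> 'rV[R]_3) : open W ->
  Ck k W a -> Ck k W b -> Ck k W (fun x => dot (a x) (b x)).
Proof.
move=> oW Ca Cb; apply: Ck_coord => //; apply: Ck_mulmx => //; exact: Ck_trmx.
Qed.

Lemma Ck_cross (E : normedModType R) k (W : set E) (a b : E -> 'rV[R]_3) : open W ->
  Ck k W a -> Ck k W b -> Ck k W (fun x => cross (a x) (b x)).
Proof.
move=> oW Ca Cb; apply: Ck_matrix => // i j.
apply: (Ck_ext oW (f := fun x => a x 0 (j + 1) * b x 0 (j + 2)
    + (-1) * (a x 0 (j + 2) * b x 0 (j + 1)))) => [y _|].
  by rewrite mxE mulN1r.
by apply: CkD => //; repeat (apply: CkM => //); (exact: Ck_coord || exact: Ck_cst).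
Qed.

Lemma Ck_det3 (E : normedModType R) k (W : set E) (a b c : E -> 'rV[R]_3) : open W ->
  Ck k W a -> Ck k W b -> Ck k W c -> Ck k W (fun x => det3 (a x) (b x) (c x)).
Proof.
move=> oW Ca Cb Cc; apply: (Ck_ext oW (f := fun x => dot (cross (a x) (b x)) (c x))).
  by move=> x _; rewrite det3_cross.
by apply: Ck_dot => //; exact: Ck_cross.
Qed.

Lemma Ck_unit_normal (E : normedModType R) k (W : set E) (a b : E -> 'rV[R]_3) : open W ->
  (forall x, W x -> independent (a x) (b x)) ->
  Ck k W a -> Ck k W b -> Ck k W (fun x => unit_normal (a x) (b x)).
Proof.
move=> oW ind Ca Cb.
have Cc := Ck_cross oW Ca Cb.
have cp x : W x -> 0 < dot (cross (a x) (b x)) (cross (a x) (b x)).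
  by move=> /ind/independent_cross.
apply: CkZ => //; apply: CkV => //; last by apply: Ck_sqrt => //; exact: Ck_dot.
by move=> x /cp c0; rewrite gt_eqF// sqrtr_gt0.
Qed.

End GaussMap.

(** * The differential of the Gauss map *)

Section GaussDifferential.
Context {R : realType} {T : topologicalType}.
Implicit Types (D : set T) (f : T -> 'rV[R]_3) (U : set 'rV[R]_2) (p : 'rV[R]_2 -> T).
Implicit Types (o : T -> set ('rV[R]_3 * 'rV[R]_3)).

(** The condition that defines the second component of [gauss_diff]. *)
Definition shape_operator D f o (x : T) (A : 'M[R]_3) : Prop :=
  gauss_map o x *m A = 0 /\
  forall U p u w, chart D f U p -> U u -> p u = x ->
    'D_w (f \o p) u *m A = 'D_w (gauss_map o \o p) u.

Lemma mx_eq_on_frame (n a b : 'rV[R]_3) (A B : 'M[R]_3) : dot n n = 1 ->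
  dot n a = 0 -> dot n b = 0 -> det3 a b n != 0 ->
  n *m A = n *m B -> a *m A = a *m B -> b *m A = b *m B -> A = B.
Proof.
move=> nn na nb d0 nA aA bA.
have H (v : 'rV[R]_3) : v *m A = v *m B.
  pose y := v - dot n v *: n.
  have nv : dot n y = 0 by rewrite /y dotDr -scaleNr dotZr nn mulr1 subrr.
  have -> : v = y + dot n v *: n by rewrite subrK.
  rewrite [LHS]mulmxDl [RHS]mulmxDl; congr (_ + _); last by rewrite -!scalemxAl nA.
  rewrite (normal_span nn na nb d0 nv) !mulmxDl -!scalemxAl.
  by rewrite aA bA.
by apply/row_matrixP => k; rewrite !rowE H.
Qed.

Lemma shape_operator_unique D f o x A B : orientation D f o -> D x ->
  shape_operator D f o x A -> shape_operator D f o x B -> A = B.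
Proof.
move=> oo Dx [nA HA] [nB HB].
have [U [p [cp [u Uu pu] ox]]] := orientation_chart oo Dx.
have := ox u Uu; rewrite pu => -[_ gE].
have [nn n0 n1 d0] := unit_normalP (chart_independent cp Uu).
rewrite -gE in nn n0 n1 d0.
apply: (mx_eq_on_frame nn n0 n1); first by rewrite gt_eqF.
- by rewrite nA nB.
- by rewrite /partial (HA _ _ _ _ cp Uu pu) (HB _ _ _ _ cp Uu pu).
- by rewrite /partial (HA _ _ _ _ cp Uu pu) (HB _ _ _ _ cp Uu pu).
Qed.

Lemma gauss_diffE D f o x A : orientation D f o -> D x ->
  shape_operator D f o x A -> gauss_diff D f o x = (gauss_map o x, A).
Proof.
move=> oo Dx SA; rewrite /gauss_diff; congr pair.
have H := xgetPex 0 (ex_intro _ A SA : exists A, [set A | shape_operator D f o x A] A).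
exact: shape_operator_unique oo Dx H SA.
Qed.

(** If no matrix is a shape operator, [gauss_diff] has the default value 0;
    a nonzero value is therefore a genuine shape operator. *)
Lemma gauss_diff_shape D f o x : (gauss_diff D f o x).2 != 0 ->
  shape_operator D f o x (gauss_diff D f o x).2.
Proof.
rewrite /gauss_diff /=; set S := [set A | _] => A0.
have [[A SA]|nS] := pselect (exists A, S A).
  exact: (xgetPex 0 (ex_intro _ A SA)).
by case/eqP: A0; apply: xgetPN => A SA; apply: nS; exists A.
Qed.

End GaussDifferential.

(** * Homeomorphisms and reflections of charts *)

Section Transport.
Context {R : realType} {T T' : topologicalType} {V : normedModType R}.

Lemma chart_homeo (D : set T) (f : T -> V) (D' : set T') (f' : T' -> V)
    (Phi : T -> T') (Psi : T' -> T) U p :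
  open D' ->
  (forall x, D x -> [/\ {for x, continuous Phi}, D' (Phi x) & Psi (Phi x) = x]) ->
  (forall y, D' y -> [/\ {for y, continuous Psi}, D (Psi y) & Phi (Psi y) = y]) ->
  (forall x, D x -> f' (Phi x) = f x) ->
  chart D f U p -> chart D' f' U (Phi \o p).
Proof.
move=> oD' HPhi HPsi ff' [oU [cp inj] op sD [Cf imm]].
have Dp u : U u -> D (p u) by move=> Uu; apply: sD; exists u.
split => //.
- split=> [u Uu|u v]; first by apply: continuous_comp; [exact: cp|have [] := HPhi _ (Dp _ Uu)].
  rewrite !inE => Uu Uv /= /(congr1 Psi).
  have [_ _ ->] := HPhi _ (Dp _ Uu); have [_ _ ->] := HPhi _ (Dp _ Uv).
  by apply: inj; rewrite inE.
- move=> W oW sW; have oWp := op W oW sW.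
  rewrite openE => _ [u Wu <-] /=.
  have [_ D'p pp] := HPhi _ (Dp _ (sW _ Wu)).
  have [cPsi _ _] := HPsi _ D'p.
  have N1 : nbhs (Psi (Phi (p u))) (p @` W).
    by rewrite pp; apply: open_nbhs_nbhs; split => //; exists u.
  have N2 : nbhs (Phi (p u)) (Psi @^-1` (p @` W)) := cPsi _ N1.
  apply: filterS2 N2 (open_nbhs_nbhs (conj oD' D'p)) => y [v Wv pv] D'y.
  by exists v => //=; rewrite pv; have [] := HPsi y D'y.
- by move=> _ [u Uu <-]; have [] := HPhi _ (Dp _ Uu).
- have E u : U u -> (f \o p) u = (f' \o (Phi \o p)) u by move=> Uu; rewrite /= ff'//; exact: Dp.
  split=> [k|u w Uu]; first exact: Ck_ext oU E (Cf k).
  by rewrite -(derive_ext w oU E Uu); exact: imm.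
Qed.

End Transport.

Section Reflection.
Context {R : realType} {T : topologicalType} {V : normedModType R}.

(** The reflection (x, y) |-> (- x, y) of the parameter plane, which
    reverses the orientation of a chart. *)
Definition flip : 'M[R]_2 := 1%:M - 2 *: delta_mx 0 0.

Lemma flipK : flip *m flip = 1%:M.
Proof.
rewrite /flip mulmxBl mul1mx mulmxBr mulmx1 -scalemxAl -scalemxAr mul_delta_mx scalerA.
have -> : 2 * 2 = 2 + 2 :> R by rewrite -natrM -natrD.
by rewrite [(2 + 2) *: _]scalerDl opprB addrK subrK.
Qed.

Lemma flip0 : (delta_mx 0 0 : 'rV[R]_2) *m flip = - delta_mx 0 0.
Proof.
rewrite /flip mulmxBr mulmx1 -scalemxAr mul_delta_mx scaler_nat mulr2n.
by rewrite opprD addrA subrr sub0r.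
Qed.

Lemma flip1 : (delta_mx 0 1 : 'rV[R]_2) *m flip = delta_mx 0 1.
Proof. by rewrite /flip mulmxBr mulmx1 -scalemxAr mul_delta_mx_0// scaler0 subr0. Qed.

Lemma flip_continuous : continuous (mulmxr flip : 'rV[R]_2 -> 'rV[R]_2).
Proof. exact: (@rV_linear_continuous _ _ _ (mulmxr flip : {linear 'rV[R]_2 -> 'rV[R]_2})). Qed.

Lemma derive_flip (F : 'rV[R]_2 -> V) u w : differentiable F (u *m flip) ->
  'D_w (F \o mulmxr flip) u = 'D_(w *m flip) F (u *m flip).
Proof.
move=> dF.
pose L := (mulmxr flip : {linear 'rV[R]_2 -> 'rV[R]_2}).
have dL : differentiable L u by apply: linear_differentiable; exact: flip_continuous.
rewrite deriveE; last exact: (differentiable_comp dL dF).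
rewrite (diff_comp dL dF) /= diff_lin; last exact: flip_continuous.
by rewrite deriveE.
Qed.

Lemma chart_flip (D : set T) (f : T -> V) U p : chart D f U p ->
  chart D f (mulmxr flip @^-1` U) (p \o mulmxr flip).
Proof.
move=> cp; have [oU [cpp inj] op sD [Cf imm]] := cp.
have LK (u : 'rV[R]_2) : u *m flip *m flip = u by rewrite -mulmxA flipK mulmx1.
have oU' : open (mulmxr flip @^-1` U).
  by apply: open_comp => // u _; exact: flip_continuous.
split => //.
- split=> [u Uu|u v]; first by apply: continuous_comp; [exact: flip_continuous|exact: cpp].
  rewrite !inE => Uu Uv /= E; rewrite -[u]LK -[v]LK; congr (_ *m _).
  by apply: inj; rewrite ?inE.
- move=> W oW sW.
  have -> : (p \o mulmxr flip) @` W = p @` (mulmxr flip @^-1` W).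
    apply/seteqP; split => [_ [u Wu <-]|_ [u /= Wu <-]].
      by exists (u *m flip) => //=; rewrite LK.
    by exists (u *m flip) => //=; rewrite LK.
  apply: op; first by apply: open_comp => // u _; exact: flip_continuous.
  by move=> u /= /sW /=; rewrite LK.
- by move=> _ [u Uu <-]; apply: sD; exists (u *m flip).
- split=> [k|u w Uu].
    apply: (Ck_comp (f := f \o p) (t := mulmxr flip) oU' _ (Cf k)); first by [].
    apply: Ck_mulmx => //; [exact: Ck_id|exact: Ck_cst].
  rewrite (derive_flip (F := f \o p)); last exact: chart_differentiable cp Uu.
  move=> /(imm _ _ Uu) /(congr1 (fun z => z *m flip)).
  by rewrite LK mul0mx.
Qed.

End Reflection.

Lemma partial_flip (R : realType) (T : topologicalType) (f : T -> 'rV[R]_3) p u :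
  differentiable (f \o p) u ->
  partial f (p \o mulmxr flip) (u *m flip) 0 = - partial f p u 0 /\
  partial f (p \o mulmxr flip) (u *m flip) 1 = partial f p u 1.
Proof.
move=> df; have LK : u *m flip *m flip = u by rewrite -mulmxA flipK mulmx1.
have d : differentiable (f \o p) (u *m flip *m flip) by rewrite LK.
have H w := derive_flip (F := f \o p) w d.
split; rewrite /partial [LHS]H LK; last by rewrite flip1.
by rewrite flip0 deriveE// linearN -deriveE.
Qed.

(** * Primitives of omega are minimal immersions *)

Section Parametrization.
Context {R : realType} {T T' : topologicalType}.
Variables (D : set T) (i : T -> ambient R) (D' : set T') (j : T' -> 'rV[R]_3).
(** The surface in space is D', parametrized by a homeomorphism Phi with
    inverse Psi: the identity for an immersed surface, the primitive itself
    when D' is its image. *)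
Variables (Phi : T -> T') (Psi : T' -> T).

Local Notation X x := (invmx (plus_id (i x).1 (i x).2)).

(** The equation d phi = omega, where omega depends on ds only and ds is the
    differential of fst o i. *)
Definition omega_primitive (phi : T -> 'rV[R]_3) : Prop :=
  forall x, D x -> exists U p, [/\ chart D i U p, (p @` U) x, smooth_on U (phi \o p) &
    forall u w, U u -> 'D_w (phi \o p) u = 'D_w (fst \o i \o p) u *m X (p u)].

Hypothesis sD : surface D i.
Hypothesis QD : forall x, D x -> Qnz (i x).
Hypothesis tD : transverse D i.

Let QB x (Dx : D x) : Qbundle (i x) := (QD Dx).1.

Section Primitive.
Variable phi : T -> 'rV[R]_3.
Hypothesis prim : omega_primitive phi.

Lemma chart_continuous (V : normedModType R) (f : T -> V) U p : chart D f U p ->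
  forall u, U u -> {for u, continuous p}.
Proof. by move=> [_ [+ _] _ _ _]. Qed.

Lemma chart_dom (V : normedModType R) (f : T -> V) U p : chart D f U p ->
  forall u, U u -> D (p u).
Proof. by move=> [_ _ _ + _] u Uu; apply; exists u. Qed.

Lemma X_unit x : D x -> X x \in unitmx.
Proof.
move=> Dx; rewrite unitmx_inv; have := QD Dx; case: (i x) => s q /=.
exact: plus_id_unit.
Qed.

(** As the projection fst o i is an immersion, the equation d phi = omega
    passes from one chart around each point to every map h for which fst o i
    o h is smooth. *)
Lemma primitive_along (E : normedModType R) (h : E -> T) (W : set E) : open W ->
  (forall e, W e -> {for e, continuous h}) -> (forall e, W e -> D (h e)) ->
  smooth_on W (fst \o i \o h) ->
  smooth_on W (phi \o h) /\ forall e v, W e ->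
    'D_v (phi \o h) e = 'D_v (fst \o i \o h) e *m X (h e).
Proof.
move=> oW ch Dh Ch; split.
  apply: (smooth_along (D := D) oW ch Ch) => e We.
  have [U [p [cp pe Cp _]]] := prim (Dh _ We).
  by exists U, p; split => //; exact: (chart_fst tD QB cp).
move=> e v We; have [U [p [cp pe Cp Dp]]] := prim (Dh _ We).
apply: (derive_along v oW ch Ch (chart_fst tD QB cp) Cp _ We pe) => u w Uu pu.
by rewrite -pu; exact: Dp.
Qed.

(** The differential of phi is that of the immersion fst o i followed by an
    invertible matrix. *)
Lemma primitive_chart U p : chart D i U p -> chart D phi U p.
Proof.
move=> cp; have cp' := chart_fst tD QB cp.
have [oU cpp op sDp [Cs imm]] := cp'.
have [Cphi Dphi] := primitive_along oU (chart_continuous cp) (chart_dom cp) Cs.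
split => //; split => // u w Uu; rewrite Dphi// => /(congr1 (mulmx^~ (invmx (X (p u))))).
rewrite mulmxK; last exact/X_unit/(chart_dom cp).
by rewrite mul0mx; exact: imm.
Qed.

Lemma smooth_along_primitive (E : normedModType R) (h : E -> T) (W : set E) : open W ->
  (forall e, W e -> {for e, continuous h}) -> (forall e, W e -> D (h e)) ->
  smooth_on W (phi \o h) -> smooth_on W (i \o h).
Proof.
move=> oW ch Dh Ch; apply: (smooth_along (D := D) oW ch Ch) => e We.
have [U [p [cp pe]]] := sD.2 _ (Dh _ We).
by exists U, p; split => //; [exact: primitive_chart|have [_ _ _ _ []] := cp].
Qed.

(** The vector ds is orthogonal to s, and omega applies the inverse of q to
    it within the plane orthogonal to s. Hence s is normal to the surface
    phi, and the differential of phi composed with q is that of s. *)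
Lemma primitive_derive U p : chart D phi U p -> forall u w, U u ->
  dot ('D_w (phi \o p) u) (i (p u)).1 = 0 /\
  'D_w (phi \o p) u *m (i (p u)).2 = 'D_w (fst \o i \o p) u.
Proof.
move=> cp u w Uu; have [oU cpp op sDp [Cphi imm]] := cp.
have Ci := smooth_along_primitive oU (chart_continuous cp) (chart_dom cp) Cphi.
have Cs k : Ck k U (fst \o i \o p) := Ck_fst oU (Ci k).
have [_ ->//] := primitive_along oU (chart_continuous cp) (chart_dom cp) Cs.
have di : differentiable (i \o p) u by have [+ _] := Ci 1%N; apply.
have QU v : U v -> Qbundle ((i \o p) v) by move=> Uv; exact/QB/(chart_dom cp).
have [+ _ _ _] := tangent_Qbundle w oU Uu di QU.
have [_ <-] := derive_fst w di.
have := QD (chart_dom cp Uu); rewrite /=; case: (i (p u)) => s q /= Qn ds.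
exact: omega_inverse.
Qed.

End Primitive.

Hypothesis hT' : hausdorff_space T'.
Hypothesis oD' : open D'.
Hypothesis HPhi : forall x, D x -> [/\ {for x, continuous Phi}, D' (Phi x) & Psi (Phi x) = x].
Hypothesis HPsi : forall y, D' y -> [/\ {for y, continuous Psi}, D (Psi y) & Phi (Psi y) = y].
Hypothesis prim : omega_primitive (j \o Phi).

Let phi := j \o Phi.

Lemma surface_open (V : normedModType R) (f : T -> V) : surface D f -> open D.
Proof.
move=> [_ cD]; rewrite openE => x /cD[U [p [cp px]]].
have [_ _ _ s _] := cp.
by apply: filterS s _; exact: open_nbhs_nbhs (conj (chart_open cp) px).
Qed.

Lemma push_chart U p : chart D phi U p -> chart D' j U (Phi \o p).
Proof. by apply: (chart_homeo oD' HPhi HPsi). Qed.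

Lemma pull_chart U p : chart D' j U p -> chart D phi U (Psi \o p).
Proof.
apply: chart_homeo HPsi HPhi _; first exact: surface_open sD.
by move=> y /HPsi[_ _]; rewrite /phi /= => ->.
Qed.

Lemma pushed_surface : surface D' j.
Proof.
split => // y D'y; have [_ Dy E] := HPsi D'y; have [U [p [cp [u Uu pu]]]] := sD.2 _ Dy.
exists U, (Phi \o p); split; first exact/push_chart/primitive_chart.
by exists u => //=; rewrite pu.
Qed.

Lemma pushed_diffeo : diffeo D i D' j Phi.
Proof.
split.
- split=> [x /HPhi[]//|x x'|y D'y].
    rewrite !inE => Dx Dx' /(congr1 Psi).
    by have [_ _ ->] := HPhi Dx; have [_ _ ->] := HPhi Dx'.
  by have [_ Dy E] := HPsi D'y; exists (Psi y).
- split=> [x /HPhi[]//|U p cp].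
  by have [_ _ _ _ []] := primitive_chart prim cp.
- exists Psi; split => [x /HPhi[]//|y /HPsi[]//|].
  split=> [y /HPsi[]//|U p cp].
  have cp' := pull_chart cp; have [oU _ _ _ [Cphi _]] := cp'.
  exact: (smooth_along_primitive prim oU (chart_continuous cp') (chart_dom cp') Cphi).
Qed.

Lemma normal_det3 (s a b : 'rV[R]_3) : dot s s = 1 -> independent a b ->
  dot s a = 0 -> dot s b = 0 -> det3 a b s != 0.
Proof.
move=> ss ind sa sb; apply/eqP => d0.
have [nn na nb dn] := unit_normalP ind; set n := unit_normal a b in nn na nb dn.
have sn : dot n s = 0.
  by rewrite /n /unit_normal dotZl -(det3_cross a b s) d0 mulr0.
have E := normal_span nn na nb (negbT (gt_eqF dn)) sn.
move: ss; rewrite {2}E dotDr !dotZr sa sb !mulr0 addr0 => /eqP.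
by rewrite eq_sym oner_eq0.
Qed.

Definition induced_orientation (y : T') := frames (i (Psi y)).1.

Lemma primitive_normal U p u : chart D phi U p -> U u ->
  [/\ dot (i (p u)).1 (i (p u)).1 = 1, dot (i (p u)).1 (partial phi p u 0) = 0,
      dot (i (p u)).1 (partial phi p u 1) = 0 &
      det3 (partial phi p u 0) (partial phi p u 1) (i (p u)).1 != 0].
Proof.
move=> cp Uu; have [ss _ _ _] := QB (chart_dom cp Uu).
have H w := (primitive_derive prim cp w Uu).1.
have s0 : dot (i (p u)).1 (partial phi p u 0) = 0 by rewrite dotC H.
have s1 : dot (i (p u)).1 (partial phi p u 1) = 0 by rewrite dotC H.
by split => //; exact: normal_det3 (chart_independent cp Uu) s0 s1.
Qed.

(** The determinant does not vanish by normal_det3 and keeps its sign around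
    a point; a reflection of the chart changes that sign. *)
Lemma positive_chart x : D x -> exists U p, [/\ chart D phi U p, (p @` U) x &
  forall u, U u -> 0 < det3 (partial phi p u 0) (partial phi p u 1) (i (p u)).1].
Proof.
move=> Dx; have [U [p [cpi [u Uu pu]]]] := sD.2 _ Dx.
have cp := primitive_chart prim cpi.
wlog d0 : U p u cpi cp Uu pu / 0 < det3 (partial phi p u 0) (partial phi p u 1) (i (p u)).1.
  have [_ _ _ dn0] := primitive_normal cp Uu.
  move=> H; have := dn0; rewrite neq_lt => /orP[dneg|dpos]; last exact: (H U p u).
  have LK : u *m flip *m flip = u by rewrite -mulmxA flipK mulmx1.
  have cpf := chart_flip cp.
  apply: (H _ _ (u *m flip) (chart_flip cpi) cpf) => /=; rewrite ?LK//.
  have [-> ->] := partial_flip (chart_differentiable cp Uu).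
  by rewrite det3Nl oppr_gt0.
have [oU cpp op sDp [Cphi imm]] := cp.
pose W := U `&` [set u | 0 < det3 (partial phi p u 0) (partial phi p u 1) (i (p u)).1].
have Ci := smooth_along_primitive prim oU (chart_continuous cp) (chart_dom cp) Cphi.
have oW : open W.
  rewrite openE => v [Uv dv]; apply: filterI; first exact: (open_near oU Uv).
  have C : Ck 0 U (fun u => det3 (partial phi p u 0) (partial phi p u 1) (i (p u)).1).
    exact: (Ck_det3 oU (Ck_partial 0 0 cp) (Ck_partial 1 0 cp) (Ck_fst oU (Ci 0%N))).
  exact: (cvgr_gt _ (C v Uv) _ dv).
exists W, p; split => //.
- by apply: chart_sub cp => // v [].
- by exists u => //; split.
- by move=> v [].
Qed.

Lemma induced_orientationP : orientation D' j induced_orientation.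
Proof.
move=> y D'y; have [_ Dy E] := HPsi D'y.
have [U [p [cp [u Uu pu] Hp]]] := positive_chart Dy.
exists U, (Phi \o p); split; first exact: push_chart.
  by exists u => //=; rewrite pu.
move=> v Uv; have [ss s0 s1 _] := primitive_normal cp Uv.
rewrite /induced_orientation /=; have [_ _ ->] := HPhi (chart_dom cp Uv).
exact/esym/(positive_framesE ss s0 s1 (Hp v Uv)).
Qed.

Lemma gauss_map_induced x : D x -> gauss_map induced_orientation (Phi x) = (i x).1.
Proof.
move=> Dx; have [U [p [cp [u Uu pu] Hp]]] := positive_chart Dx.
have [ss s0 s1 _] := primitive_normal cp Uu.
have HH := gauss_map_frames ss (chart_independent cp Uu) (And3 s0 s1 (Hp u Uu)).
rewrite pu in HH; apply: HH.
by rewrite /induced_orientation; have [_ _ ->] := HPhi Dx.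
Qed.

Lemma gauss_diff_induced x : D x -> gauss_diff D' j induced_orientation (Phi x) = i x.
Proof.
move=> Dx; have [_ D'x PK] := HPhi Dx.
rewrite (gauss_diffE (A := (i x).2) induced_orientationP D'x).
  by rewrite gauss_map_induced// -surjective_pairing.
split; first by rewrite gauss_map_induced//; have [] := QB Dx.
move=> U p u w cp Uu pu; have cp' := pull_chart cp.
have [oU _ _ sU _] := cp.
have PhiK v (Uv : U v) : Phi (Psi (p v)) = p v by have [] := HPsi (sU _ (imageP p Uv)).
have E v : U v -> (j \o p) v = (phi \o (Psi \o p)) v.
  by move=> Uv; rewrite /phi /= PhiK.
have E' v : U v -> (gauss_map induced_orientation \o p) v = (fst \o i \o (Psi \o p)) v.
  move=> Uv /=; rewrite -gauss_map_induced; last exact: (chart_dom cp' Uv).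
  by rewrite PhiK.
rewrite (derive_ext w oU E Uu) (derive_ext w oU E' Uu).
have [_] := primitive_derive prim cp' w Uu.
by rewrite /= pu PK.
Qed.

(** By primitive_derive the normal is s and the shape operator is q;
    symmetry, vanishing trace and invertibility of q then say that the
    surface is minimal of nonzero curvature. *)
Lemma primitive_parametrizes : parametrizes_minimal D i D' j Phi.
Proof.
split; [exact: pushed_surface|exact: pushed_diffeo|].
have onto y : D' y -> exists2 x, D x & y = Phi x.
  by move=> /HPsi[_ Dy E]; exists (Psi y).
exists induced_orientation; split.
- by split; [exact: induced_orientationP|exact: gauss_map_induced].
- move=> o' oo' go' y D'y.
  have [U [p [cp [u Uu pu] H]]] := orientation_chart oo' D'y.
  have [ho hg] := H u Uu; rewrite pu in ho hg.
  have [_ Dy E] := HPsi D'y.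
  by rewrite ho -hg /induced_orientation -(go' _ Dy) E.
- exact: gauss_diff_induced.
- split; [exact: pushed_surface|exact: induced_orientationP|].
  by move=> y /onto[x Dx ->]; rewrite gauss_diff_induced//; have [] := QB Dx.
- move=> y /onto[x Dx ->]; rewrite /gauss_curvature gauss_diff_induced//.
  have := QD Dx; case: (i x) => s q /= Qn.
  by have := plus_id_unit Qn; rewrite unitmxE unitfE.
Qed.

End Parametrization.

(** * Restriction to open subsets *)

Section Restriction.
Context {R : realType} {T : topologicalType} {V : normedModType R}.
Implicit Types (D W : set T) (f : T -> V).

Lemma chart_widen W D f U p : W `<=` D -> chart W f U p -> chart D f U p.
Proof. by move=> WD [oU cp op sW Cf]; split => // x /sW /WD. Qed.

Lemma chart_restrict W D f U p : open W -> chart D f U p ->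
  chart W f (U `&` p @^-1` W) p.
Proof.
move=> oW cp; have [oU [cpp inj] op sD [Cf imm]] := cp.
have oU' : open (U `&` p @^-1` W).
  rewrite openE => u [Uu Wu]; apply: filterI; first exact: (open_near oU Uu).
  exact: (cpp u Uu _ (open_near oW Wu)).
have [_ [c1 c2] c3 _ c4] := chart_sub oU' (@subIsetl _ _ _) cp.
by split => // _ [u [_ Wu] <-].
Qed.

Lemma surface_restrict W D f : open W -> W `<=` D -> surface D f -> surface W f.
Proof.
move=> oW WD [hT sD]; split => // x Wx; have [U [p [cp [u Uu pu]]]] := sD x (WD _ Wx).
exists (U `&` p @^-1` W), p; split; first exact: chart_restrict cp.
by exists u => //; split => //=; rewrite pu.
Qed.

Lemma tangent_restrict W D f x v : open W -> W x -> tangent D f x v -> tangent W f x v.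
Proof.
move=> oW Wx [U [p [u [w [cp Uu pu Dv]]]]].
exists (U `&` p @^-1` W), p, u, w; split => //; first exact: chart_restrict cp.
by split => //=; rewrite pu.
Qed.

End Restriction.

Lemma transverse_restrict (R : realType) (T : topologicalType) (W D : set T)
  (i : T -> ambient R) : open W -> W `<=` D -> transverse D i -> transverse W i.
Proof.
move=> oW WD tD x Wx v tv; have [c [k [tc tk E]]] := tD x (WD _ Wx) v tv.
by exists c, k; split => //; exact: tangent_restrict tc.
Qed.

Lemma primitive_restrict (R : realType) (T : topologicalType) (W D : set T)
  (i : T -> ambient R) phi : open W -> W `<=` D ->
  omega_primitive D i phi -> omega_primitive W i phi.
Proof.
move=> oW WD pD x Wx; have [U [p [cp [u Uu pu] Cp Dp]]] := pD x (WD _ Wx).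
exists (U `&` p @^-1` W), p; split; first exact: chart_restrict cp.
- by exists u => //; split => //=; rewrite pu.
- by move=> k; apply: Ck_sub (Cp k) => v [].
- by move=> v w [Uv _]; exact: Dp.
Qed.

(** * Existence of primitives of omega *)

Section LocalPrimitives.
Context {R : realType} {T : topologicalType}.
Variables (D : set T) (i : T -> ambient R).
Hypothesis sD : surface D i.
Hypothesis QD : forall x, D x -> Qnz (i x).
Hypothesis tD : transverse D i.

Lemma primitives_differ_by_constant P P' x : omega_primitive D i P ->
  omega_primitive D i P' -> D x -> \forall y \near x, P y - P' y = P x - P' x.
Proof.
move=> prP prP' Dx; have [U [p [cp [u Uu pu]]]] := sD.2 x Dx.
have [oU cpp op _ [Ci _]] := cp.
have Cs k : Ck k U (fst \o i \o p) := Ck_fst oU (Ci k).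
have [CP DP] := primitive_along QD tD prP oU (chart_continuous cp) (chart_dom cp) Cs.
have [CP' DP'] := primitive_along QD tD prP' oU (chart_continuous cp) (chart_dom cp) Cs.
have [r r0 rU] := open_normP oU Uu.
pose B := [set v | `|v - u| < r].
have oB : open B by exact: open_norm_ball.
have Bu : B u by rewrite /B /= subrr normr0.
have opB : open (p @` B) by apply: op => // v; exact: rU.
have pBx : (p @` B) x by exists u.
apply: filterS (open_near opB pBx) => _ [v Bv <-].
rewrite -pu.
apply: (@zero_derive_const R 1 3 _ (fun v => P (p v) - P' (p v)) u v u r); last exact: Bu; last exact: Bv.
move=> e /rU Ue.
have d1 : differentiable (P \o p) e by have [+ _] := CP 1%N; apply.
have d2 : differentiable (P' \o p) e by have [+ _] := CP' 1%N; apply.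
split=> [|w]; first exact: (differentiableB d1 d2).
have := @deriveB _ _ _ (P \o p) (P' \o p) e w (diff_derivable d1) (diff_derivable d2).
rewrite (_ : (P \o p) - (P' \o p) = fun v => P (p v) - P' (p v))// => ->.
by rewrite DP// DP'// subrr.
Qed.

Hypothesis cD : omega_closed D i.

Lemma Ck_X k (E : normedModType R) (h : E -> T) (W : set E) : open W ->
  (forall e, W e -> D (h e)) -> Ck k W (i \o h) ->
  Ck k W (fun e => invmx (plus_id (i (h e)).1 (i (h e)).2)).
Proof.
move=> oW Dh Ci; apply: Ck_invmx => //.
  by move=> e /Dh /QD; case: (i (h e)) => s q; exact: plus_id_unit.
apply: CkD => //; first exact: (Ck_snd oW Ci).
apply: Ck_mulmx => //; last exact: (Ck_fst oW Ci).
by apply: Ck_trmx => //; exact: (Ck_fst oW Ci).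
Qed.

Lemma fst_combination (a b : R) (d0 d1 : ambient R) (M : 'M[R]_3) :
  (a *: d0 + b *: d1).1 *m M = a *: (d0.1 *m M) + b *: (d1.1 *m M).
Proof. by rewrite !scalemxAl -mulmxDl. Qed.

(** The lemma of Poincare in a chart. The domain of the chart is a ball
    around u, hence star-shaped, which provides the paths that continuation
    needs. *)
Lemma local_primitive x : D x -> exists (U : set 'rV[R]_2) p u (P : T -> 'rV[R]_3),
  [/\ chart D i U p, U u, p u = x,
      (forall v (t : R), U v -> 0 <= t <= 1 -> U (u + t *: (v - u))) &
      omega_primitive (p @` U) i P].
Proof.
move=> Dx; have [U [p [cp [u Uu pu]]]] := sD.2 x Dx.
have [oU cpp op _ [Ci _]] := cp.
pose A (k : 'I_2) (v : 'rV[R]_2) := pullback omega (i \o p) v (delta_mx 0 k).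
have CA k l : Ck l U (A k).
  apply: Ck_mulmx => //.
    by apply: Ck_fst => //; have [_ H] := Ci l.+1; exact: H.
  exact: (Ck_X oU (chart_dom cp) (Ci l)).
have clA v (k l : 'I_2) : U v -> 'D_(delta_mx 0 k) (A l) v = 'D_(delta_mx 0 l) (A k) v.
  move=> Uv; apply/eqP; rewrite -subr_eq0; apply/eqP.
  exact: (cD cp (delta_mx 0 k) (delta_mx 0 l) Uv).
have [r [P [r0 rU HP]]] := closed_primitive oU Uu (fun k => CA k 1%N) clA.
pose B := [set v | `|v - u| < r].
have oB : open B by exact: open_norm_ball.
have Bu : B u by rewrite /B /= subrr normr0.
have cpB : chart D i B p := chart_sub oB rU cp.
have injB : set_inj B p by have [_ [_ +] _ _ _] := cpB.
have PE v : B v -> P v = (P \o lift B p \o p) v by move=> Bv; rewrite /= liftK.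
exists B, p, u, (P \o lift B p); split => //.
- by move=> v t Bv t01; apply: segment_ball.
- move=> _ [v Bv <-]; exists B, p; split.
  + by have [? [? ?] ? _ ?] := cpB; split.
  + by exists v.
  + move=> k; apply: (Ck_ext oB PE); case: k => [|k].
      by move=> e Be; apply: differentiable_continuous; have [] := HP e Be.
    split=> [e Be|w]; first by have [] := HP e Be.
    apply: (Ck_ext oB (f := fun e => \sum_k w 0 k *: A k e)).
      by move=> e Be; have [_ ->] := HP e Be.
    apply: Ck_sum => // l _; apply: CkZ => //; first exact: Ck_cst.
    exact: Ck_sub rU (CA l k).
  + move=> e w Be; rewrite -(derive_ext w oB PE Be); have [_ ->] := HP e Be.
    have di : differentiable (i \o p) e by have [+ _] := Ci 1%N; apply; exact: rU.
    have [dfi Dfi] := derive_fst w di.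
    have -> : 'D_w (fst \o i \o p) e = ('D_w (i \o p) e).1 by rewrite -Dfi.
    rewrite derive_sum// !sum2; apply/esym; exact: fst_combination.
Qed.

End LocalPrimitives.

Section GlobalPrimitive.
Context {R : realType} {T : topologicalType}.
Variables (D : set T) (i : T -> ambient R).
Hypothesis sD : surface D i.
Hypothesis QD : forall x, D x -> Qnz (i x).
Hypothesis tD : transverse D i.
Hypothesis cD : omega_closed D i.
Hypothesis scD : simply_connected R D.

(** Continuation of the local primitives, from a, over the simply connected
    set D. *)
Lemma global_primitive a b : D a -> exists phi, phi a = b /\ omega_primitive D i phi.
Proof.
move=> Da; have oD := surface_open sD.
pose loc (W : set T) (P : T -> 'rV[R]_3) := [/\ open W, W `<=` D & omega_primitive W i P].
have loc_open W P : loc W P -> open W /\ W `<=` D by case.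
have loc_const W W' P P' x : loc W P -> loc W' P' -> W x -> W' x ->
    \forall y \near x, P y - P' y = P x - P' x.
  move=> [oW sW prP] [oW' sW' prP'] Wx Wx'.
  have oI := openI oW oW'.
  have sI : W `&` W' `<=` D by move=> y [/sW].
  have s1 : W `&` W' `<=` W by move=> y [].
  have s2 : W `&` W' `<=` W' by move=> y [].
  have pr1 := primitive_restrict oI s1 prP; have pr2 := primitive_restrict oI s2 prP'.
  exact: (primitives_differ_by_constant (surface_restrict oI sI sD)
    (fun y Iy => QD (sI y Iy)) (transverse_restrict oI sI tD) pr1 pr2 (conj Wx Wx')).
have loc_path x : D x -> exists W P, [/\ loc W P, W x &
    forall y, W y -> exists g : R -> T, [/\ {within `[0, 1], continuous g},
    (forall t : R, t \in `[0, 1] -> W (g t)), g 0 = x & g 1 = y]].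
  move=> Dx; have [U [p [u [P [cp Uu pu cU prP]]]]] := local_primitive sD QD cD Dx.
  exists (p @` U), P; split; [split => //|by exists u|].
  - exact: chart_open cp.
  - by have [] := cp.
  - move=> _ [v Uv <-]; exists (fun t => p (u + t *: (v - u))); split.
    + apply/continuous_in_subspaceT => t; rewrite inE /= in_itv /= => t01.
      apply: (@continuous_comp _ _ _ (fun t : R => u + t *: (v - u)) p).
        by apply: cvgD; [exact: cvg_cst|exact: scalel_continuous].
      by apply: (chart_continuous cp); exact: cU.
    + by move=> t; rewrite in_itv /= => t01; exists (u + t *: (v - u)) => //; exact: cU.
    + by rewrite scale0r addr0.
    + by rewrite scale1r [u + _]addrC subrK.
have loc_ex x : D x -> exists W P, loc W P /\ W x.
  by move=> /loc_path[W [P [lP Wx _]]]; exists W, P.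
have [phi [pa Hphi]] := global_continuation loc_open loc_const loc_ex scD loc_path b Da.
exists phi; split => // x Dx.
have [W [P [[oW sW prP] Wx E]]] := Hphi x Dx.
have [U [p [cp px CP DP]]] := prP x Wx.
have cpD := chart_widen sW cp; have [oU _ _ _ _] := cp.
pose k := phi x - P x.
have E' u : U u -> (P \o p) u + k = (phi \o p) u.
  move=> Uu /=; rewrite (E (p u)); last exact: (chart_dom cp).
  by rewrite /k addrCA addrA addrAC -addrA.
exists U, p; split => // [l|u w Uu].
  by apply: (Ck_ext oU E'); apply: CkD => //; exact: Ck_cst.
rewrite -DP// -(derive_ext w oU E' Uu).
exact: derive_add_cst.
Qed.

End GlobalPrimitive.

(** * Integrals of omega along curves *)

Section PathIntegral.
Context {R : realType} {T : topologicalType}.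
Variables (D : set T) (i : T -> ambient R).
Hypothesis QD : forall x, D x -> Qnz (i x).
Hypothesis tD : transverse D i.

(** By the equation d phi = omega the integrand is the derivative of phi o
    g. *)
Lemma path_integral_primitive phi g a b : omega_primitive D i phi ->
  smooth_curve D i g a b -> path_integral (i \o g) = phi b - phi a.
Proof.
move=> prphi [ga gb [J [oJ sJ HJ Cg]]].
have cg t : J t -> {for t, continuous g} by move=> /HJ[].
have Dg t : J t -> D (g t) by move=> /HJ[].
have Cs k : Ck k J (fst \o i \o g) := Ck_fst oJ (Cg k).
have [Cphi Dphi] := primitive_along QD tD prphi oJ cg Dg Cs.
have JI (t : R) : 0 <= t <= 1 -> J t by move=> t01; apply: sJ; rewrite /= in_itv.
apply/rowP => k; rewrite mxE.
have E (t : R) : J t -> omega ((i \o g) t) (derive1 (i \o g) t) 0 k = ('D_1 (phi \o g) t) 0 k.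
  move=> Jt; rewrite Dphi// derive1E /omega.
  have di : differentiable (i \o g) t by have [+ _] := Cg 1%N; apply.
  have [dfi Dfi] := derive_fst (1 : R) di.
  by have -> : 'D_1 (fst \o i \o g) t = ('D_1 (i \o g) t).1 by rewrite -Dfi.
transitivity (\int[@lebesgue_measure R]_(t in `[0, 1]) ('D_1 (phi \o g) t) 0 k).
  by apply: eq_Rintegral => t; rewrite inE /= in_itv /= => /JI; exact: E.
have dphi (t : R) : 0 <= t <= 1 -> differentiable (phi \o g) t.
  by move=> /JI; have [+ _] := Cphi 1%N; apply.
have H1 (t : R) : 0 <= t <= 1 ->
    is_derive t 1 (fun t : R => (phi \o g) t 0 k) (('D_1 (phi \o g) t) 0 k).
  move=> t01; apply: DeriveDef; last by rewrite derive_coord//; exact: dphi.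
  by apply: diff_derivable; exact: differentiable_coordf (dphi t t01).
rewrite (FTC_unit_interval H1); first by rewrite /= ga gb !mxE.
apply: continuous_in_subspaceT => t; rewrite inE /= in_itv /= => /JI Jt.
have C0 : Ck 0 J ('D_1 (phi \o g)) by have [_ H] := Cphi 1%N; exact: H.
exact: (Ck_continuous (Ck_coord 0 k oJ C0) Jt).
Qed.

End PathIntegral.

(** * Immersed surfaces are locally embedded *)

Section Embedding.
Context {R : realType} {T : topologicalType}.

Lemma chart_point_continuous (V : normedModType R) m (D : set T) (f : T -> 'rV[R]_m)
    (g : T -> V) U p x : chart D f U p -> (p @` U) x ->
  (forall u, U u -> {for u, continuous (g \o p)}) -> {for x, continuous g}.
Proof.
move=> cp px cgp N HN; have [Ul pl] := liftP px.
have [_ [_ inj] _ _ _] := cp.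
have c1 : {for x, continuous ((g \o p) \o lift U p)}.
  by apply: continuous_comp; [exact: lift_continuous cp px|exact: cgp].
have HN' : nbhs (((g \o p) \o lift U p) x) N by rewrite /= pl.
have C : nbhs x (((g \o p) \o lift U p) @^-1` N) := c1 _ HN'.
apply: filterS2 C (open_near (chart_open cp) px) => y Hy /liftP[_ py].
by move: Hy; rewrite /preimage /= py.
Qed.

(** On a ball where f o p is bilipschitz, f is injective with continuous
    inverse. *)
Lemma chart_embedding m (D : set T) (f : T -> 'rV[R]_m) U p u :
  chart D f U p -> U u -> exists r : R, [/\ 0 < r,
    forall v, `|v - u| < r -> U v &
    topological_embedding (p @` [set v | `|v - u| < r]) f].
Proof.
move=> cp Uu; have [oU [cpp inj] op sD [Cf imm]] := cp.
have [r [c [r0 c0 rU Hc]]] := immersion_bilipschitz oU (Cf 1%N) Uu (imm u ^~ Uu).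
exists r; split => //; split.
- move=> x [v /rU Uv <-]; apply: (chart_point_continuous cp); first by exists v.
  by move=> w Uw; exact: Ck_continuous (Cf 0%N) Uw.
- move=> x y; rewrite !inE => -[v vr <-] [w wr <-] E.
  congr p; apply/eqP; rewrite -subr_eq0 -normr_le0.
  by apply: le_trans (Hc v w vr wr) _; rewrite /= E subrr normr0 mulr0.
- move=> W oW sW; pose C1 := p @` [set v | `|v - u| < r].
  (* the points near which f (C1) is contained in f (W) *)
  exists [set z | \forall y \near z, (f @` C1) y -> (f @` W) y]; last first.
    apply/seteqP; split => [_ [x Wx <-]|y [[x C1x <-]] H]; last first.
      by apply: (nbhs_singleton H); exists x.
    split; first by exists x => //; exact: sW.
    have [v vr pv] := sW x Wx.
    have Wpv : W (p v) by rewrite pv.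
    have cpv := cpp v (rU v vr).
    have C : nbhs v (p @^-1` W) := cpv _ (open_near oW Wpv).
    have [rho rho0 Hrho] := near_normP C.
    have rc0 : 0 < rho / c by rewrite divr_gt0.
    apply: (near_norm rc0) => y yx [x' [w wr px'] fx'].
    rewrite -fx' -px' in yx *; exists (p w) => //.
    apply: Hrho; apply: le_lt_trans (Hc w v wr vr) _.
    by rewrite mulrC -ltr_pdivlMr//= pv.
  by rewrite openE => z /nbhs_interior.
Qed.

End Embedding.

(** * Embedded subsets with the subspace topology *)

Section SubspaceTopology.
Context {T V : topologicalType}.

Lemma subspace_nbhs (A : set V) (y : V) (N : set V) : A y ->
  (\forall z \near y, A z -> N z) -> nbhs (y : subspace A) N.
Proof. by move=> Ay H; rewrite -[nbhs _]nbhs_subspace_in. Qed.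

Lemma nbhs_subspace_near (A : set V) (y : V) (N : set V) : A y ->
  nbhs (y : subspace A) N -> \forall z \near y, A z -> N z.
Proof. by move=> Ay; rewrite -[nbhs _]nbhs_subspace_in. Qed.

Lemma continuous_to_subspace (C1 : set T) (A : set V) (f : T -> V) x : open C1 ->
  C1 x -> (forall y, C1 y -> A (f y)) -> {for x, continuous f} ->
  {for x, continuous (f : T -> subspace A)}.
Proof.
move=> oC Cx fA cf N HN; have H := nbhs_subspace_near (fA x Cx) HN.
have C : nbhs x (f @^-1` _) := cf _ H.
by apply: filterS2 C (open_nbhs_nbhs (conj oC Cx)) => y Hy /fA; exact: Hy.
Qed.

Lemma hausdorff_subspace (A : set V) : hausdorff_space V -> hausdorff_space (subspace A).
Proof.
move=> hV x y xy; apply: hV => B C HB HC.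
have sub (z : V) (S : set V) : nbhs z S -> nbhs (z : subspace A) S.
  have [Az|nAz] := pselect (A z); first by move=> HS; apply: subspace_nbhs => //; apply: filterS HS.
  by move=> /nbhs_singleton Sz; rewrite -[nbhs _](nbhs_subspace_out nAz) => w ->.
exact: xy (sub _ _ HB) (sub _ _ HC).
Qed.

Lemma inverse_of_embedding (C1 : set T) (f : T -> V) (g : V -> T) y : open C1 ->
  topological_embedding C1 f -> (forall x, C1 x -> g (f x) = x) ->
  (f @` C1) y -> {for y, continuous (g : subspace (f @` C1) -> T)}.
Proof.
move=> oC [cf inj op] gf [x Cx <-{y}] N; rewrite gf// => HN.
have oW : open (N^° `&` C1) by apply: openI => //; exact: open_interior.
have [S oS ES] := op _ oW (@subIsetr _ _ _).
have fxW : (f @` (N^° `&` C1)) (f x) by exists x.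
have Sx : S (f x) by move: fxW; rewrite ES => -[].
suff : nbhs (f x : subspace (f @` C1)) (g @^-1` N) by [].
apply: subspace_nbhs; first by exists x.
apply: filterS (open_nbhs_nbhs (conj oS Sx)) => z Sz Az.
have : (f @` (N^° `&` C1)) z by rewrite ES.
by move=> [w [/interior_subset Nw Cw] <-]; rewrite /preimage /= gf.
Qed.

End SubspaceTopology.

(** * From closed transverse surfaces to minimal surfaces *)

Section ClosedSurfaces.
Context {R : realType} {C : topologicalType} (i : C -> ambient R).
Hypothesis sC : surface setT i.
Hypothesis QC : forall q, Qnz (i q).
Hypothesis clC : omega_closed setT i.
Hypothesis tC : transverse setT i.

Let QD (D : set C) x (_ : D x) : Qnz (i x) := QC x.

(** The map phi is the global primitive with value x0 at a, and
    primitive_parametrizes applies to it with Phi the identity of C0, and to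
    its restriction to an embedded C1 with Phi = phi. *)
Lemma integrate_closed_form (x0 : 'rV[R]_3) (C0 : set C) (a : C) : open C0 ->
  simply_connected R C0 -> C0 a ->
  exists phi : C -> 'rV[R]_3,
   [/\ forall (q1 : C) (g : R -> C), smooth_curve C0 i g a q1 ->
             phi q1 = x0 + path_integral (i \o g),
       parametrizes_minimal C0 i C0 phi id,
       forall C1 : set C, open C1 -> C1 `<=` C0 -> topological_embedding C1 phi ->
             parametrizes_minimal C1 i (T' := subspace (phi @` C1))
               (phi @` C1) id phi &
       forall q, C0 q -> exists C1 : set C,
             [/\ open C1, C1 `<=` C0, C1 q & topological_embedding C1 phi]].
Proof.
move=> oC0 scC0 C0a.
have sT : C0 `<=` setT by [].
have sC0 := surface_restrict oC0 sT sC.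
have tC0 := transverse_restrict oC0 sT tC.
have clC0 : omega_closed C0 i by move=> U p /(chart_widen sT)/clC.
have [phi [pa prim]] := global_primitive sC0 (QD (D := C0)) tC0 clC0 scC0 x0 C0a.
have hC := sC.1.
exists phi; split.
- move=> q1 g /(path_integral_primitive (QD (D := C0)) tC0 prim) ->.
  by rewrite pa addrC subrK.
- have Hid x : C0 x -> [/\ {for x, continuous (@id C)}, C0 (id x) & id (id x) = x].
    by move=> Cx; split => //; exact: cvg_id.
  exact: (@primitive_parametrizes R C C C0 i C0 phi id id sC0 (QD (D := C0)) tC0 hC oC0 Hid Hid prim).
- move=> C1 oC1 s1 emb; have [cphi inj _] := emb.
  have sC1 := surface_restrict oC1 s1 sC0.
  have tC1 := transverse_restrict oC1 s1 tC0.
  have prim1 := primitive_restrict oC1 s1 prim.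
  pose Psi (y : 'rV[R]_3) := xget a [set x | C1 x /\ phi x = y].
  have PsiP y : (phi @` C1) y -> C1 (Psi y) /\ phi (Psi y) = y.
    by move=> [x Cx xy]; apply: (xgetPex a (P := [set x | C1 x /\ phi x = y])); exists x.
  have PsiK x : C1 x -> Psi (phi x) = x.
    move=> Cx; have [] : C1 (Psi (phi x)) /\ phi (Psi (phi x)) = phi x by apply: PsiP; exists x.
    by move=> ? ?; apply: inj; rewrite ?inE.
  apply: (@primitive_parametrizes R C (subspace (phi @` C1)) C1 i (phi @` C1) id phi Psi
    sC1 (QD (D := C1)) tC1 _ _ _ _ prim1).
  + exact/hausdorff_subspace/norm_hausdorff.
  + exact: open_subspaceT.
  + move=> x Cx; split; [|by exists x|exact: PsiK].
    apply: (continuous_to_subspace oC1 Cx); last exact: cphi.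
    by move=> y Cy; exists y.
  + move=> y Ay; have [P1 P2] := PsiP y Ay; split => //.
    exact: (inverse_of_embedding oC1 emb PsiK Ay).
- move=> q Cq; have [U [p [cp [u Uu pu]]]] := sC0.2 q Cq.
  have cpp := primitive_chart (QD (D := C0)) tC0 prim cp.
  have [r [r0 rU emb]] := chart_embedding cpp Uu.
  exists (p @` [set v | `|v - u| < r]); split => //.
  + by have [_ _ op _ _] := cp; apply: op => //; exact: open_norm_ball.
  + by move=> _ [v /rU Uv <-]; exact: (chart_dom cp).
  + by exists u => //=; rewrite subrr normr0.
Qed.

Lemma germ_of_minimal_surface (q : C) : exists (D : set C) (f : C -> 'rV[R]_3)
     (o : C -> set ('rV[R]_3 * 'rV[R]_3)),
  [/\ open D /\ D q, minimal_surface D f o, diffeo D i D f id,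
      forall x, D x -> gauss_curvature D f o x != 0 &
      forall x, D x -> gauss_diff D f o x = i x].
Proof.
have [U [p [u [P [cp Uu pu _ prim]]]]] := local_primitive sC (QD (D := setT)) clC (x := q) I.
have sT : p @` U `<=` setT by [].
have oD := chart_open cp.
have sD := surface_restrict oD sT sC; have tD := transverse_restrict oD sT tC.
have Hid x : (p @` U) x -> [/\ {for x, continuous (@id C)}, (p @` U) (id x) & id (id x) = x].
  by move=> Dx; split => //; exact: cvg_id.
have [s1 d1 [ori [_ _ gd ms gc]]] := @primitive_parametrizes R C C (p @` U) i (p @` U) P id id
   sD (QD (D := p @` U)) tD sC.1 oD Hid Hid prim.
by exists (p @` U), P, ori; split => //; split => //; exists u.
Qed.

End ClosedSurfaces.

(** * The Gauss image of a minimal surface *)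

Lemma dot_combination (R : realType) (m a b : 'rV[R]_3) (x y : R) :
  dot m a = 0 -> dot m b = 0 -> dot m (x *: a + y *: b) = 0.
Proof. by move=> ma mb; rewrite dotDr !dotZr ma mb !mulr0 addr0. Qed.

Lemma mulmx_combination (R : realType) (a b : 'rV[R]_3) (A : 'M[R]_3) (x y : R) :
  (x *: a + y *: b) *m A = x *: (a *m A) + y *: (b *m A).
Proof. by rewrite mulmxDl -!scalemxAl. Qed.

(** The bilinear form of A is symmetric on the frame (a, b, m), whose vector
    m lies in the kernel of A and is orthogonal to its image. *)
Lemma symmetric_on_frame (R : realType) (m a b : 'rV[R]_3) (A : 'M[R]_3) :
  dot m m = 1 -> dot m a = 0 -> dot m b = 0 -> det3 a b m != 0 ->
  m *m A = 0 -> dot (a *m A) m = 0 -> dot (b *m A) m = 0 ->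
  dot (a *m A) b = dot (b *m A) a -> A^T = A.
Proof.
move=> mm ma mb d0 mA Aa Ab sym.
have key v : dot (v *m A) a = dot (a *m A) v -> dot (v *m A) b = dot (b *m A) v ->
    dot (v *m A) m = dot (m *m A) v -> v *m A^T = v *m A.
  move=> va vb vm; pose x := v *m A - v *m A^T.
  have E w : dot (v *m A) w = dot (w *m A) v -> dot w x = 0.
    move=> vw; rewrite /x dotC dotDl -scaleN1r dotZl (dot_mulmx A^T v w) trmxK.
    by rewrite [dot v (w *m A)]dotC vw mulN1r subrr.
  have xE := normal_span mm ma mb d0 (E m vm).
  have : dot x x = 0.
    by rewrite [X in dot X _]xE dotDl !dotZl (E a va) (E b vb) !mulr0 addr0.
  by move=> /dot_eq0 /eqP; rewrite subr_eq0 => /eqP.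
apply: (mx_eq_on_frame mm ma mb d0); apply: key => //.
- by rewrite mA dot0l Aa.
- by rewrite mA dot0l Ab.
- by rewrite mA dot0l Aa.
- by rewrite mA dot0l Ab.
Qed.

Lemma derive_constant_dot (R : realType) (E : normedModType R) (x y : E -> 'rV[R]_3)
    (U : set E) (c : R) u w : open U -> U u -> differentiable x u -> differentiable y u ->
  (forall e, U e -> dot (x e) (y e) = c) ->
  dot ('D_w x u) (y u) + dot (x u) ('D_w y u) = 0.
Proof.
move=> oU Uu dx dy xyc; have [_ <-] := derive_dot w dx dy.
by rewrite (derive_ext (g := cst c) w oU xyc Uu) derive_cst.
Qed.

Lemma schwarz_rV (R : realType) n m (F : 'rV[R]_n -> 'rV[R]_m) U (v w u : 'rV[R]_n) :
  open U -> Ck 2 U F -> U u ->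
  'D_v ('D_w F) u = 'D_w ('D_v F) u.
Proof.
move=> oU CF Uu; have [dF DF] := CF.
have dDF z : differentiable ('D_z F) u by have [+ _] := DF z; apply.
apply/rowP => k.
have E1 := derive_coord v 0 k (dDF w).
have E2 := derive_coord w 0 k (dDF v).
apply: (etrans (esym E1)); apply: etrans E2.
have E z x : U x -> ('D_z F) x 0 k = 'D_z (fun y => F y 0 k) x.
  by move=> Ux; rewrite derive_coord//; exact: dF.
apply: (etrans (derive_ext v oU (E w) Uu)); apply: etrans (esym (derive_ext w oU (E v) Uu)).
exact: (schwarz v w oU (Ck_coord 0 k oU CF) Uu).
Qed.

(** A fiber of Q is a linear space, so it contains the line through y in a
    vertical direction. *)
Lemma line_in_fiber (R : realType) (y k : ambient R) : Qbundle y -> k.1 = 0 -> k.2^T = k.2 ->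
  \tr k.2 = 0 -> y.1 *m k.2 = 0 -> tangent_set (fiber y.1) y k.
Proof.
move=> [yy yT ytr yq] k1 kT ktr yk.
have C l : Ck l setT (fun t : R => y + t *: k).
  apply: CkD; [exact: openT|exact: Ck_cst|].
  by apply: CkZ; [exact: openT|exact: Ck_id|exact: Ck_cst].
exists (fun t : R => y + t *: k), setT; split => //.
- exact: openT.
- move=> t _; split; last by rewrite /= k1 scaler0 addr0.
  split; rewrite /= ?k1 ?scaler0 ?addr0//.
  + by rewrite linearD linearZ /= yT kT.
  + by rewrite mxtraceD mxtraceZ ytr ktr mulr0 addr0.
  + by rewrite mulmxDr -scalemxAr yq yk scaler0 addr0.
- split; first by rewrite scale0r addr0.
  by rewrite derive1E derive_affine.
Qed.

Section MinimalSurfaces.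
Context {R : realType} {T : topologicalType}.
Variables (D : set T) (f : T -> 'rV[R]_3) (o : T -> set ('rV[R]_3 * 'rV[R]_3)).
Hypothesis mD : minimal_surface D f o.
Hypothesis KD : forall x, D x -> gauss_curvature D f o x != 0.

Local Notation n := (gauss_map o).
Local Notation N := (gauss_diff D f o).

Let sD : surface D f. Proof. by case: mD. Qed.
Let oD : orientation D f o. Proof. by case: mD. Qed.

Lemma orientation_frames x : D x -> o x = frames (n x).
Proof.
move=> Dx; have [U [p [cp [u Uu pu] H]]] := orientation_chart oD Dx.
by have [ho hg] := H u Uu; rewrite -pu hg ho.
Qed.

(** For vanishing n', the matrix plus_id is n^T n, of rank at most 1. *)
Lemma gauss_diff_neq0 x : D x -> (N x).2 != 0.
Proof.
move=> Dx; have := KD Dx; rewrite /gauss_curvature; apply: contra => /eqP N0.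
have -> : plus_id (N x).1 (N x).2 = (N x).1^T *m (N x).1 by rewrite /plus_id N0 add0r.
apply: contraT => d0; have : (N x).1^T *m (N x).1 \in unitmx by rewrite unitmxE unitfE.
move=> /mxrank_unit r3; have := mxrankM_maxl ((N x).1^T) ((N x).1).
by rewrite r3 => /leq_trans/(_ (rank_leq_col _)).
Qed.

Lemma gauss_shape x : D x -> shape_operator D f o x (N x).2.
Proof. by move=> /gauss_diff_neq0; exact: gauss_diff_shape. Qed.

Lemma gauss_map_along (E : normedModType R) (h : E -> T) (W : set E) : open W ->
  (forall e, W e -> {for e, continuous h}) -> (forall e, W e -> D (h e)) ->
  smooth_on W (f \o h) ->
  [/\ smooth_on W (n \o h),
      forall e, W e -> dot (n (h e)) (n (h e)) = 1,
      forall e v, W e -> dot (n (h e)) ('D_v (f \o h) e) = 0 &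
      forall e v, W e -> 'D_v (n \o h) e = 'D_v (f \o h) e *m (N (h e)).2].
Proof.
move=> oW ch Dh Cf.
have nchart U p : chart D f U p -> (forall u, U u ->
    n (p u) = unit_normal (partial f p u 0) (partial f p u 1)) -> smooth_on U (n \o p).
  move=> cp gE k; have [oU _ _ _ _] := cp.
  apply: (Ck_ext oU) (Ck_unit_normal oU (fun u => chart_independent cp) (Ck_partial 0 k cp) (Ck_partial 1 k cp)).
  by move=> u Uu /=; rewrite gE.
have at_e e : W e -> exists U p, [/\ chart D f U p, (p @` U) (h e), smooth_on U (n \o p) &
    forall u, U u -> n (p u) = unit_normal (partial f p u 0) (partial f p u 1)].
  move=> We; have [U [p [cp pe H]]] := orientation_chart oD (Dh _ We).
  have gE u : U u -> n (p u) = unit_normal (partial f p u 0) (partial f p u 1).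
    by move=> Uu; have [] := H u Uu.
  by exists U, p; split => //; exact: nchart.
split.
- apply: (smooth_along (D := D) oW ch Cf) => e /at_e[U [p [cp pe Cn _]]].
  by exists U, p.
- move=> e /at_e[U [p [cp [u Uu pu] _ gE]]]; rewrite -pu gE//.
  by have [] := unit_normalP (chart_independent cp Uu).
- move=> e v We; have [U [p [cp pe _ gE]]] := at_e e We.
  have df u : U u -> differentiable (f \o p) u := chart_differentiable cp.
  rewrite (derive_lift oW ch Cf cp v df We pe); have [Ul pl] := liftP pe.
  rewrite derive_sum; last exact: df.
  have [_ n0 n1 _] := unit_normalP (chart_independent cp Ul).
  rewrite -gE// pl in n0 n1.
  by rewrite sum2; exact: dot_combination n0 n1.
- move=> e v We; have [U [p [cp pe Cn gE]]] := at_e e We.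
  apply: (derive_along v oW ch Cf cp Cn _ We pe) => u w Uu pu.
  have [_ H] := gauss_shape (Dh _ We).
  by rewrite (H U p u w cp Uu pu).
Qed.

Section OneChart.
Variables (U : set 'rV[R]_2) (p : 'rV[R]_2 -> T).
Hypothesis cp : chart D f U p.

Let oU : open U. Proof. by case: cp. Qed.
Let Cf : smooth_on U (f \o p). Proof. by have [_ _ _ _ []] := cp. Qed.
Let along := gauss_map_along oU (chart_continuous cp) (chart_dom cp) Cf.

Lemma smooth_gauss_map : smooth_on U (n \o p).
Proof. by have [] := along. Qed.

Lemma chart_frame u : U u ->
  [/\ dot (n (p u)) (n (p u)) = 1, dot (n (p u)) (partial f p u 0) = 0,
      dot (n (p u)) (partial f p u 1) = 0 &
      det3 (partial f p u 0) (partial f p u 1) (n (p u)) != 0].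
Proof.
move=> Uu; have [_ nn nt _] := along.
have n0 : dot (n (p u)) (partial f p u 0) = 0 := nt u (delta_mx 0 0) Uu.
have n1 : dot (n (p u)) (partial f p u 1) = 0 := nt u (delta_mx 0 1) Uu.
split => //; first exact: nn.
exact: (normal_det3 (nn u Uu) (chart_independent cp Uu) n0 n1).
Qed.

Lemma derive_gauss_map u w : U u ->
  'D_w (n \o p) u = 'D_w (f \o p) u *m (N (p u)).2.
Proof. by have [_ _ _] := along; apply. Qed.

(** Row l of n' is the image of the basis vector l, whose component
    orthogonal to n has, in the frame of partial derivatives of f,
    coefficients that are quotients of determinants; and n' maps that frame
    to the partial derivatives of n. *)
Lemma smooth_shape_operator : smooth_on U (fun u => (N (p u)).2).
Proof.
move=> k.
pose e0 u := partial f p u 0; pose e1 u := partial f p u 1.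
pose d u := det3 (e0 u) (e1 u) (n (p u)).
have Cn := smooth_gauss_map.
have Cd : Ck k U d := Ck_det3 oU (Ck_partial 0 k cp) (Ck_partial 1 k cp) (Cn k).
have rowE u l : U u -> row l (N (p u)).2 =
    (det3 (delta_mx 0 l) (e1 u) (n (p u)) / d u) *: 'D_(delta_mx 0 0) (n \o p) u
    + (det3 (e0 u) (delta_mx 0 l) (n (p u)) / d u) *: 'D_(delta_mx 0 1) (n \o p) u.
  move=> Uu; have [nn n0 n1 d0] := chart_frame Uu.
  have [nA _] := gauss_shape (chart_dom cp Uu).
  rewrite !derive_gauss_map// -/(partial f p u 0) -/(partial f p u 1).
  have [y [ny dl E0 E1]] : exists y : 'rV[R]_3, [/\ dot (n (p u)) y = 0,
      delta_mx 0 l = y + dot (n (p u)) (delta_mx 0 l) *: n (p u),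
      det3 y (e1 u) (n (p u)) = det3 (delta_mx 0 l) (e1 u) (n (p u)) &
      det3 (e0 u) y (n (p u)) = det3 (e0 u) (delta_mx 0 l) (n (p u))].
    exists (delta_mx 0 l - dot (n (p u)) (delta_mx 0 l) *: n (p u)); split.
    - by rewrite dotDr -scaleNr dotZr nn mulr1 subrr.
    - by rewrite subrK.
    - by rewrite det3_add_l.
    - by rewrite det3_add_m.
  have yE := normal_span nn n0 n1 d0 ny.
  rewrite -/(e0 u) -/(e1 u) -/(d u) E0 E1 in yE.
  rewrite rowE [X in X *m _]dl mulmxDl -scalemxAl nA scaler0 addr0.
  by rewrite [X in X *m _]yE; exact: mulmx_combination.
have dn0 u : U u -> d u != 0 by move=> /chart_frame[].
have CDn i : Ck k U ('D_(delta_mx 0 i) (n \o p)) by have [_ H] := Cn k.+1; exact: H.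
apply: Ck_matrix => // l m.
apply: (Ck_ext oU (f := fun u => ((det3 (delta_mx 0 l) (e1 u) (n (p u)) * (d u)^-1) *: 'D_(delta_mx 0 0) (n \o p) u
    + (det3 (e0 u) (delta_mx 0 l) (n (p u)) * (d u)^-1) *: 'D_(delta_mx 0 1) (n \o p) u) 0 m)).
  by move=> u Uu; rewrite -rowE// mxE.
apply: Ck_coord => //; apply: CkD => //.
  apply: (CkZ oU _ (CDn 0)); apply: (CkM oU _ (CkV oU dn0 Cd)).
  exact: (Ck_det3 oU (Ck_cst k U _) (Ck_partial 1 k cp) (Cn k)).
apply: (CkZ oU _ (CDn 1)); apply: (CkM oU _ (CkV oU dn0 Cd)).
exact: (Ck_det3 oU (Ck_partial 0 k cp) (Ck_cst k U _) (Cn k)).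
Qed.

(** Differentiating n . f_l = 0 gives n_k . f_l = - n . f_lk, where f_lk is
    symmetric in l and k. *)
Lemma shape_operator_sym u : U u -> (N (p u)).2^T = (N (p u)).2.
Proof.
move=> Uu; have [nn n0 n1 d0] := chart_frame Uu.
have [nA _] := gauss_shape (chart_dom cp Uu).
have dn : differentiable (n \o p) u by have [+ _] := smooth_gauss_map 1; apply.
have De i : differentiable (partial f p ^~ i) u.
  by have [+ _] := Ck_partial i 1 cp; apply.
have [_ nn1 nt _] := along.
have nn' w : dot ('D_w (n \o p) u) (n (p u)) = 0.
  have := derive_constant_dot w oU Uu dn dn nn1.
  by rewrite [dot ((n \o p) u) _]dotC -mulr2n => /eqP; rewrite mulrn_eq0 /= => /eqP.
have ne (l k : 'I_2) := derive_constant_dot (delta_mx 0 k) oU Uu dn (De l)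
  (fun y Uy => nt y (delta_mx 0 l) Uy).
have S := schwarz_rV (delta_mx 0 1) (delta_mx 0 0) oU (Cf 2) Uu.
have ne01 := ne 0 1; have ne10 := ne 1 0.
have sym01 : dot ('D_(delta_mx 0 0) (n \o p) u) (partial f p u 1) =
    dot ('D_(delta_mx 0 1) (n \o p) u) (partial f p u 0).
  apply: (addIr (dot ((n \o p) u) ('D_(delta_mx 0 1) ('D_(delta_mx 0 0) (f \o p)) u))).
  by apply: etrans (esym ne01); rewrite S; exact: ne10.
have G0 := derive_gauss_map (delta_mx 0 0) Uu.
have G1 := derive_gauss_map (delta_mx 0 1) Uu.
have m0 := nn' (delta_mx 0 0); have m1 := nn' (delta_mx 0 1).
rewrite G0 in m0 sym01; rewrite G1 in m1 sym01.
exact: (symmetric_on_frame nn n0 n1 d0 nA m0 m1 sym01).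
Qed.

End OneChart.

Lemma gauss_diff_Qnz x : D x -> Qnz (N x).
Proof.
move=> Dx; split; last exact: gauss_diff_neq0.
have [U [p [cp [u Uu pu]]]] := sD.2 x Dx.
have [nn _ _ _] := chart_frame cp Uu; have [nA _] := gauss_shape Dx.
have := shape_operator_sym cp Uu; rewrite pu in nn * => symA.
by have [_ _ trA] := mD; split => //; exact: trA.
Qed.

(** The relation dn = df n' can be solved for df because n' is invertible on
    the plane orthogonal to n. *)
Lemma gauss_map_derive_inverse U p u w : chart D f U p -> U u ->
  'D_w (f \o p) u = 'D_w (fst \o N \o p) u *m invmx (plus_id (N (p u)).1 (N (p u)).2).
Proof.
move=> cp Uu; have Dp := chart_dom cp Uu.
have -> : 'D_w (fst \o N \o p) u = 'D_w (f \o p) u *m plus_id (N (p u)).1 (N (p u)).2.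
  rewrite mul_plus_id; first exact: (derive_gauss_map cp).
  have [oU _ _ _ [Cf _]] := cp.
  have [_ _ nt _] := gauss_map_along oU (chart_continuous cp) (chart_dom cp) Cf.
  by rewrite dotC; exact: nt.
rewrite mulmxK//; have := gauss_diff_Qnz Dp; case: (N (p u)) => s q /=.
exact: plus_id_unit.
Qed.

Lemma smooth_gauss_diff U p : chart D f U p -> smooth_on U (N \o p).
Proof.
move=> cp k; have [oU _ _ _ _] := cp.
apply: (Ck_ext oU) (Ck_pair oU (smooth_gauss_map cp k) (smooth_shape_operator cp k)).
by [].
Qed.

(** The Gauss map is an immersion because its differential determines that
    of f. *)
Lemma gauss_map_chart U p : chart D f U p -> chart D n U p.
Proof.
move=> cp; have [oU cpp op sDp [Cf imm]] := cp; split => //; split.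
  exact: smooth_gauss_map cp.
move=> u w Uu Dn0; apply: (imm u w Uu).
by rewrite (gauss_map_derive_inverse w cp Uu) (_ : 'D_w _ u = 0) ?mul0mx.
Qed.

Lemma gauss_diff_chart U p : chart D f U p -> chart D N U p.
Proof.
move=> cp; have [oU cpp op sDp [Cn imm]] := gauss_map_chart cp; split => //; split.
  exact: smooth_gauss_diff cp.
move=> u w Uu DN0; apply: (imm u w Uu).
have dN : differentiable (N \o p) u by have [+ _] := smooth_gauss_diff cp 1; apply.
by have [_] := derive_fst w dN; rewrite DN0.
Qed.

Lemma gauss_diff_surface : surface D N.
Proof.
split; first exact: sD.1.
by move=> x /sD.2[U [p [cp px]]]; exists U, p; split => //; exact: gauss_diff_chart.
Qed.

Lemma immersion_primitive : omega_primitive D N f.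
Proof.
move=> x /sD.2[U [p [cp px]]]; exists U, p; split => //.
- exact: gauss_diff_chart.
- by have [_ _ _ _ []] := cp.
- by move=> u w Uu; exact: (gauss_map_derive_inverse w cp Uu).
Qed.

(** For v tangent to Q, the vector z = q^-1 ds (v) is tangent to the minimal
    surface, and the derivative c of the Gauss differential in the direction
    z has the same base component as v. The difference v - c is vertical,
    and the fibers are linear. *)
Lemma gauss_diff_transverse : transverse D N.
Proof.
move=> x Dx v [g [J [oJ J0 Cg Qg [g0 gv]]]].
have dg : differentiable g 0 by have [+ _] := Cg 1%N; apply.
have := tangent_Qbundle (1 : R) oJ J0 dg Qg; rewrite -derive1E gv g0.
move=> [v1n vT vtr vA].
have [U [p [cp [u Uu pu]]]] := sD.2 x Dx.
have Qx := gauss_diff_Qnz Dx; have [QBx _] := Qx.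
have [nn n0 n1 d0] := chart_frame cp Uu; rewrite pu in nn n0 n1 d0.
pose z := v.1 *m invmx (plus_id (N x).1 (N x).2).
have [zn zA] : dot z (n x) = 0 /\ z *m (N x).2 = v.1.
  rewrite /z; move: Qx v1n; rewrite -[n x]/((N x).1); case: (N x) => s q /=.
  exact: omega_inverse.
rewrite dotC in zn; have zE := normal_span nn n0 n1 d0 zn.
move: zE; set al := _ / _; set be := _ / _ => zE.
pose w : 'rV[R]_2 := \row_l (if l == 0 then al else be).
have w0 : w 0 0 = al by rewrite mxE.
have w1 : w 0 1 = be by rewrite mxE.
have dfp := chart_differentiable cp Uu.
have Dz : 'D_w (f \o p) u = z by rewrite derive_sum// sum2 w0 w1 [RHS]zE.
have cN := gauss_diff_chart cp; have [oU _ _ _ _] := cN.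
have dN := chart_differentiable cN Uu.
pose c := 'D_w (N \o p) u.
have [_ Dfst] := derive_fst w dN.
have c1 : c.1 = v.1.
  by rewrite /c -Dfst -zA -Dz -pu; exact: (derive_gauss_map cp).
have QU y : U y -> Qbundle ((N \o p) y).
  by move=> Uy; have [] := gauss_diff_Qnz (chart_dom cp Uy).
have := tangent_Qbundle w oU Uu dN QU; rewrite -/c /= pu => -[_ cT ctr cA].
exists c, (v - c); split; last by rewrite addrC subrK.
  by exists U, p, u, w.
apply: (@line_in_fiber R (N x) (v - c)) => //=.
- by rewrite c1 subrr.
- by rewrite linearB /= vT cT.
- by rewrite linearB /= vtr ctr subrr.
- rewrite mulmxBr; apply/eqP; rewrite subr_eq0; apply/eqP.
  by apply: (addrI (v.1 *m (N x).2)); rewrite vA -c1 cA.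
Qed.

(** The pullback of omega is df, which is closed by the symmetry of second
    derivatives. *)
Lemma gauss_diff_closed : omega_closed D N.
Proof.
move=> U p cp u v w Uu; have [oU _ _ _ [CN _]] := cp.
have Cs k : Ck k U (fst \o N \o p) := Ck_fst oU (CN k).
have [Cf Df] := primitive_along gauss_diff_Qnz gauss_diff_transverse immersion_primitive
   oU (chart_continuous cp) (chart_dom cp) Cs.
have E z x : U x -> pullback omega (N \o p) x z = 'D_z (f \o p) x.
  move=> Ux; rewrite Df// /pullback /omega.
  have [_ <-] := derive_fst z (chart_differentiable cp Ux).
  by [].
have E1 : 'D_v (pullback omega (N \o p) ^~ w) u = 'D_v ('D_w (f \o p)) u.
  by apply: (derive_ext v oU _ Uu) => y; exact: E.
have E2 : 'D_w (pullback omega (N \o p) ^~ v) u = 'D_w ('D_v (f \o p)) u.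
  by apply: (derive_ext w oU _ Uu) => y; exact: E.
apply/eqP; rewrite subr_eq0; apply/eqP.
apply: (etrans E1); apply: etrans (esym E2).
exact: (schwarz_rV v w oU (Cf 2) Uu).
Qed.

End MinimalSurfaces.

(** * The Gauss image as a subset of Q *)

Section GaussImage.
Context {R : realType} {T : topologicalType}.
Variables (D : set T) (i : T -> ambient R) (a : T).
Hypothesis sD : surface D i.
Hypothesis embD : topological_embedding D i.
Let oD : open D. Proof. exact: surface_open sD. Qed.

Local Notation C0 := (i @` D).
Local Notation j := (id : subspace C0 -> ambient R).

Definition embedding_inverse (y : ambient R) : T := xget a [set x | D x /\ i x = y].
Local Notation Psi := embedding_inverse.

Lemma embedding_inverseP y : C0 y -> D (Psi y) /\ i (Psi y) = y.
Proof.
by move=> [x Dx xy]; apply: (xgetPex a (P := [set x | D x /\ i x = y])); exists x.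
Qed.

Lemma embedding_inverseK x : D x -> Psi (i x) = x.
Proof.
move=> Dx; have [_ inj _] := embD.
have [D1 E1] : D (Psi (i x)) /\ i (Psi (i x)) = i x.
  by apply: embedding_inverseP; exists x.
by apply: inj; rewrite ?inE.
Qed.

Let Hi x : D x -> [/\ {for x, continuous (i : T -> subspace C0)}, C0 (i x) & Psi (i x) = x].
Proof.
move=> Dx; split; [|by exists x|exact: embedding_inverseK].
apply: (continuous_to_subspace oD Dx) => [y Dy|]; first by exists y.
by have [ci _ _] := embD; exact: ci.
Qed.

Let HPsi y : C0 y -> [/\ {for y, continuous (Psi : subspace C0 -> T)}, D (Psi y) & i (Psi y) = y].
Proof.
move=> Cy; have [P1 P2] := embedding_inverseP Cy; split => //.
exact: (inverse_of_embedding oD embD embedding_inverseK Cy).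
Qed.

Let oC : open (C0 : set (subspace C0)). Proof. exact: open_subspaceT. Qed.

Lemma image_chart U p : chart D i U p ->
  chart (T := subspace C0) C0 j U (i \o p).
Proof. by apply: (chart_homeo (f' := j) oC Hi HPsi). Qed.

Lemma preimage_chart U p : chart (T := subspace C0) C0 j U p -> chart D i U (Psi \o p).
Proof. by apply: (chart_homeo (f := j) (f' := i) oD HPsi Hi) => y /HPsi[]. Qed.

Lemma preimage_chartK U p u : chart (T := subspace C0) C0 j U p -> U u -> i (Psi (p u)) = p u.
Proof. by move=> cp /(chart_dom cp)/HPsi[]. Qed.

Lemma image_surface : surface (T := subspace C0) C0 j.
Proof.
split; first exact/hausdorff_subspace/norm_hausdorff.
move=> y Cy; have [_ Dy E] := HPsi Cy; have [U [p [cp [u Uu pu]]]] := sD.2 _ Dy.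
exists U, (i \o p); split; first exact: image_chart.
by exists u => //=; rewrite pu.
Qed.

Lemma image_transverse : transverse D i -> transverse (T := subspace C0) C0 j.
Proof.
move=> tD y Cy v tv; have [_ Dy E] := HPsi Cy.
rewrite -E in tv; have [c [k [[U [p [u [w [cp Uu pu Dc]]]]] tk vE]]] := tD _ Dy v tv.
exists c, k; split => //; last by rewrite -E.
exists U, (i \o p), u, w; split => //; first exact: image_chart.
by rewrite /= pu.
Qed.

Lemma image_closed : omega_closed D i -> omega_closed (T := subspace C0) C0 j.
Proof.
move=> cD U p cp u v w Uu; have [oU _ _ _ _] := cp.
rewrite -[RHS](cD U _ (preimage_chart cp) u v w Uu).
have E x : U x -> (j \o p) x = (i \o (Psi \o p)) x.
  by move=> Ux; rewrite /= (preimage_chartK cp Ux).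
have E2 z x : U x -> pullback omega (j \o p) x z = pullback omega (i \o (Psi \o p)) x z.
  by move=> Ux; rewrite /pullback (derive_ext z oU E Ux) E.
have Ev : 'D_v (pullback omega (j \o p) ^~ w) u =
    'D_v (pullback omega (i \o (Psi \o p)) ^~ w) u.
  by apply: (derive_ext v oU _ Uu) => x; exact: E2.
have Ew : 'D_w (pullback omega (j \o p) ^~ v) u =
    'D_w (pullback omega (i \o (Psi \o p)) ^~ v) u.
  by apply: (derive_ext w oU _ Uu) => x; exact: E2.
exact: (f_equal2 (fun x y => x - y) Ev Ew).
Qed.

Hypothesis QD : forall x, D x -> Qnz (i x).
Hypothesis tD : transverse D i.
Variable f : T -> 'rV[R]_3.
Hypothesis prim : omega_primitive D i f.

Lemma image_diffeo : (forall U p, chart D f U p -> smooth_on U (i \o p)) ->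
  diffeo D f (T' := subspace C0) C0 j i.
Proof.
move=> Ci; split.
- split=> [x Dx|x y|y Cy]; first by exists x.
    by have [_ inj _] := embD; exact: inj.
  by have [_ Dy E] := HPsi Cy; exists (Psi y).
- split=> [x /Hi[]//|U p cp].
  exact: Ci cp.
- exists Psi; split => [x /Hi[]//|y /HPsi[]//|].
  split=> [y /HPsi[]//|U p cp].
  have cp' := preimage_chart cp; have [oU _ _ _ [C' _]] := cp'.
  have Cs k : Ck k U (fst \o i \o (Psi \o p)) := Ck_fst oU (C' k).
  by have [] := primitive_along QD tD prim oU (chart_continuous cp') (chart_dom cp') Cs.
Qed.

Lemma image_path_integral (g : R -> ambient R) x y : D x -> D y ->
  smooth_curve C0 id g (i x) (i y) -> path_integral g = f y - f x.
Proof.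
move=> Dx Dy [g0 g1 [J [oJ sJ HJ Cg]]].
have E t : J t -> g t = (i \o (Psi \o g)) t.
  by move=> /HJ[_ /HPsi[_ _ Eg]]; rewrite /= Eg.
have curve : smooth_curve D i (Psi \o g) x y.
  split; rewrite /= ?g0 ?g1 ?embedding_inverseK//.
  exists J; split => //.
    move=> t Jt; have [cg Cgt] := HJ t Jt; have [cPsi DPsi _] := HPsi Cgt.
    split; last exact: DPsi.
    (* g is continuous into the ambient space, and its values lie in C0 *)
    have cg' : {for t, continuous (g : R -> subspace C0)}.
      exact: (continuous_to_subspace oJ Jt (fun t Jt => (HJ t Jt).2) cg).
    exact: (@continuous_comp _ _ _ (g : R -> subspace C0) (Psi : subspace C0 -> T) t cg' cPsi).
  by move=> k; exact: Ck_ext oJ E (Cg k).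
rewrite -(path_integral_primitive QD tD prim curve).
apply/rowP => k; rewrite [LHS]mxE [RHS]mxE.
apply: eq_Rintegral => t; rewrite inE => t01; have Jt := sJ t t01.
have Dt : derive1 g t = derive1 (i \o (Psi \o g)) t.
  by rewrite !derive1E; exact: derive_ext oJ E Jt.
by rewrite (E t Jt) Dt.
Qed.

End GaussImage.

(** The Gauss map is an immersion, hence an embedding of a small ball of a
    chart, and so is n', whose first component it is. The properties of n'
    as an immersed surface pass to its image. *)
Lemma gauss_image_of_minimal_surface (R : realType) (M : topologicalType)
    (f : M -> 'rV[R]_3) (o : M -> set ('rV[R]_3 * 'rV[R]_3)) :
  minimal_surface setT f o -> (forall x, gauss_curvature setT f o x != 0) ->
  let N := gauss_diff setT f o in
  forall x0 : M, exists M0 : set M,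
   [/\ open M0, connected M0, M0 x0 &
     let C0 := N @` M0 in
     let i := id : subspace C0 -> ambient R in
     [/\ surface (T := subspace C0) C0 i,
         C0 `<=` (@Qnz R) /\ transverse (T := subspace C0) C0 i,
         diffeo M0 f (T' := subspace C0) C0 i N,
         omega_closed (T := subspace C0) C0 i &
         forall (x1 : M) (g : R -> subspace C0), M0 x1 ->
           smooth_curve C0 i g (N x0) (N x1) ->
           f x1 = f x0 + path_integral (i \o g)]].
Proof.
move=> mM KM N x0.
have KD x (_ : setT x) := KM x.
have [U [p [cp [u Uu pu]]]] := (gauss_diff_surface mM KD).2 x0 I.
have [U' [p' [cp' [u' Uu' pu']]]] : exists U p, chart setT f U p /\ (p @` U) x0.
  by have [sM _ _] := mM; exact: sM.2.
have cn := gauss_map_chart mM KD cp'; have cN := gauss_diff_chart mM KD cp'.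
have [r [r0 rU [cemb inj op]]] := chart_embedding cn Uu'.
pose B := [set v : 'rV[R]_2 | `|v - u'| < r].
have oB : open B by exact: open_norm_ball.
have oM0 : open (p' @` B) by have [_ _ + _ _] := cp'; apply.
have sT : p' @` B `<=` setT by [].
have embN : topological_embedding (p' @` B) N.
  split.
  - move=> x [v /rU Uv <-]; apply: (chart_point_continuous cn); first by exists v.
    by move=> w Uw; have [_ _ _ _ [CN _]] := cN; exact: Ck_continuous (CN 0%N) Uw.
  - by move=> x y Bx By /(congr1 fst); exact: inj.
  - move=> W oW sW; have [S oS ES] := op W oW sW.
    exists (fst @^-1` S); first by apply: open_comp => // z _; exact: cvg_fst.
    apply/seteqP; split => [_ [x Wx <-]|y [[x Bx <-]] Sx].
      split; first by exists x => //; exact: sW.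
      have : (gauss_map o @` W) (gauss_map o x) by exists x.
      by rewrite ES => -[].
    have : (gauss_map o @` W) (gauss_map o x) by rewrite ES; split => //; exists x.
    move=> [x' Wx' E]; exists x' => //; congr N.
    by apply: inj; rewrite ?inE//; exact: sW.
have sN : surface (p' @` B) N := surface_restrict oM0 sT (gauss_diff_surface mM KD).
have QN x (_ : (p' @` B) x) : Qnz (N x) := gauss_diff_Qnz mM KD (I : setT x).
have tN : transverse (p' @` B) N := transverse_restrict oM0 sT (gauss_diff_transverse mM KD).
have clN : omega_closed (p' @` B) N.
  by move=> V q /(chart_widen sT); exact: gauss_diff_closed.
have prN : omega_primitive (p' @` B) N f := primitive_restrict oM0 sT (immersion_primitive mM KD).
have M0x : (p' @` B) x0 by exists u' => //; rewrite /B /= subrr normr0.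
exists (p' @` B); split => //.
  apply: connected_continuous_connected.
    by apply: convex_connected => x y t Bx By t01; exact: segment_ball.
  apply: continuous_in_subspaceT => v; rewrite inE => /rU Uv.
  exact: (chart_continuous cp').
split.
- exact: (image_surface x0 sN embN).
- split; first by move=> _ [x Bx <-]; exact: QN.
  exact: (image_transverse x0 sN embN tN).
- apply: (image_diffeo x0 sN embN QN tN prN) => V q /(chart_widen sT) cq.
  exact: (smooth_gauss_diff mM KD cq).
- exact: (image_closed x0 sN embN clN).
- move=> x1 g M0x1 cg.
  have E := @image_path_integral R M (p' @` B) N x0 sN embN QN tN f prN g x0 x1 M0x M0x1 cg.
  by rewrite E addrC subrK.
Qed.

(** * Surfaces with the same Gauss image *)

Section Translations.
Context {R : realType} {M1 M2 : topologicalType}.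
Variables (D1 : set M1) (D2 : set M2) (f1 : M1 -> 'rV[R]_3) (f2 : M2 -> 'rV[R]_3).
Variables (o1' : M1 -> set ('rV[R]_3 * 'rV[R]_3)) (o2' : M2 -> set ('rV[R]_3 * 'rV[R]_3)).
Variable h : M1 -> M2.
Hypothesis m1 : minimal_surface D1 f1 o1'.
Hypothesis m2 : minimal_surface D2 f2 o2'.
Hypothesis K1 : forall x, D1 x -> gauss_curvature D1 f1 o1' x != 0.
Hypothesis K2 : forall x, D2 x -> gauss_curvature D2 f2 o2' x != 0.
Hypothesis hD : forall x, D1 x -> D2 (h x).
Hypothesis ch : forall x, D1 x -> {for x, continuous h}.

Local Notation N1 := (gauss_diff D1 f1 o1').
Local Notation N2 := (gauss_diff D2 f2 o2').

(** Along h the base points s and the operators q of both surfaces agree,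
    and f2 satisfies d phi = omega along h by primitive_along. *)
Lemma pullback_primitive : (forall x, D1 x -> N2 (h x) = N1 x) ->
  omega_primitive D1 N1 (f2 \o h).
Proof.
move=> NE x Dx; have [U [p [cp px]]] := (gauss_diff_surface m1 K1).2 x Dx.
have [oU _ _ _ [CN _]] := cp.
have Dp u : U u -> D1 (p u) by exact: (chart_dom cp).
have chp u : U u -> {for u, continuous (h \o p)}.
  by move=> Uu; apply: continuous_comp; [exact: (chart_continuous cp)|exact/ch/Dp].
have E u : U u -> (fst \o N1 \o p) u = (fst \o N2 \o (h \o p)) u.
  by move=> Uu; rewrite /= -[X in _ = X]/((N2 (h (p u))).1) NE//; exact: Dp.
have Cs k : Ck k U (fst \o N2 \o (h \o p)) := Ck_ext oU E (Ck_fst oU (CN k)).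
have [Cf Df] := primitive_along (gauss_diff_Qnz m2 K2) (gauss_diff_transverse m2 K2)
  (immersion_primitive m2 K2) oU chp (fun u Uu => hD (Dp u Uu)) Cs.
exists U, p; split => // u w Uu.
rewrite (derive_ext w oU E Uu); apply: etrans (Df u w Uu) _.
by rewrite -(NE (p u) (Dp u Uu)).
Qed.

(** Both f1 and f2 o h are primitives of omega along the same surface, so
    they differ by a locally constant function. *)
Lemma equal_gauss_diff_translation : connected D1 ->
  (forall x, D1 x -> N2 (h x) = N1 x) ->
  exists c : 'rV[R]_3, forall x, D1 x -> f2 (h x) = f1 x + c /\ o2' (h x) = o1' x.
Proof.
move=> cD1 NE.
have o2E x : D1 x -> o2' (h x) = o1' x.
  move=> Dx; rewrite (orientation_frames m1 Dx) (orientation_frames m2 (hD Dx)).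
  by have /(congr1 fst) /= -> := NE x Dx.
have prim := pullback_primitive NE.
have lc x : D1 x -> \forall y \near x, D1 y -> f2 (h y) - f1 y = f2 (h x) - f1 x.
  move=> Dx; have := primitives_differ_by_constant (gauss_diff_surface m1 K1)
    (gauss_diff_Qnz m1 K1) (gauss_diff_transverse m1 K1) prim (immersion_primitive m1 K1) Dx.
  by apply: filterS => y ->.
have const := connected_locally_constant (g := fun x => f2 (h x) - f1 x) cD1 lc.
have [D0|/set0P[x Dx]] := eqVneq D1 set0.
  by exists 0 => y; rewrite D0.
exists (f2 (h x) - f1 x) => y Dy; split; last exact: o2E.
by rewrite (const x y Dx Dy) addrC subrK.
Qed.

Lemma translation_gauss_diff (c : 'rV[R]_3) :
  (forall x, D1 x -> f2 (h x) = f1 x + c /\ o2' (h x) = o1' x) ->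
  forall x, D1 x -> N2 (h x) = N1 x.
Proof.
move=> H.
have gE x : D1 x -> gauss_map o2' (h x) = gauss_map o1' x.
  by move=> Dx; rewrite /gauss_map; have [_ ->] := H x Dx.
move=> x Dx.
suff S : shape_operator D1 f1 o1' x (N2 (h x)).2.
  have [_ or1 _] := m1.
  by rewrite (gauss_diffE or1 Dx S) -(gE x Dx).
have [nA _] := gauss_shape K2 (hD Dx).
split; first by rewrite -(gE x Dx).
move=> U p u w cp Uu pu; have [oU _ _ _ [Cf _]] := cp.
have Dp v : U v -> D1 (p v) by exact: (chart_dom cp).
have chp v : U v -> {for v, continuous (h \o p)}.
  by move=> Uv; apply: continuous_comp; [exact: (chart_continuous cp)|exact/ch/Dp].
have E v : U v -> (f1 \o p) v + c = (f2 \o (h \o p)) v.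
  by move=> Uv /=; have [->] := H _ (Dp v Uv).
have C2 k : Ck k U (f2 \o (h \o p)).
  by apply: (Ck_ext oU E); apply: CkD => //; exact: Ck_cst.
have [_ _ _ Dn] := gauss_map_along m2 K2 oU chp (fun v Uv => hD (Dp v Uv)) C2.
have E' v : U v -> (gauss_map o1' \o p) v = (gauss_map o2' \o (h \o p)) v.
  by move=> Uv /=; rewrite gE//; exact: Dp.
have D12 : 'D_w (f2 \o (h \o p)) u = 'D_w (f1 \o p) u.
  by rewrite -(derive_ext w oU E Uu); exact: derive_add_cst.
apply: etrans (esym (derive_ext w oU E' Uu)).
apply: etrans (esym (Dn u w Uu)); rewrite D12.
by rewrite /= pu.
Qed.

End Translations.

(** * The local equivalence *)

Theorem mainTheorem1 (R : realType) :
  (* (1): M0 is the immersed surface (C0, phi), which may cross itself when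
     phi is not injective (Enneper's surface); where phi is a topological
     embedding, M0 is the subset phi (C1) of R^3 *)
  (forall (C : topologicalType) (i : C -> ambient R),
     surface setT i -> (forall q, Qnz (i q)) ->
     omega_closed setT i -> transverse setT i ->
     forall (q0 : C) (x0 : 'rV[R]_3) (C0 : set C) (a : C) (g0 : R -> C),
     open C0 -> simply_connected R C0 -> C0 a ->
     smooth_curve setT i g0 q0 a ->
     exists phi : C -> 'rV[R]_3,
       [/\ forall (q1 : C) (g : R -> C), smooth_curve C0 i g a q1 ->
             phi q1 = x0 + path_integral (i \o g0) + path_integral (i \o g),
           parametrizes_minimal C0 i C0 phi id,
           forall C1 : set C, open C1 -> C1 `<=` C0 ->
             topological_embedding C1 phi ->
             parametrizes_minimal C1 i (T' := subspace (phi @` C1))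
               (phi @` C1) id phi &
           forall q, C0 q -> exists C1 : set C,
             [/\ open C1, C1 `<=` C0, C1 q & topological_embedding C1 phi]])
  /\
  (* (2) *)
  (forall (M : topologicalType) (f : M -> 'rV[R]_3)
          (o : M -> set ('rV[R]_3 * 'rV[R]_3)),
     minimal_surface setT f o -> (forall x, gauss_curvature setT f o x != 0) ->
     let N := gauss_diff setT f o in
     forall x0 : M, exists M0 : set M,
       [/\ open M0, connected M0, M0 x0 &
         let C0 := N @` M0 in
         let i := id : subspace C0 -> ambient R in
         [/\ surface (T := subspace C0) C0 i,
             C0 `<=` Qnz /\ transverse (T := subspace C0) C0 i,
             diffeo M0 f (T' := subspace C0) C0 i N,
             omega_closed (T := subspace C0) C0 i &
             forall (x1 : M) (g : R -> subspace C0), M0 x1 ->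
               smooth_curve C0 i g (N x0) (N x1) ->
               f x1 = f x0 + path_integral (i \o g)]])
  /\
  (* local equivalence: surjectivity on germs *)
  (forall (C : topologicalType) (i : C -> ambient R),
     surface setT i -> (forall q, Qnz (i q)) ->
     omega_closed setT i -> transverse setT i ->
     forall q : C, exists (D : set C) (f : C -> 'rV[R]_3)
                          (o : C -> set ('rV[R]_3 * 'rV[R]_3)),
       [/\ open D /\ D q, minimal_surface D f o,
           diffeo D i D f id,
           forall x, D x -> gauss_curvature D f o x != 0 &
           forall x, D x -> gauss_diff D f o x = i x])
  /\
  (* local equivalence: the fibers are the orbits of the translations *)
  (forall (M1 M2 : topologicalType) (D1 : set M1) (D2 : set M2)
          (f1 : M1 -> 'rV[R]_3) (f2 : M2 -> 'rV[R]_3)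
          (o1 : M1 -> set ('rV[R]_3 * 'rV[R]_3))
          (o2 : M2 -> set ('rV[R]_3 * 'rV[R]_3)) (h : M1 -> M2),
     minimal_surface D1 f1 o1 -> minimal_surface D2 f2 o2 ->
     (forall x, D1 x -> gauss_curvature D1 f1 o1 x != 0) ->
     (forall x, D2 x -> gauss_curvature D2 f2 o2 x != 0) ->
     connected D1 -> diffeo D1 f1 D2 f2 h ->
     (forall x, D1 x ->
        gauss_diff D2 f2 o2 (h x) = gauss_diff D1 f1 o1 x) <->
     exists c : 'rV[R]_3, forall x, D1 x ->
       f2 (h x) = f1 x + c /\ o2 (h x) = o1 x).
Proof.
split; [|split; [|split]].
- move=> C i sC QC clC tC q0 x0 C0 a g0 oC0 scC0 C0a cg0.
  have [phi [H1 H2 H3 H4]] := integrate_closed_form sC QC clC tC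
    (x0 + path_integral (i \o g0)) oC0 scC0 C0a.
  by exists phi; split.
- exact: gauss_image_of_minimal_surface.
- move=> C i sC QC clC tC q; exact: (germ_of_minimal_surface sC QC clC tC).
- move=> M1 M2 D1 D2 f1 f2 o1' o2' h m1 m2 K1 K2 cD1 [hbij [ch _] _].
  have hD x : D1 x -> D2 (h x) by have [+ _ _] := hbij; apply.
  split; first exact: equal_gauss_diff_translation.
  move=> [c H]; exact: (translation_gauss_diff m1 m2 K2 hD ch H).
Qed.
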